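(* Let $\mathfrak g$ be a classical Lie superalgebra over $\mathbb K$, not of type $A(1,1)$, $P(3)$, $Q(n)$, nor $D(2,1;a)$ with $a\notin\mathbb Z$, with a fixed Chevalley basis. Let $V$ be a rational, finite dimensional $\mathfrak g$-module, $M$ an admissible lattice of $V$, and $\mathfrak g_V=\{X\in\mathfrak g : X.M\subseteq M\}$. If $V$ is faithful, then $$\mathfrak g_V=\mathfrak h_V\oplus\Big(\bigoplus_{\alpha\in\Delta}\mathbb Z\,X_\alpha\Big),\qquad \mathfrak h_V:=\{H\in\mathfrak h : \mu(H)\in\mathbb Z\ \ \forall\,\mu\in\Lambda\},$$ where $\Lambda$ is the set of all weights of $V$. In particular, $\mathfrak g_V$ is a lattice in $\mathfrak g$, and it is independent of the choice of the admissible lattice $M$ (but not of $V$).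
   Context: $\mathbb K$ is an algebraically closed field of characteristic $0$. A finite dimensional non-Abelian Lie superalgebra $\mathfrak g=\mathfrak g_0\oplus\mathfrak g_1$ over $\mathbb K$ is classical if it has no nontrivial homogeneous ideals and $\mathfrak g_1$ is completely reducible as a $\mathfrak g_0$-module; by Kac these are the simple Lie algebras and $A(m,n),B(m,n),C(n),D(m,n),F(4),G(3),D(2,1;a),P(n),Q(n)$ (Kac's notation), where $P(n)=\big\{\begin{pmatrix}A&B\\C&-A^t\end{pmatrix}: A\in\mathfrak{sl}(n+1),\,B^t=B,\,C^t=-C\big\}$. Roots. $\mathfrak h$ is a fixed Cartan subalgebra of $\mathfrak g_0$; $\mathfrak g_\alpha=\{x\in\mathfrak g: [h,x]=\alpha(h)x\ \forall h\in\mathfrak h\}$; $\Delta_0=\{\alpha\ne0:\mathfrak g_\alpha\cap\mathfrak g_0\neq0\}$, $\Delta_1=\{\alpha:\mathfrak g_\alpha\cap\mathfrak g_1\ne0\}$, $\Delta=\Delta_0\cup\Delta_1$; $\ell=\dim\mathfrak h$. On $\mathfrak h$ and $\mathfrak h^*$ one has a nondegenerate symmetric form $(\ ,\ )$: the restriction of an even nondegenerate invariant form on $\mathfrak g$ if $\mathfrak g$ is not of type $P(n)$, and the one coming from $\mathfrak g_0\cong\mathfrak{sl}(n+1)$ for $P(n)$. Fix a distinguished simple root system $\Pi$ (all its elements even except one, if $\mathfrak g_1\neq0$; every root is a sum of elements of $\Pi$, ''positive'', or the opposite of such a sum, ''negative''); $\Delta^\pm$ are the positive/negative roots, $\Delta_i^\pm=\Delta^\pm\cap\Delta_i$.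 Coroots. If $\mathfrak g$ is not of type $P(n)$, $H_\alpha\in\mathfrak h$ is proportional to the element dual to $\alpha$ under the form, normalized by $\alpha(H_\alpha)=2$ if $(\alpha,\alpha)\ne0$, and, if $(\alpha,\alpha)=0$, so that the numbers $\beta(H_\alpha)$ $(\beta\in\Delta)$ generate $\mathbb Z$ (unique up to an immaterial sign, with $H_{-\alpha}=-H_\alpha$). For $P(n)$, with $\varepsilon_i$ the diagonal coordinates, the even roots are $\alpha_{i,j}=\varepsilon_i-\varepsilon_j$ with usual coroots, the odd ones are $\pm\beta_{i,j}$, $\beta_{i,j}=\beta_{j,i}=\varepsilon_i+\varepsilon_j$ $(i<j)$, and $\gamma_i=2\varepsilon_i$; the positive odd roots are the $\beta_{i,j}$ and $\gamma_i$; $H_{\pm\beta_{i,j}}:=\pm H_{\alpha_{i,j}}$ $(i<j)$; sums and strings of roots of $P(n)$ are computed formally in the free $\mathbb Z$-module on $\varepsilon_1,\dots,\varepsilon_{n+1}$. The $\alpha$-string through $\beta$ is $\{\beta-r\alpha,\dots,\beta+q\alpha\}$ with $r,q\geq0$ largest such that $\beta+j\alpha\in\Delta\cup\{0\}$ for $-r\le j\le q$. A Chevalley basis of $\mathfrak g$ is a homogeneous $\mathbb K$-basis $\{H_1,\dots,H_\ell\}\sqcup\{X_\alpha\}_{\alpha\in\Delta}$ such that: (a) $\{H_i\}$ is a $\mathbb K$-basis of $\mathfrak h$, and $\mathfrak h_{\mathbb Z}:=\mathrm{Span}_{\mathbb Z}(H_1,\dots,H_\ell)=\mathrm{Span}_{\mathbb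 Z}\{H_\alpha:\alpha\in\Delta\cap(-\Delta)\}$; (b) $[H_i,H_j]=0$, $[H_i,X_\alpha]=\alpha(H_i)X_\alpha$; (c) $[X_\alpha,X_{-\alpha}]=\sigma_\alpha H_\alpha$ for $\alpha\in\Delta\cap(-\Delta)$, with $\sigma_\alpha=-1$ if $\alpha\in\Delta_1^-$ and $\sigma_\alpha=1$ otherwise; (d) $[X_\alpha,X_\beta]=c_{\alpha,\beta}X_{\alpha+\beta}$ for $\alpha\ne-\beta$, where: if $\alpha+\beta\notin\Delta$, then $c_{\alpha,\beta}=0$, $X_{\alpha+\beta}:=0$; if $\alpha+\beta\in\Delta$ and $(\alpha,\alpha)\ne0$ or $(\beta,\beta)\neq0$, then $c_{\alpha,\beta}=\pm(r+1)$ with $r$ from the $\alpha$-string through $\beta$, except that $c_{\alpha,\beta}=\pm(r+2)$ if $\mathfrak g=P(n)$, $\alpha=\beta_{j,i}$, $\beta=\alpha_{i,j}$; if $\alpha+\beta\in\Delta$ and $(\alpha,\alpha)=0=(\beta,\beta)$, then $c_{\alpha,\beta}=\pm\beta(H_\alpha)$. Kostant superalgebra: $K_{\mathbb Z}(\mathfrak g)$ is the unital $\mathbb Z$-subsuperalgebra of $U(\mathfrak g)$ generated by all $X_\alpha^{(n)}:=X_\alpha^n/n!$ $(\alpha\in\Delta_0)$, $X_\gamma$ $(\gamma\in\Delta_1)$, $\binom{H_i}{n}:=H_i(H_i-1)\cdots(H_i-n+1)/n!$, $n\in\mathbb N$, $1\le i\le\ell$. A $\mathbb Z$-lattice of a finite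 dimensional $\mathbb K$-space $V$ is the $\mathbb Z$-span of a $\mathbb K$-basis of $V$. A $\mathfrak g$-module $V$ is rational if $V=\bigoplus_{\mu\in\mathfrak h^*}V_\mu$ with $V_\mu=\{v: h.v=\mu(h)v\ \forall h\in\mathfrak h\}$, and $\mu(H_i)\in\mathbb Z$ for all $i$ and all weights $\mu$ (i.e. $V_\mu\neq0$). A $\mathbb Z$-lattice $M$ of $V$ is admissible if it is $K_{\mathbb Z}(\mathfrak g)$-stable. *)

(* Defs.v *)
From HB Require Import structures.
From mathcomp Require Import all_boot all_order all_algebra.
From mathcomp Require Import generic_quotient boolp.

Set Implicit Arguments.
Unset Strict Implicit.
Unset Printing Implicit Defensive.

Import GRing.Theory.

Local Open Scope ring_scope.
Local Open Scope quotient_scope.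

(* [Zspan S v]: [v] lies in the additive subgroup generated by [S]. *)
Definition Zspan (V : zmodType) (S : V -> Prop) (v : V) : Prop :=
  exists s : seq (int * V),
    (forall p, p \in s -> S p.2) /\ v = \sum_(p <- s) p.2 *~ p.1.

Definition is_lattice (K : fieldType) (V : vectType K) (M : V -> Prop) : Prop :=
  exists b : seq V, basis_of fullv b /\
    (forall v, M v <-> Zspan (fun w => w \in b) v).

(* [false] is the even parity and [true] the odd one. Over a field of
   characteristic 2 or 3 more axioms would be needed. *)
Record lieSuper (K : fieldType) := LieSuper {
  lie_sort :> vectType K;
  lpart : bool -> {vspace lie_sort};
  br : lie_sort -> lie_sort -> lie_sort;
  lpart_sum : (lpart false + lpart true)%VS = fullv;
  lpart_cap : (lpart false :&: lpart true)%VS = 0%VS;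
  br_linearl : forall c x y z, br (c *: x + y) z = c *: br x z + br y z;
  br_linearr : forall c x y z, br z (c *: x + y) = c *: br z x + br z y;
  br_part : forall a b x y,
    x \in lpart a -> y \in lpart b -> br x y \in lpart (a (+) b);
  br_skew : forall a b x y,
    x \in lpart a -> y \in lpart b -> br x y = - ((-1) ^+ (a && b) *: br y x);
  br_jacobi : forall a b x y z, x \in lpart a -> y \in lpart b ->
    br x (br y z) = br (br x y) z + (-1) ^+ (a && b) *: br y (br x z)
}.

Section Classical.
Variables (K : fieldType) (g : lieSuper K).

Definition homogeneous_ideal (I : {vspace g}) : Prop :=
  I = ((I :&: lpart g false) + (I :&: lpart g true))%VS /\
  (forall x y : g, y \in I -> br x y \in I).

Definition even_submodule (W : {vspace g}) : Prop :=
  forall x w : g, x \in lpart g false -> w \in W -> br x w \in W.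

Definition classical : Prop :=
  [/\ exists x y : g, br x y <> 0,
      forall I, homogeneous_ideal I -> I = 0%VS \/ I = fullv
    & forall W, (W <= lpart g true)%VS -> even_submodule W ->
        exists W', [/\ even_submodule W', (W + W')%VS = lpart g true
                     & (W :&: W')%VS = 0%VS] ].

(* Cartan subalgebra of the Lie algebra [lpart g false]: a nilpotent
   subalgebra which is its own normalizer. *)
Definition is_cartan (h : {vspace g}) : Prop :=
  [/\ (h <= lpart g false)%VS,
      forall x y : g, x \in h -> y \in h -> br x y \in h,
      exists n, forall (s : seq g) y, size s = n ->
        {subset s <= h} -> y \in h -> foldr (@br _ g) y s = 0
    & forall x, x \in lpart g false ->
        (forall y, y \in h -> br x y \in h) -> x \in h].

End Classical.

Section GeneralLinear.
Variables (K : fieldType) (p q : nat).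
Implicit Types x y : 'M[K]_(p + q).

Definition gl_even x : 'M[K]_(p + q) :=
  block_mx (ulsubmx x) 0 0 (drsubmx x).
Definition gl_odd x : 'M[K]_(p + q) :=
  block_mx 0 (ursubmx x) (dlsubmx x) 0.

(* x y - (-1)^(|x||y|) y x, extended bilinearly *)
Definition gl_br x y : 'M[K]_(p + q) :=
  x *m y - gl_even y *m x - gl_odd y *m gl_even x + gl_odd y *m gl_odd x.

(* g is isomorphic to S / Z, for a subsuperalgebra S of gl(p|q) and an ideal Z
   of S: there is a surjective morphism S -> g with kernel Z. The linear map is
   defined on the whole matrix space, but only its values on S matter. *)
Definition gl_subquotient (S Z : 'M[K]_(p + q) -> Prop) (g : lieSuper K) :=
  exists f : 'Hom('M[K]_(p + q), g),
    [/\ forall x : g, exists2 m, S m & f m = x,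
        forall m, S m -> (f m = 0 <-> Z m),
        forall m n, S m -> S n -> f (gl_br m n) = br (f m) (f n)
      & forall m, S m ->
          f (gl_even m) \in lpart g false /\ f (gl_odd m) \in lpart g true].

End GeneralLinear.

Section Types.
Variables (K : fieldType) (g : lieSuper K).

(* A(1,1) = sl(2|2) / K.1 *)
Definition type_A11 : Prop :=
  @gl_subquotient K 2 2
    (fun m => \tr (ulsubmx m) - \tr (drsubmx m) = 0)
    (fun m => exists c : K, m = c%:M) g.

Definition Qtilde n (m : 'M[K]_(n.+1 + n.+1)) : Prop :=
  exists A B : 'M[K]_n.+1, \tr B = 0 /\ m = block_mx A B B A.

Definition type_Q n : Prop :=
  (2 <= n)%N /\
  @gl_subquotient K n.+1 n.+1 (@Qtilde n) (fun m => exists c : K, m = c%:M) g.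

Definition Pmatrix n (m : 'M[K]_(n.+1 + n.+1)) : Prop :=
  exists A B C : 'M[K]_n.+1,
    [/\ \tr A = 0, B^T = B, C^T = - C & m = block_mx A B C (- A^T)].

(* [phi] is an isomorphism of g onto P(n) *)
Definition iso_P n (phi : 'Hom(g, 'M[K]_(n.+1 + n.+1))) : Prop :=
  [/\ (2 <= n)%N,
      lker phi = 0%VS,
      forall m, (exists x, phi x = m) <-> Pmatrix m,
      forall x y, phi (br x y) = gl_br (phi x) (phi y)
    & forall x, (x \in lpart g false -> gl_odd (phi x) = 0) /\
                (x \in lpart g true -> gl_even (phi x) = 0)].

Definition type_P n : Prop := exists phi, @iso_P n phi.

Definition cartan_D21 (a : K) : 'M[K]_3 :=
  \matrix_(i, j) nth 0 (nth [::] [:: [:: 0; 1; a];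
                                     [:: -1; 2; 0];
                                     [:: -1; 0; 2] ] i) j.

(* D(2,1;a), as the contragredient Lie superalgebra with the above Cartan matrix, the first
   simple root being odd. The last condition says that no nonzero homogeneous
   ideal meets the local part trivially. *)
Definition type_D21 (a : K) : Prop :=
  a <> 0 /\ a <> -1 /\
  exists e f h : 'I_3 -> g,
    [/\ forall i, [/\ e i \in lpart g (i == 0), f i \in lpart g (i == 0)
                    & h i \in lpart g false],
        free (codom h),
        forall i j, [/\ br (e i) (f j) = (if i == j then h i else 0),
                        br (h i) (h j) = 0,
                        br (h i) (e j) = cartan_D21 a i j *: e j
                      & br (h i) (f j) = - (cartan_D21 a i j *: f j)],
        forall W : {vspace g},
          (forall i, [/\ e i \in W, f i \in W & h i \in W]) ->
          (forall x y, x \in W -> y \in W -> br x y \in W) -> W = fullv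
      & forall I : {vspace g}, homogeneous_ideal I ->
          (I :&: <<codom e ++ codom f ++ codom h>>)%VS = 0%VS -> I = 0%VS].

(* The algebras D(2,1;a) for a in an orbit of the symmetric group S_3 (generated
   by a -> 1/a and a -> -1-a) are isomorphic, so g is regarded as being of type
   D(2,1;a) with a not an integer only when no integral parameter yields g. *)
Definition type_D21_nonint : Prop :=
  (exists a, type_D21 a) /\ (forall z : int, ~ type_D21 z%:~R).

End Types.

(* The roots live in an abelian group [lat] : the dual of the Cartan subalgebra
   in general, the free Z-module on the epsilon_i for P(n). *)
Record rootDatum (K : fieldType) (g : lieSuper K) := RootDatum {
  lat : zmodType;
  (* the value of a weight at an element of the Cartan subalgebra *)
  wt : lat -> g -> K;
  evroot : lat -> Prop;
  odroot : lat -> Prop;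
  (* only its restriction to the Cartan subalgebra is used *)
  form : g -> g -> K;
  coroot_spec : (lat -> g) -> Prop;
  (* the pairs of roots (beta_ji, alpha_ij) of P(n) *)
  exceptional : lat -> lat -> Prop;
  (* for P(n), the prescribed positive odd roots *)
  positive_spec : (lat -> Prop) -> Prop
}.

Section RootNotions.
Variables (K : fieldType) (g : lieSuper K) (h : {vspace g}).

Definition wt_space (w : g -> K) (x : g) : Prop :=
  forall y, y \in h -> br y x = w y *: x.

(* [t] is the element of h dual to the weight [w] under [B] *)
Definition form_dual (B : g -> g -> K) (w : g -> K) (t : g) : Prop :=
  t \in h /\ (forall y, y \in h -> B t y = w y).

Definition sqnorm0 (B : g -> g -> K) (w : g -> K) : Prop :=
  exists2 t, form_dual B w t & B t t = 0.

Section Basic.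

Let hdual : vectType K := 'Hom(subvs_of h, K^o).
Variable B : g -> g -> K.

Definition hdual_wt (al : hdual) (y : g) : K := al (vsproj h y).

Definition basic_evroot (al : hdual) : Prop :=
  al <> 0 /\
  exists x, [/\ x <> 0, x \in lpart g false & wt_space (hdual_wt al) x].

Definition basic_odroot (al : hdual) : Prop :=
  exists x, [/\ x <> 0, x \in lpart g true & wt_space (hdual_wt al) x].

Definition basic_root (al : hdual) : Prop := basic_evroot al \/ basic_odroot al.

Definition basic_coroot (H : hdual -> g) : Prop :=
  forall al, basic_root al ->
    [/\ exists t c, form_dual B (hdual_wt al) t /\ H al = c *: t,
        ~ sqnorm0 B (hdual_wt al) -> hdual_wt al (H al) = 2,
        sqnorm0 B (hdual_wt al) -> forall c : K,
          Zspan (fun d => exists2 be, basic_root be & d = hdual_wt be (H al)) c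
          <-> (exists z : int, c = z%:~R)
      & H (- al) = - H al].

Definition basic_datum : rootDatum g :=
  @RootDatum K g hdual hdual_wt basic_evroot basic_odroot B basic_coroot
    (fun _ _ => False) (fun _ => True).

Definition invariant_form : Prop :=
  [/\ forall c x y z, B (c *: x + y) z = c * B x z + B y z
        /\ B z (c *: x + y) = c * B z x + B z y,
      forall x y, x \in lpart g false -> y \in lpart g true -> B x y = 0,
      forall a b x y, x \in lpart g a -> y \in lpart g b ->
        B x y = (-1) ^+ (a && b) * B y x,
      forall x y z, B (br x y) z = B x (br y z)
    & forall x, (forall y, B x y = 0) -> x = 0].

End Basic.

Section Strange.

Variables (n : nat) (phi : 'Hom(g, 'M[K]_(n.+1 + n.+1))).

Let epslat : zmodType := 'rV[int]_n.+1.
Let eps (i : 'I_n.+1) : epslat := delta_mx 0 i.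

Definition P_alpha i j : epslat := eps i - eps j.
Definition P_beta i j : epslat := eps i + eps j.
Definition P_gamma i : epslat := eps i *+ 2.

Definition P_wt (la : epslat) (y : g) : K :=
  \sum_(i < n.+1) (la 0 i)%:~R * ulsubmx (phi y) i i.

Definition P_evroot (la : epslat) : Prop :=
  exists i j, i != j /\ la = P_alpha i j.

Definition P_odroot_pos (la : epslat) : Prop :=
  (exists i j : 'I_n.+1, (i < j)%N /\ la = P_beta i j) \/
  (exists i, la = P_gamma i).

Definition P_odroot (la : epslat) : Prop :=
  P_odroot_pos la \/ (exists i j : 'I_n.+1, (i < j)%N /\ la = - P_beta i j).

Definition P_form (x y : g) : K := \tr (ulsubmx (phi x) *m ulsubmx (phi y)).

Definition P_coroot (H : epslat -> g) : Prop :=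
  (forall i j, i != j ->
     phi (H (P_alpha i j)) =
       block_mx (delta_mx i i - delta_mx j j) 0
                0 (- (delta_mx i i - delta_mx j j))) /\
  (forall i j : 'I_n.+1, (i < j)%N ->
     H (P_beta i j) = H (P_alpha i j) /\ H (- P_beta i j) = - H (P_alpha i j)).

Definition P_exceptional (la mu : epslat) : Prop :=
  exists i j, [/\ i != j, la = P_beta j i & mu = P_alpha i j].

Definition P_positive (pos : epslat -> Prop) : Prop :=
  forall la, P_odroot la -> (pos la <-> P_odroot_pos la).

Definition P_datum : rootDatum g :=
  @RootDatum K g epslat P_wt P_evroot P_odroot P_form P_coroot
    P_exceptional P_positive.

End Strange.

(* How the root system of g with respect to h is set up: by means of an
   invariant form if g is not of type P(n), and of an isomorphism with P(n)
   taking h to the diagonal matrices otherwise. *)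
Inductive rootModel : Type :=
  | BasicModel (B : g -> g -> K)
  | StrangeModel (n : nat) (phi : 'Hom(g, 'M[K]_(n.+1 + n.+1))).

Definition model_ok (m : rootModel) : Prop :=
  match m with
  | BasicModel B => (forall n, ~ type_P g n) /\ invariant_form B
  | StrangeModel n phi =>
      iso_P phi /\ (forall x, x \in h <-> is_diag_mx (phi x))
  end.

Definition model_datum (m : rootModel) : rootDatum g :=
  match m with
  | BasicModel B => basic_datum B
  | StrangeModel n phi => P_datum phi
  end.

End RootNotions.

Section Chevalley.
Variables (K : fieldType) (g : lieSuper K) (h : {vspace g}) (R : rootDatum g).
Implicit Types (roots simple pos : seq (lat R)) (al be : lat R).

Definition is_root al : Prop := evroot al \/ odroot al.
Definition root0 al : Prop := is_root al \/ al = 0.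
Definition isotropic al : Prop := sqnorm0 h (@form _ _ R) (wt al).

Definition sum_of simple al : Prop :=
  exists s : seq (lat R), {subset s <= simple} /\ al = \sum_(x <- s) x.

(* In type A(n,n) the elements of a simple system are linearly dependent in the
   dual of h, with a positive combination vanishing, so that a root may be both
   a sum of simple roots and the opposite of one. The condition on brackets
   selects the intended positive system; in the other types it is automatic. *)
Definition distinguished roots simple pos : Prop :=
  [/\ {subset simple <= pos} /\ {subset pos <= roots},
      forall al, al \in roots ->
        (al \in pos -> sum_of simple al) /\
        (al \notin pos -> sum_of simple (- al)),
      (forall al, al \in pos -> - al \notin pos) /\
      (forall al be x y, al \in pos -> be \in pos ->
         wt_space h (wt al) x -> wt_space h (wt be) y -> br x y <> 0 ->
         al + be \in pos),
      forall al, al \in simple ->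
        ~ exists be be', [/\ be \in pos, be' \in pos & al = be + be']
    & if lpart g true == 0%VS then forall al, al \in simple -> evroot al
      else exists2 al, al \in simple /\ odroot al
             & forall be, be \in simple -> be <> al -> evroot be].

(* [be - r al] is the beginning of the [al]-string through [be] *)
Definition string_start al be (r : nat) : Prop :=
  (forall j, (j <= r)%N -> root0 (be - al *+ j)) /\ ~ root0 (be - al *+ r.+1).

Definition eq_upto_sign (c d : K) : Prop := c = d \/ c = - d.

Definition is_chevalley_basis roots pos (cr : lat R -> g)
    (H : 'I_(\dim h) -> g) (X : lat R -> g) : Prop :=
  [/\ basis_of fullv (codom H ++ [seq X al | al <- roots]) /\
      (forall al, al \in roots ->
         X al \in lpart g false \/ X al \in lpart g true),
      basis_of h (codom H) /\
      (forall y, Zspan (fun z => exists i, z = H i) y <->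
         Zspan (fun z => exists al,
                  [/\ al \in roots, - al \in roots & z = cr al]) y),
      (forall i j, br (H i) (H j) = 0) /\
      (forall i al, al \in roots -> br (H i) (X al) = wt al (H i) *: X al),
      forall al, al \in roots -> - al \in roots ->
        (odroot al /\ al \notin pos -> br (X al) (X (- al)) = - cr al) /\
        (~ (odroot al /\ al \notin pos) -> br (X al) (X (- al)) = cr al)
    & forall al be, al \in roots -> be \in roots -> al <> - be ->
        (al + be \notin roots -> br (X al) (X be) = 0) /\
        (al + be \in roots -> exists2 c : K,
           br (X al) (X be) = c *: X (al + be) &
           (~ isotropic al \/ ~ isotropic be ->
              exists2 r, string_start al be r &
                (exceptional al be -> eq_upto_sign c r.+2%:R) /\
                (~ exceptional al be -> eq_upto_sign c r.+1%:R)) /\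
           (isotropic al /\ isotropic be ->
              eq_upto_sign c (wt be (cr al)))) ].

End Chevalley.

Record chevalleyBasis (K : fieldType) (g : lieSuper K) := ChevalleyBasis {
  cartan : {vspace g};
  cartanP : is_cartan cartan;
  cmodel : rootModel g;
  cmodelP : model_ok cartan cmodel;
  cdatum := model_datum cartan cmodel;
  croots : seq (lat cdatum);
  croots_uniq : uniq croots;
  crootsP : forall al, al \in croots <-> is_root al;
  csimple : seq (lat cdatum);
  cpos : seq (lat cdatum);
  cdistinguished : distinguished cartan croots csimple cpos;
  cposP : positive_spec (fun al => al \in cpos);
  ccoroot : lat cdatum -> g;
  ccorootP : coroot_spec ccoroot;
  cH : 'I_(\dim cartan) -> g;
  cX : lat cdatum -> g;
  chevalleyP : @is_chevalley_basis K g cartan cdatum croots cpos ccoroot cH cX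
}.
Arguments ccoroot {K g} c _ : rename.
Arguments cH {K g} c _ : rename.
Arguments cX {K g} c _ : rename.

Section Enveloping.
Variables (K : fieldType) (g : lieSuper K).

(* U(g) is the algebra of terms [uterm] modulo the congruence [ueq]. *)
Inductive uterm : Type :=
  | Ucst (c : K)
  | Ugen (x : g)
  | Uadd (s t : uterm)
  | Umul (s t : uterm).

Inductive ueq : uterm -> uterm -> Prop :=
  | ueq_refl s : ueq s s
  | ueq_sym s t : ueq s t -> ueq t s
  | ueq_trans s t u : ueq s t -> ueq t u -> ueq s u
  | ueq_add s s' t t' : ueq s s' -> ueq t t' -> ueq (Uadd s t) (Uadd s' t')
  | ueq_mul s s' t t' : ueq s s' -> ueq t t' -> ueq (Umul s t) (Umul s' t')
  | ueq_addA s t u : ueq (Uadd s (Uadd t u)) (Uadd (Uadd s t) u)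
  | ueq_addC s t : ueq (Uadd s t) (Uadd t s)
  | ueq_add0 s : ueq (Uadd (Ucst 0) s) s
  | ueq_addN s : ueq (Uadd (Umul (Ucst (-1)) s) s) (Ucst 0)
  | ueq_mulA s t u : ueq (Umul s (Umul t u)) (Umul (Umul s t) u)
  | ueq_mul1 s : ueq (Umul (Ucst 1) s) s
  | ueq_mulDl s t u : ueq (Umul (Uadd s t) u) (Uadd (Umul s u) (Umul t u))
  | ueq_mulDr s t u : ueq (Umul s (Uadd t u)) (Uadd (Umul s t) (Umul s u))
  | ueq_cstD c d : ueq (Uadd (Ucst c) (Ucst d)) (Ucst (c + d))
  | ueq_cstM c d : ueq (Umul (Ucst c) (Ucst d)) (Ucst (c * d))
  | ueq_cstC c s : ueq (Umul (Ucst c) s) (Umul s (Ucst c))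
  | ueq_gen c x y :
      ueq (Ugen (c *: x + y)) (Uadd (Umul (Ucst c) (Ugen x)) (Ugen y))
  | ueq_br a b x y : x \in lpart g a -> y \in lpart g b ->
      ueq (Umul (Ugen x) (Ugen y))
          (Uadd (Umul (Ucst ((-1) ^+ (a && b))) (Umul (Ugen y) (Ugen x)))
                (Ugen (br x y))).

Section Representation.
Variables (V : lmodType K) (act : g -> V -> V).

Definition is_representation : Prop :=
  [/\ forall c x y v, act (c *: x + y) v = c *: act x v + act y v,
      forall c x v w, act x (c *: v + w) = c *: act x v + act x w
    & forall a b x y v, x \in lpart g a -> y \in lpart g b ->
        act (br x y) v =
          act x (act y v) - (-1) ^+ (a && b) *: act y (act x v)].

Fixpoint ueval (t : uterm) (v : V) : V :=
  match t with
  | Ucst c => c *: v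
  | Ugen x => act x v
  | Uadd s t => ueval s v + ueval t v
  | Umul s t => ueval s (ueval t v)
  end.

Hypothesis actP : is_representation.

Lemma ueval_linear t c v w :
  ueval t (c *: v + w) = c *: ueval t v + ueval t w.
Proof.
case: actP => _ aV _; elim: t v w => /= [d|x|s IHs t IHt|s IHs t IHt] v w.
- by rewrite scalerDr !scalerA mulrC.
- exact: aV.
- by rewrite IHs IHt scalerDr addrACA.
- by rewrite IHt IHs.
Qed.

Lemma ueval_ueq s t : ueq s t -> ueval s =1 ueval t.
Proof.
have [aL aV aB] := actP.
have uD u v w : ueval u (v + w) = ueval u v + ueval u w.
  by have := ueval_linear u 1 v w; rewrite !scale1r.
have uZ u c v : ueval u (c *: v) = c *: ueval u v.
  have u0 : ueval u 0 = 0.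
    by apply: (addrI (ueval u 0)); rewrite -uD !addr0.
  by have := ueval_linear u c v 0; rewrite !addr0 u0 addr0.
elim=> {s t} /=.
- by [].
- by move=> s t _ IH v; rewrite IH.
- by move=> s t u _ IH1 _ IH2 v; rewrite IH1 IH2.
- by move=> s s' t t' _ IH1 _ IH2 v; rewrite IH1 IH2.
- by move=> s s' t t' _ IH1 _ IH2 v; rewrite IH2 IH1.
- by move=> s t u v; rewrite addrA.
- by move=> s t v; rewrite addrC.
- by move=> s v; rewrite scale0r add0r.
- by move=> s v; rewrite scaleN1r addNr scale0r.
- by [].
- by move=> s v; rewrite scale1r.
- by [].
- by move=> s t u v; rewrite uD.
- by move=> c d v; rewrite scalerDl.
- by move=> c d v; rewrite scalerA.
- by move=> c s v; rewrite uZ.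
- by move=> c x y v; rewrite aL.
- move=> a b x y xa yb v; rewrite (aB a b) //.
  by rewrite addrC subrK.
Qed.

End Representation.

HB.instance Definition _ := gen_eqMixin uterm.
HB.instance Definition _ := gen_choiceMixin uterm.

Definition ueqb (s t : uterm) : bool := `[< ueq s t >].

Fact ueqb_refl : reflexive ueqb.
Proof. by move=> s; apply/asboolP; apply: ueq_refl. Qed.
Fact ueqb_sym : symmetric ueqb.
Proof. by move=> s t; apply/asboolP/asboolP; apply: ueq_sym. Qed.
Fact ueqb_trans : transitive ueqb.
Proof.
by move=> t s u /asboolP st /asboolP tu; apply/asboolP; apply: ueq_trans tu.
Qed.

Canonical ueqb_equiv := EquivRel ueqb ueqb_refl ueqb_sym ueqb_trans.

Definition enveloping : Type := {eq_quot ueqb}.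
HB.instance Definition _ := Choice.on enveloping.
HB.instance Definition _ := EqQuotient.on enveloping.

Local Notation U := enveloping.

Lemma uclassP s t : ueq s t <-> \pi_U s = \pi_U t.
Proof.
split=> [st|/eqquotP/asboolP //].
by apply/eqquotP/asboolP.
Qed.

Lemma repr_ueq s : ueq (repr (\pi_U s)) s.
Proof. by apply/uclassP; rewrite reprK. Qed.

Definition Ucl_cst (c : K) : U := \pi_U (Ucst c).
Definition Ucl_add (x y : U) : U := \pi_U (Uadd (repr x) (repr y)).
Definition Ucl_mul (x y : U) : U := \pi_U (Umul (repr x) (repr y)).

Lemma Ucl_addE s t : Ucl_add (\pi_U s) (\pi_U t) = \pi_U (Uadd s t).
Proof. by apply/uclassP; apply: ueq_add; apply: repr_ueq. Qed.

Lemma Ucl_mulE s t : Ucl_mul (\pi_U s) (\pi_U t) = \pi_U (Umul s t).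
Proof. by apply/uclassP; apply: ueq_mul; apply: repr_ueq. Qed.

Definition Ucl_opp (x : U) : U := Ucl_mul (Ucl_cst (-1)) x.
Definition Ucl_scale (c : K) (x : U) : U := Ucl_mul (Ucl_cst c) x.

Fact Ucl_addA : associative Ucl_add.
Proof.
elim/quotW=> s; elim/quotW=> t; elim/quotW=> u.
rewrite (Ucl_addE t u) (Ucl_addE s t) (Ucl_addE s (Uadd t u)).
by rewrite (Ucl_addE (Uadd s t) u); apply/uclassP; apply: ueq_addA.
Qed.
Fact Ucl_addC : commutative Ucl_add.
Proof.
elim/quotW=> s; elim/quotW=> t; rewrite (Ucl_addE s t) (Ucl_addE t s).
by apply/uclassP; apply: ueq_addC.
Qed.
Fact Ucl_add0 : left_id (Ucl_cst 0) Ucl_add.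
Proof.
elim/quotW=> s; rewrite (Ucl_addE (Ucst 0) s).
by apply/uclassP; apply: ueq_add0.
Qed.
Fact Ucl_addN : left_inverse (Ucl_cst 0) Ucl_opp Ucl_add.
Proof.
elim/quotW=> s; rewrite /Ucl_opp (Ucl_mulE (Ucst (-1)) s).
rewrite (Ucl_addE (Umul (Ucst (-1)) s) s).
by apply/uclassP; apply: ueq_addN.
Qed.

HB.instance Definition _ :=
  GRing.isZmodule.Build U Ucl_addA Ucl_addC Ucl_add0 Ucl_addN.

Fact Ucl_mulA : associative Ucl_mul.
Proof.
elim/quotW=> s; elim/quotW=> t; elim/quotW=> u.
rewrite (Ucl_mulE t u) (Ucl_mulE s t) (Ucl_mulE s (Umul t u)).
by rewrite (Ucl_mulE (Umul s t) u); apply/uclassP; apply: ueq_mulA.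
Qed.
Fact Ucl_mul1 : left_id (Ucl_cst 1) Ucl_mul.
Proof.
elim/quotW=> s; rewrite (Ucl_mulE (Ucst 1) s).
by apply/uclassP; apply: ueq_mul1.
Qed.
Fact Ucl_mulr1 : right_id (Ucl_cst 1) Ucl_mul.
Proof.
elim/quotW=> s; rewrite (Ucl_mulE s (Ucst 1)); apply/uclassP.
exact: ueq_trans (ueq_sym (ueq_cstC 1 s)) (ueq_mul1 s).
Qed.
Fact Ucl_mulDl : left_distributive Ucl_mul +%R.
Proof.
elim/quotW=> s; elim/quotW=> t; elim/quotW=> u; rewrite /GRing.add /=.
rewrite (Ucl_addE s t) (Ucl_mulE s u) (Ucl_mulE t u) (Ucl_mulE (Uadd s t) u).
rewrite (Ucl_addE (Umul s u) (Umul t u)).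
by apply/uclassP; apply: ueq_mulDl.
Qed.
Fact Ucl_mulDr : right_distributive Ucl_mul +%R.
Proof.
elim/quotW=> s; elim/quotW=> t; elim/quotW=> u; rewrite /GRing.add /=.
rewrite (Ucl_addE t u) (Ucl_mulE s u) (Ucl_mulE s t) (Ucl_mulE s (Uadd t u)).
rewrite (Ucl_addE (Umul s t) (Umul s u)).
by apply/uclassP; apply: ueq_mulDr.
Qed.
Fact Ucl_1neq0 : Ucl_cst 1 != 0.
Proof.
apply/eqP=> /uclassP E.
have triv : is_representation (fun (_ : g) (_ : K^o) => 0 : K^o).
  by split=> *; rewrite ?scaler0 ?addr0 ?subr0.
have /eqP := ueval_ueq triv E (1 : K).
by rewrite /= scale1r scale0r oner_eq0.
Qed.

HB.instance Definition _ := GRing.Zmodule_isNzRing.Build U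
  Ucl_mulA Ucl_mul1 Ucl_mulr1 Ucl_mulDl Ucl_mulDr Ucl_1neq0.

Fact Ucl_scalerA c d (x : U) : Ucl_scale c (Ucl_scale d x) = Ucl_scale (c * d) x.
Proof.
rewrite /Ucl_scale Ucl_mulA; congr (Ucl_mul _ _).
by rewrite (Ucl_mulE (Ucst c) (Ucst d)); apply/uclassP; apply: ueq_cstM.
Qed.
Fact Ucl_scaler1 : left_id 1 Ucl_scale.
Proof. exact: Ucl_mul1. Qed.
Fact Ucl_scalerDr : right_distributive Ucl_scale +%R.
Proof. by move=> c x y; rewrite /Ucl_scale Ucl_mulDr. Qed.
Fact Ucl_scalerDl (x : U) : {morph Ucl_scale^~ x : c d / c + d}.
Proof.
move=> c d; rewrite /Ucl_scale -Ucl_mulDl; congr (Ucl_mul _ _).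
rewrite /GRing.add /= (Ucl_addE (Ucst c) (Ucst d)).
by apply/uclassP/ueq_sym; apply: ueq_cstD.
Qed.

HB.instance Definition _ := GRing.Zmodule_isLmodule.Build K U
  Ucl_scalerA Ucl_scaler1 Ucl_scalerDr Ucl_scalerDl.

Fact Ucl_scalerAl (c : K) (x y : U) : c *: (x * y) = (c *: x) * y.
Proof. exact: Ucl_mulA. Qed.

HB.instance Definition _ :=
  GRing.Lmodule_isLalgebra.Build K U Ucl_scalerAl.

Fact Ucl_scalerAr (c : K) (x y : U) : c *: (x * y) = x * (c *: y).
Proof.
have cstC z : Ucl_mul (Ucl_cst c) z = Ucl_mul z (Ucl_cst c).
  elim/quotW: z => s; rewrite (Ucl_mulE (Ucst c) s).
  by rewrite (Ucl_mulE s (Ucst c)); apply/uclassP; apply: ueq_cstC.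
transitivity (Ucl_mul (Ucl_cst c) (Ucl_mul x y)) => //.
by rewrite Ucl_mulA cstC -Ucl_mulA.
Qed.

HB.instance Definition _ :=
  GRing.Lalgebra_isAlgebra.Build K U Ucl_scalerAr.

Definition uinj (x : g) : U := \pi_U (Ugen x).

Definition uact (V : lmodType K) (act : g -> V -> V) (u : U) (v : V) : V :=
  ueval act (repr u) v.

End Enveloping.

Section UactTheory.
Variables (K : fieldType) (g : lieSuper K) (V : lmodType K).
Variable act : g -> V -> V.
Hypothesis actP : is_representation act.
Local Notation U := (enveloping g).

Lemma uact_pi (t : uterm g) v : uact act (\pi_U t) v = ueval act t v.
Proof. exact: (ueval_ueq actP (repr_ueq t)). Qed.

Lemma uact_inj x v : uact act (uinj x) v = act x v.
Proof. exact: uact_pi. Qed.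

Lemma uactD (u w : U) v : uact act (u + w) v = uact act u v + uact act w v.
Proof.
elim/quotW: u => s; elim/quotW: w => t.
have -> : \pi_U s + \pi_U t = \pi_U (Uadd s t) by exact: Ucl_addE.
by rewrite !uact_pi.
Qed.

Lemma uactM (u w : U) v : uact act (u * w) v = uact act u (uact act w v).
Proof.
elim/quotW: u => s; elim/quotW: w => t.
have -> : \pi_U s * \pi_U t = \pi_U (Umul s t) by exact: Ucl_mulE.
by rewrite !uact_pi.
Qed.

Lemma uactZ c (u : U) v : uact act (c *: u) v = c *: uact act u v.
Proof.
elim/quotW: u => s.
have -> : c *: \pi_U s = \pi_U (Umul (Ucst g c) s) by exact: Ucl_mulE.
by rewrite !uact_pi.
Qed.

Lemma uact1 v : uact act (1 : U) v = v.
Proof. by rewrite [LHS](uact_pi (Ucst g 1)) /= scale1r. Qed.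

End UactTheory.

Inductive subring_gen (A : nzRingType) (S : A -> Prop) : A -> Prop :=
  | subring_gen_in a : S a -> subring_gen S a
  | subring_gen_1 : subring_gen S 1
  | subring_gen_sub a b :
      subring_gen S a -> subring_gen S b -> subring_gen S (a - b)
  | subring_gen_mul a b :
      subring_gen S a -> subring_gen S b -> subring_gen S (a * b).

Section Kostant.
Variables (K : fieldType) (g : lieSuper K) (C : chevalleyBasis g).
Local Notation U := (enveloping g).

Definition divided_power (u : U) (n : nat) : U := (n`!%:R : K)^-1 *: u ^+ n.
Definition ubinomial (u : U) (n : nat) : U :=
  (n`!%:R : K)^-1 *: \prod_(k < n) (u - k%:R).

Definition kostant_generator (u : U) : Prop :=
  [\/ exists al n, evroot al /\ u = divided_power (uinj (cX C al)) n,
      exists al, odroot al /\ u = uinj (cX C al)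
    | exists i n, u = ubinomial (uinj (cH C i)) n].

Definition kostant : U -> Prop := subring_gen kostant_generator.

End Kostant.

Record superModule (K : fieldType) (g : lieSuper K) := SuperModule {
  mod_sort :> vectType K;
  mpart : bool -> {vspace mod_sort};
  mact : g -> mod_sort -> mod_sort;
  mpart_sum : (mpart false + mpart true)%VS = fullv;
  mpart_cap : (mpart false :&: mpart true)%VS = 0%VS;
  mact_part : forall a b x v,
    x \in lpart g a -> v \in mpart b -> mact x v \in mpart (a (+) b);
  mactP : is_representation mact
}.

Definition faithful (K : fieldType) (g : lieSuper K) (V : superModule g) :=
  forall x : g, (forall v : V, mact x v = 0) -> x = 0.

Section Rational.
Variables (K : fieldType) (g : lieSuper K) (C : chevalleyBasis g).
Variable V : superModule g.

Let hdual : vectType K := 'Hom(subvs_of (cartan C), K^o).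
Implicit Types (mu : hdual) (M : V -> Prop).

Definition weight_vector mu (v : V) : Prop :=
  forall y : subvs_of (cartan C), mact (vsval y) v = (mu y : K) *: v.

Definition is_weight mu : Prop := exists2 v, v <> 0 & weight_vector mu v.

(* The weight spaces are the joint eigenspaces of the Cartan subalgebra, so
   their sum is always direct; only its being the whole space is required. *)
Definition rational : Prop :=
  (forall v : V, exists s : seq V,
     (forall w, w \in s -> exists mu, weight_vector mu w) /\
     v = \sum_(w <- s) w) /\
  (forall mu, is_weight mu ->
     forall i, exists z : int, mu (vsproj (cartan C) (cH C i)) = z%:~R :> K).

Definition admissible M : Prop :=
  is_lattice M /\
  (forall u, kostant C u -> forall v, M v -> M (uact (@mact _ _ V) u v)).

Definition stabilizer M (x : g) : Prop := forall v, M v -> M (mact x v).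

Definition integral_cartan (y : g) : Prop :=
  y \in cartan C /\
  (forall mu, is_weight mu ->
     exists z : int, mu (vsproj (cartan C) y) = z%:~R :> K).

End Rational.

(* Main.v *)
(* Let S be the stabilizer of M in g. Integral polynomials in the binomials of
   the H_i project M onto its weight spaces, so if y + sum_al c_al X_al is in S,
   with y in h, then so are y and every c_al X_al: roots are nonzero on h, and
   pairwise distinct there, which for P(n) requires n <> 3. An element y of h is
   in S if and only if the weights take integral values at y, since mu(y)^k v
   stays in M for v in M of weight mu. If c X_al is in S and -al is a root, then
   c H_al is in S, hence c be(H_al) is an integer for all roots be, by
   faithfulness. For isotropic al this is c in Z. Otherwise 2c is an integer;
   moreover c X_{-al} is in S, through the divided square of X_{-al} if al is
   even and a bracket with X_{-2al} if al is odd, so that c^2 H_al is in S and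
   2c^2 is an integer too; hence c is an integer. For P(n) some be(H_al) is 1, and
   the roots gamma_i are moved to beta_ij by a bracket. Finally h_V is a lattice
   by the Smith normal form of the matrix of the weights.

   The stabilizer depends on V: for sl(2), the element H/2 stabilizes the standard
   lattice of the adjoint module but not that of the natural one. *)

Require Import Defs.
From HB Require Import structures.
From mathcomp Require Import all_boot all_order all_algebra.
From mathcomp Require Import boolp ring zify.

Set Implicit Arguments.
Unset Strict Implicit.
Unset Printing Implicit Defensive.

Import GRing.Theory.
Local Open Scope ring_scope.

(** Coefficients lie in [K], so integrality has to be extracted from stability itself. On the Cartan
    part this works by iteration: the powers of one eigenvalue, multiplied by a fixed nonzero
    integer, stay integers. A root vector allows no such iteration, and its coroot may leave a
    factor 2 undecided: in sl(2) the only values be(H_al) are 2 and -2. The relation on 2c^2 is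
    there to remove this factor, and it is available only if c X_al is carried to c X_{-al} without
    a further factor 2. Hence the divided square for even al; for odd al, one has to show that the
    structure constant of the bracket used is 1 up to sign. The roots of the two models have
    different types; the models meet in the list of mechanisms [root_case], after which the argument
    is uniform. *)

Definition is_integer (K : fieldType) (c : K) : Prop := exists z : int, c = z%:~R.

(** * Integers in a field, lattices *)

Section Integral.
Variable K : fieldType.
Implicit Types (a c x : K) (z : int).

Lemma is_integer_int z : is_integer (z%:~R : K). Proof. by exists z. Qed.

Lemma is_integer0 : is_integer (0 : K). Proof. by exists 0. Qed.

Lemma is_integer1 : is_integer (1 : K). Proof. by exists 1. Qed.

Lemma is_integerN a : is_integer a -> is_integer (- a).
Proof. by case=> z ->; exists (- z); rewrite mulrNz. Qed.

Lemma is_integerD a c : is_integer a -> is_integer c -> is_integer (a + c).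
Proof. by case=> y -> [z ->]; exists (y + z); rewrite intrD. Qed.

Lemma is_integerB a c : is_integer a -> is_integer c -> is_integer (a - c).
Proof. by move=> Ia Ic; apply: is_integerD Ia (is_integerN Ic). Qed.

Lemma is_integerM a c : is_integer a -> is_integer c -> is_integer (a * c).
Proof. by case=> y -> [z ->]; exists (y * z); rewrite intrM. Qed.

Lemma is_integer_nat n : is_integer (n%:R : K). Proof. by exists n%:Z. Qed.

Lemma is_integer_sum (I : eqType) (r : seq I) (P : pred I) (F : I -> K) :
  (forall i, i \in r -> P i -> is_integer (F i)) ->
  is_integer (\sum_(i <- r | P i) F i).
Proof.
move=> IF; rewrite big_seq_cond; apply: big_ind => [||i /andP[ir Pi]].
- exact: is_integer0.
- exact: is_integerD.
- exact: IF.
Qed.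

Hypothesis charK : [pchar K] =i pred0.

Lemma natr_eq0_char0 n : ((n%:R : K) == 0) = (n == 0)%N.
Proof. by move/pcharf0P: charK => ->. Qed.

Lemma intr_eq0_char0 z : ((z%:~R : K) == 0) = (z == 0).
Proof.
case: z => n; first by rewrite -pmulrn natr_eq0_char0.
by rewrite NegzE mulrNz oppr_eq0 -pmulrn natr_eq0_char0 oppr_eq0.
Qed.

Lemma intr_inj_char0 : injective (intr : int -> K).
Proof.
move=> y z E; apply/eqP; rewrite -subr_eq0 -intr_eq0_char0 intrB E.
by rewrite subrr.
Qed.

(** With v the q-adic valuation, the hypothesis gives k v(m) <= (k+1) v(n). If v(m) > v(n), this
    fails at k = v(n) + 1, because (v(n)+1)^2 > v(n) (v(n)+2). *)
Lemma dvdn_bounded_powers m n :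
  (forall k, m ^ k %| n ^ k.+1)%N -> (m %| n)%N.
Proof.
move=> dvd_pow; have [->|n_gt0] := posnP n; first exact: dvdn0.
have m_gt0 : (0 < m)%N.
  by rewrite lt0n; apply: contraTneq (dvd_pow 1) => ->; rewrite expn1 dvd0n
     expn_eq0 eqn0Ngt n_gt0.
apply/dvdn_partP => // q; rewrite mem_primes => /and3P[q_pr _ _].
rewrite p_part pfactor_dvdn // leqNgt; apply/negP => lt_log.
have := dvdn_leq_log q _ (dvd_pow (logn q n).+1).
by rewrite expn_gt0 n_gt0 => /(_ isT); rewrite !lognX; nia.
Qed.

(** Put p = c z. Then c^(k+1) z = p^(k+1) / z^k is an integer, so z^k divides p^(k+1) for every k,
    which forces z to divide p. *)
Lemma integral_bounded_denominator c z :
  z != 0 -> (forall k, is_integer (c ^+ k * z%:~R)) -> is_integer c.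
Proof.
move=> z0 pow_c; have [p Ep] := pow_c 1; rewrite expr1 in Ep.
have zK0 : (z%:~R : K) != 0 by rewrite intr_eq0_char0.
suff /dvdzP[w Ew] : (z %| p)%Z.
  by exists w; apply: (mulIf zK0); rewrite Ep Ew intrM.
apply: dvdn_bounded_powers => k; have [w Ew] := pow_c k.+1.
rewrite -!abszX; change (z ^+ k %| p ^+ k.+1)%Z; apply/dvdzP; exists w.
apply: intr_inj_char0; rewrite intrM !rmorphXn /= -Ew -Ep exprMn.
by rewrite [z%:~R ^+ k.+1]exprS !mulrA.
Qed.

End Integral.

(** * Generalized binomial coefficients at integers of either sign *)

Section BinomialFunction.
Variables (K : fieldType) (charK : [pchar K] =i pred0).
Implicit Types x : K.

(** The scalar by which [ubinomial] acts on an eigenvector of eigenvalue [x]. *)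
Definition binf x n : K := (n`!%:R)^-1 * \prod_(k < n) (x - k%:R).

Let fact_neq0 n : (n`!%:R : K) != 0.
Proof. by rewrite (natr_eq0_char0 charK) -lt0n fact_gt0. Qed.

Lemma binf0 x : binf x 0 = 1.
Proof. by rewrite /binf big_ord0 fact0 invr1 mulr1. Qed.

Lemma binfS x n : binf (x + 1) n.+1 = binf x n.+1 + binf x n.
Proof.
have E : \prod_(k < n.+1) (x + 1 - k%:R) = (x + 1) * \prod_(k < n) (x - k%:R).
  rewrite big_ord_recl subr0; congr (_ * _); apply: eq_bigr => i _.
  by rewrite lift0 -natr1; ring.
rewrite /binf {}E big_ord_recr /=; set P := \prod_(k < n) _.
have n1 : (n.+1%:R : K) != 0 by rewrite natr_eq0_char0.
have := fact_neq0 n; rewrite factS natrM => n0.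
by rewrite -natr1 in n1 *; field; rewrite n0.
Qed.

Lemma binf0S n : binf 0 n.+1 = 0.
Proof. by rewrite /binf big_ord_recl subr0 mul0r mulr0. Qed.

Lemma binf_nat m n : binf m%:R n = 'C(m, n)%:R.
Proof.
elim: m n => [|m IHm] [|n]; rewrite ?binf0 ?bin0 ?binf0S ?bin0n //.
by rewrite -natr1 binfS !IHm -natrD -binS.
Qed.

(** Pascal's rule carries integrality from y to y + 1 and, by induction on the lower index, from y
    to y - 1; the second direction reaches the negative integers. *)
Lemma is_integer_binf (z : int) n : is_integer (binf z%:~R n).
Proof.
have up y m : (forall k, is_integer (binf y k)) -> is_integer (binf (y + 1) m).
  move=> Iy; case: m => [|m]; first by rewrite binf0; apply: is_integer1.
  by rewrite binfS; apply: is_integerD.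
have down y m : (forall k, is_integer (binf y k)) -> is_integer (binf (y - 1) m).
  move=> Iy; elim: m => [|m IHm]; first by rewrite binf0; apply: is_integer1.
  by have := binfS (y - 1) m; rewrite subrK => /eqP;
     rewrite -subr_eq => /eqP <-; apply: is_integerB.
elim/int_rect: z n => [|m IHm|m IHm] n.
- by case: n => [|n]; rewrite ?binf0 ?binf0S; [apply: is_integer1|apply: is_integer0].
- by rewrite -addn1 PoszD intrD; apply: up.
- by rewrite -addn1 PoszD opprD intrD mulrNz; apply: down => k; rewrite -mulrNz.
Qed.

End BinomialFunction.

(** * Integral spans and lattices *)

Section IntegralSpan.
Variable V : zmodType.
Implicit Types (S : V -> Prop) (v w : V).

Lemma Zspan0 S : Zspan S 0.
Proof. by exists [::]; rewrite big_nil. Qed.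

Lemma Zspan_in S v : S v -> Zspan S v.
Proof.
move=> Sv; exists [:: (1, v)]; split; last by rewrite big_seq1 mulr1z.
by move=> p; rewrite inE => /eqP ->.
Qed.

Lemma ZspanD S v w : Zspan S v -> Zspan S w -> Zspan S (v + w).
Proof.
case=> s [Ss ->] [t [St ->]]; exists (s ++ t); rewrite big_cat; split=> // p.
by rewrite mem_cat => /orP[/Ss|/St].
Qed.

Lemma ZspanMz S v z : Zspan S v -> Zspan S (v *~ z).
Proof.
case=> s [Ss ->]; exists [seq (p.1 * z, p.2) | p <- s]; split=> [_ /mapP[p ps ->]|].
  by move: ps => /Ss.
by rewrite big_map mulrz_suml; apply: eq_bigr => p _; rewrite mulrzA.
Qed.

Lemma Zspan_sum S (I : eqType) (r : seq I) (F : I -> V) :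
  (forall i, i \in r -> Zspan S (F i)) -> Zspan S (\sum_(i <- r) F i).
Proof.
move=> SF; rewrite big_seq; apply: big_ind => //; first exact: Zspan0.
exact: ZspanD.
Qed.

End IntegralSpan.

Section Lattices.
Variables (K : fieldType) (V : vectType K).
Implicit Types (S M : V -> Prop) (v w : V) (b : seq V).

Lemma Zspan_coord b (k : V -> K) : free b ->
  Zspan (fun w => w \in b) (\sum_(x <- b) k x *: x) <->
  (forall x, x \in b -> is_integer (k x)).
Proof.
move=> free_b; set v := \sum_(x <- b) _; split=> [[s [bs Ev]]|Ik]; last first.
  apply: Zspan_sum => x xb; have [z ->] := Ik x xb.
  by rewrite scaler_int; apply: ZspanMz; apply: Zspan_in.
have sv : v \in <<b>>%VS.
  by rewrite /v big_seq; apply: memv_suml => x xb; rewrite memvZ ?memv_span.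
have [k' Ev' uniq_k'] := free_span free_b sv.
have Ek := uniq_k' k erefl.
(* An integral combination in [Zspan] may list a basis vector several times; its coordinate is the
   sum of the multiplicities. *)
have Ek' : {in b, (fun x => \sum_(p <- s | p.2 == x) (p.1)%:~R) =1 k'}.
  apply: uniq_k'; rewrite Ev.
  under [RHS]eq_bigr => x _ do rewrite scaler_suml.
  rewrite (exchange_big_dep xpredT) //= big_seq [RHS]big_seq.
  apply: eq_bigr => p ps; rewrite -big_filter.
  have -> : [seq x <- b | p.2 == x] = [:: p.2].
    rewrite (eq_filter (a2 := pred1 p.2)); last by move=> x /=; rewrite eq_sym.
    by rewrite filter_pred1_uniq ?free_uniq // bs.
  by rewrite big_seq1 scaler_int.
move=> x xb; rewrite Ek // -Ek' //; apply: is_integer_sum => p _ _.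
exact: is_integer_int.
Qed.

Lemma lattice_span M : is_lattice M ->
  exists b, [/\ <<b>>%VS = fullv, free b & forall v, M v <-> Zspan (fun w => w \in b) v].
Proof.
by case=> b [bV bM]; exists b; split=> //; [apply: span_basis | apply: basis_free bV].
Qed.

Lemma latticeD M v w : is_lattice M -> M v -> M w -> M (v + w).
Proof. by case=> b [_ bM] /bM Mv /bM Mw; apply/bM/ZspanD. Qed.

Lemma latticeMz M v z : is_lattice M -> M v -> M (v *~ z).
Proof. by case=> b [_ bM] /bM Mv; apply/bM/ZspanMz. Qed.

Lemma lattice0 M : is_lattice M -> M 0.
Proof. by case=> b [_ bM]; apply/bM/Zspan0. Qed.

Lemma latticeN M v : is_lattice M -> M v -> M (- v).
Proof. by move=> latM Mv; rewrite -[v]mulr1z -mulrNz; apply: latticeMz. Qed.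

Lemma latticeB M v w : is_lattice M -> M v -> M w -> M (v - w).
Proof. by move=> latM Mv Mw; apply: latticeD => //; apply: latticeN. Qed.

Lemma lattice_sum M (I : eqType) (r : seq I) (F : I -> V) : is_lattice M ->
  (forall i, i \in r -> M (F i)) -> M (\sum_(i <- r) F i).
Proof.
move=> latM MF; rewrite big_seq; apply: big_ind => //; first exact: lattice0.
by move=> v w; apply: latticeD.
Qed.

(** Some coordinate of [v] in the basis of [M] is a nonzero integer z, and all c^n z are coordinates
    of elements of [M], hence integers. *)
Lemma lattice_powers_integral M v c : [pchar K] =i pred0 -> is_lattice M ->
  v != 0 -> (forall n, M (c ^+ n *: v)) -> is_integer c.
Proof.
move=> charK /lattice_span[b [bV free_b bM]] v0 Mcv.
have /(free_span free_b)[k Ev _] : v \in <<b>>%VS by rewrite bV memvf.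
have Ick n x : x \in b -> is_integer (c ^+ n * k x).
  move: x; apply/(Zspan_coord _ free_b)/bM.
  have -> : \sum_(x <- b) (c ^+ n * k x) *: x = c ^+ n *: v; last exact: Mcv.
  by rewrite Ev scaler_sumr; apply: eq_bigr => x _; rewrite scalerA.
have /hasP[x xb kx0] : has (fun x => k x != 0) b.
  apply: contraNT v0 => /hasPn k0; rewrite Ev big_seq big1 // => x /k0.
  by rewrite negbK => /eqP ->; rewrite scale0r.
have [z Ez] := Ick 0 x xb; rewrite mul1r in Ez.
apply: (integral_bounded_denominator charK (z := z)) => [|n].
  by rewrite -(intr_eq0_char0 charK) -Ez.
by rewrite -Ez; apply: Ick.
Qed.

End Lattices.

(** * The lattice dual to the rows of an integral matrix *)

Section DualLattice.
Variables (K : fieldType) (charK : [pchar K] =i pred0).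

Local Notation toK := (map_mx (intr : int -> K)).

Lemma is_integer_mx m n (A : 'M[K]_(m, n)) :
  (forall i j, is_integer (A i j)) -> exists Z : 'M[int]_(m, n), A = toK Z.
Proof.
move=> IA.
have /choice[f Ef] : forall p : 'I_m * 'I_n, exists z : int, A p.1 p.2 = z%:~R.
  by move=> p; apply: IA.
by exists (\matrix_(i, j) f (i, j)); apply/matrixP => i j; rewrite !mxE (Ef (i, j)).
Qed.

(** With W = L D R in Smith form, the condition on c is that D R c be integral. Injectivity makes
    the diagonal entries d_i nonzero, so the solutions are R^{-1} diag(1/d_i) z with z integral, and
    [B] is R^{-1} diag(1/d_i). *)
Lemma integral_preimage_lattice m n (W : 'M[int]_(m, n)) :
  (forall c : 'cV[K]_n, toK W *m c = 0 -> c = 0) ->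
  exists2 B : 'M[K]_n, B \in unitmx &
    forall c : 'cV[K]_n, (forall i, is_integer ((toK W *m c) i 0)) <->
      exists z : 'cV[int]_n, c = B *m toK z.
Proof.
move=> W_inj; have [L uL [R uR [d _ EW]]] := int_Smith_normal_form W.
set D := (X in L *m X *m R) in EW.
have EWK : toK W = toK L *m toK D *m toK R by rewrite EW !map_mxM.
have KL : toK (invmx L) *m toK L = 1%:M by rewrite -map_mxM mulVmx // map_mx1.
have KR : toK (invmx R) *m toK R = 1%:M by rewrite -map_mxM mulVmx // map_mx1.
have RK : toK R *m toK (invmx R) = 1%:M by rewrite -map_mxM mulmxV // map_mx1.
(* W sends column i of R^{-1} to L times column i of D, which is nonzero by injectivity. This also
   shows that D has a row of index i, so n <= m. *)
have d_neq0 (i : 'I_n) : exists2 j : 'I_m, i = j :> nat & d`_i != 0.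
  have : toK W *m (toK (invmx R) *m delta_mx i (0 : 'I_1)) != 0.
    apply: contra_neq (oner_neq0 K) => /W_inj E.
    have : (toK R *m (toK (invmx R) *m delta_mx i (0 : 'I_1))) i 0 = 0.
      by rewrite E mulmx0 mxE.
    by rewrite mulmxA RK mul1mx mxE !eqxx.
  rewrite EWK -!mulmxA (mulmxA (toK R)) RK mul1mx -colE => nz.
  have /matrix0Pn[j [k]] : col i (toK D) != 0.
    by apply: contra_neq nz => ->; rewrite mulmx0.
  rewrite !mxE; case: (nat_of_ord j =P i) => [ji|_]; last by rewrite mulr0n eqxx.
  by rewrite mulr1n (intr_eq0_char0 charK) ji => di; exists j; rewrite // -ji.
have dK0 (i : 'I_n) : ((d`_i)%:~R : K) != 0.
  by have [j _ di] := d_neq0 i; rewrite (intr_eq0_char0 charK).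
pose dinv := \row_(i < n) ((d`_i)%:~R : K)^-1.
exists (toK (invmx R) *m diag_mx dinv).
  rewrite unitmx_mul (mulmx1_unit KR).1 /= unitmxE det_diag unitfE.
  by apply/prodf_neq0 => i _; rewrite mxE invr_eq0 dK0.
move=> c; split=> [Wc|[z ->] i]; last first.
  rewrite EWK -!mulmxA (mulmxA (toK R)) RK mul1mx (mulmxA (toK D)).
  have -> : toK D *m diag_mx dinv = toK (\matrix_(i, j) (i == j :> nat)%:R).
    apply/matrixP => j k; rewrite mul_mx_diag !mxE.
    by case: eqP => [->|_]; rewrite ?mulr1n ?mulr0n ?mulr0z ?mul0r ?mulfV ?dK0.
  by rewrite -!map_mxM mxE; apply: is_integer_int.
have /is_integer_mx[w Ew] : forall i j, is_integer ((toK W *m c) i j).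
  by move=> i j; rewrite ord1.
have Ede : toK D *m (toK R *m c) = toK (invmx L *m w).
  by rewrite map_mxM -Ew EWK -!mulmxA (mulmxA (toK (invmx L))) KL mul1mx.
(* D R c has [m] rows; those of index below [n] are the entries d_i (R c)_i of the square diagonal
   product. *)
have /is_integer_mx[z Ez] : forall i j, is_integer ((diag_mx (\row_i (d`_i)%:~R) *m (toK R *m c)) i j).
  move=> i j; have [k ik _] := d_neq0 i.
  have <- : (toK D *m (toK R *m c)) k j = (diag_mx (\row_i (d`_i)%:~R) *m (toK R *m c)) i j.
    rewrite mul_diag_mx [LHS]mxE (bigD1 i) //= big1 ?addr0 => [|l li].
      by rewrite !mxE ik eqxx mulr1n.
    rewrite !mxE; case: eqP => [kl|_]; last by rewrite mulr0n mul0r.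
    by case/eqP: li; apply: val_inj; rewrite /= -kl -ik.
  by rewrite Ede mxE; apply: is_integer_int.
exists z; rewrite -Ez -!mulmxA (mulmxA (diag_mx _)).
have -> : diag_mx dinv *m diag_mx (\row_i (d`_i)%:~R) = 1%:M.
  by apply/matrixP => i j; rewrite mul_diag_mx !mxE; case: eqP => [->|_];
     rewrite ?mulr1n ?mulr0n ?mulr0 ?mulVf ?dK0.
by rewrite mul1mx mulmxA KR mul1mx.
Qed.

End DualLattice.

(** * Weight spaces and the Kostant superalgebra *)

Lemma span_ind (K : fieldType) (V : vectType K) (S : seq V) (P : V -> Prop) :
  P 0 -> (forall c v w, P v -> P w -> P (c *: v + w)) ->
  (forall w, w \in S -> P w) -> forall v, v \in <<S>>%VS -> P v.
Proof.
move=> P0 PD; elim: S => [|x S IHS] PS v; first by rewrite span_nil memv0 => /eqP ->.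
rewrite span_cons => /memv_addP[_ /vlineP[c ->] [w wS ->]].
by apply: PD; [apply: PS; rewrite mem_head | apply: IHS wS => y yS; apply: PS;
   rewrite in_cons yS orbT].
Qed.

Section SubringGenerated.
Variables (A : nzRingType) (S : A -> Prop).
Local Notation G := (subring_gen S).

Lemma subring_gen0 : G 0.
Proof. by rewrite -(subrr 1); apply: subring_gen_sub; apply: subring_gen_1. Qed.

Lemma subring_genD a b : G a -> G b -> G (a + b).
Proof.
move=> Ga Gb; rewrite -[b]opprK -[- b]sub0r; apply: subring_gen_sub Ga _.
exact: subring_gen_sub subring_gen0 Gb.
Qed.

Lemma subring_genMz a z : G a -> G (a *~ z).
Proof.
move=> Ga; have nat n : G (a *+ n).
  elim: n => [|n IHn]; first exact: subring_gen0.
  by rewrite mulrS; apply: subring_genD.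
case: z => n; first exact: nat.
by rewrite NegzE mulrNz -[- _]sub0r; apply: subring_gen_sub; [apply: subring_gen0 | apply: nat].
Qed.

Lemma subring_gen_prod (I : Type) (r : seq I) (F : I -> A) :
  (forall i, G (F i)) -> G (\prod_(i <- r) F i).
Proof.
by move=> GF; apply: big_ind => //; [apply: subring_gen_1 | apply: subring_gen_mul].
Qed.

End SubringGenerated.

Section Representation.
Variables (K : fieldType) (g : lieSuper K) (V : lmodType K) (act : g -> V -> V).
Hypothesis actP : is_representation act.

Lemma actDl x y v : act (x + y) v = act x v + act y v.
Proof. by case: actP => aL _ _; rewrite -[x]scale1r aL !scale1r. Qed.

Lemma act0l v : act 0 v = 0.
Proof. by apply: (addrI (act 0 v)); rewrite -actDl !addr0. Qed.

Lemma actZl c x v : act (c *: x) v = c *: act x v.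
Proof. by case: actP => aL _ _; rewrite -[_ *: x]addr0 aL act0l addr0. Qed.

Lemma act_suml (I : Type) (r : seq I) (F : I -> g) v :
  act (\sum_(i <- r) F i) v = \sum_(i <- r) act (F i) v.
Proof. by apply: (big_morph (act^~ v)) => [x y|]; rewrite ?actDl ?act0l. Qed.

Lemma actDr x v w : act x (v + w) = act x v + act x w.
Proof. by case: actP => _ aR _; rewrite -[v]scale1r aR !scale1r. Qed.

Lemma act0r x : act x 0 = 0.
Proof. by apply: (addrI (act x 0)); rewrite -actDr !addr0. Qed.

Lemma actZr c x v : act x (c *: v) = c *: act x v.
Proof. by case: actP => _ aR _; rewrite -[_ *: v]addr0 aR act0r addr0. Qed.

Lemma act_sumr (I : Type) (r : seq I) (F : I -> V) x :
  act x (\sum_(i <- r) F i) = \sum_(i <- r) act x (F i).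
Proof. by apply: (big_morph (act x)) => [v w|]; rewrite ?actDr ?act0r. Qed.

Lemma uact_linear (u : enveloping g) c v w :
  uact act u (c *: v + w) = c *: uact act u v + uact act u w.
Proof. exact: ueval_linear. Qed.

Lemma uact0r (u : enveloping g) : uact act u 0 = 0.
Proof. by have := uact_linear u (-1) 0 0; rewrite scaler0 addr0 scaleN1r addNr. Qed.

Lemma uactZr (u : enveloping g) c v : uact act u (c *: v) = c *: uact act u v.
Proof. by have := uact_linear u c v 0; rewrite uact0r !addr0. Qed.

Lemma uactDr (u : enveloping g) v w : uact act u (v + w) = uact act u v + uact act u w.
Proof. by have := uact_linear u 1 v w; rewrite !scale1r. Qed.

Lemma uactN (u : enveloping g) v : uact act (- u) v = - uact act u v.
Proof. by rewrite -scaleN1r (uactZ actP) scaleN1r. Qed.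

Lemma uactB (u w : enveloping g) v : uact act (u - w) v = uact act u v - uact act w v.
Proof. by rewrite (uactD actP) uactN. Qed.

Lemma uact_nat n v : uact act n%:R v = n%:R *: v.
Proof. by rewrite -scaler_nat (uactZ actP) (uact1 actP). Qed.

Lemma uactMz (u : enveloping g) z v : uact act (u *~ z) v = z%:~R *: uact act u v.
Proof. by rewrite -scaler_int (uactZ actP). Qed.

Lemma uact_prod_eigen (I : Type) (r : seq I) (F : I -> enveloping g) (c : I -> K) v :
  (forall i, uact act (F i) v = c i *: v) ->
  uact act (\prod_(i <- r) F i) v = (\prod_(i <- r) c i) *: v.
Proof.
move=> Fv; elim: r => [|i r IHr]; first by rewrite !big_nil (uact1 actP) scale1r.
by rewrite !big_cons (uactM actP) IHr uactZr Fv scalerA mulrC.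
Qed.

Lemma uact_ubinomial (x : g) n c v : act x v = c *: v ->
  uact act (ubinomial (uinj x) n) v = binf c n *: v.
Proof.
move=> xv; rewrite /ubinomial (uactZ actP) (uact_prod_eigen _ (c := fun k : 'I_n => c - k%:R)).
  by rewrite scalerA.
by move=> k; rewrite uactB (uact_inj actP) uact_nat xv scalerBl.
Qed.

Lemma uact_divided_power0 (x : g) v : uact act (divided_power (uinj x) 0) v = v.
Proof. by rewrite /divided_power (uactZ actP) fact0 invr1 expr0 (uact1 actP) scale1r. Qed.

Lemma uact_divided_powerS (x : g) n v :
  uact act (divided_power (uinj x) n.+1) v =
  n.+1%:R^-1 *: act x (uact act (divided_power (uinj x) n) v).
Proof.
rewrite /divided_power !(uactZ actP) exprS (uactM actP) (uact_inj actP) actZr scalerA.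
by rewrite -invfM -natrM factS.
Qed.

End Representation.

(** * Projections onto weight spaces by elements of the Kostant superalgebra *)

Section Weights.
Variables (K : fieldType) (charK : [pchar K] =i pred0).
Variables (g : lieSuper K) (C : chevalleyBasis g) (V : superModule g).

Local Notation h := (cartan C).
Local Notation hdual := 'Hom(subvs_of h, K^o).
Local Notation act := (@mact K g V).
Let actP := @mactP K g V.
Implicit Types (mu nu : hdual) (v w : V).

Lemma cartan_coord y : y \in h -> exists c : 'I_(\dim h) -> K, y = \sum_i c i *: cH C i.
Proof.
case: (chevalleyP C) => _ [bH _] _ _ _; rewrite -{1}(span_basis bH) => yH.
have [k Ey _] := free_span (basis_free bH) yH.
exists (fun i => k (cH C i)); rewrite {1}Ey big_map big_enum.
by [].
Qed.

Lemma cH_cartan i : cH C i \in h.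
Proof.
case: (chevalleyP C) => _ [bH _] _ _ _.
by apply: (basis_mem bH); apply: codom_f.
Qed.

Lemma hdual_eq mu nu :
  (forall i, mu (vsproj h (cH C i)) = nu (vsproj h (cH C i))) -> mu = nu.
Proof.
move=> E; apply/lfunP => y; have [c Ey] := cartan_coord (subvsP y).
rewrite -(vsvalK y) Ey !linear_sum; apply: eq_bigr => i _.
by rewrite !linearZ /= E.
Qed.

(** Pascal's rule, by induction on [s], builds the binomials of H_i + s from those of H_i. The shift
    is there to make finitely many integral eigenvalues nonnegative. *)
Lemma kostant_shifted_binomial i s k : exists2 u, kostant C u &
  forall v c, act (cH C i) v = c *: v -> uact act u v = binf (c + s%:R) k *: v.
Proof.
elim: s k => [|s IHs] [|k].
- by exists 1 => [|v c _]; rewrite ?binf0 ?(uact1 actP) ?scale1r //; apply: subring_gen_1.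
- exists (ubinomial (uinj (cH C i)) k.+1) => [|v c Hv].
    by apply: subring_gen_in; constructor 3; exists i, k.+1.
  by rewrite addr0; apply: uact_ubinomial.
- by exists 1 => [|v c _]; rewrite ?binf0 ?(uact1 actP) ?scale1r //; apply: subring_gen_1.
have [u Ku uE] := IHs k; have [w Kw wE] := IHs k.+1.
exists (w + u) => [|v c Hv]; first exact: subring_genD.
rewrite (uactD actP) (uE _ c) // (wE _ c) // -scalerDl; congr (_ *: _).
by rewrite -natr1 addrA (binfS charK).
Qed.

(* Newton interpolation: the binomials [n |-> 'C(n, k)] are unitriangular. *)
Lemma kostant_nat_projection i s a j : exists u, exists f : nat -> int,
  [/\ kostant C u,
      forall v n, act (cH C i) v = (n%:R - s%:R) *: v ->
        uact act u v = (f n)%:~R *: v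
    & forall n, (n <= a + j)%N -> f n = (n == a)%:R].
Proof.
elim: j => [|j [u [f [Ku uE fE]]]].
  have [u Ku uE] := kostant_shifted_binomial i s a.
  exists u, (fun n => 'C(n, a)%:Z); split=> // [v n Hv|n].
    by rewrite (uE _ _ Hv) subrK (binf_nat charK).
  rewrite addn0 leq_eqVlt => /orP[/eqP ->|lt_na]; first by rewrite binn eqxx.
  by rewrite bin_small // (ltn_eqF lt_na).
have [w Kw wE] := kostant_shifted_binomial i s (a + j.+1).
exists (u - w *~ f (a + j.+1)%N), (fun n => f n - 'C(n, a + j.+1)%:Z * f (a + j.+1)%N).
split=> [|v n Hv|n].
- by apply: subring_gen_sub => //; apply: subring_genMz.
- rewrite (uactB actP) (uactMz actP) (uE _ _ Hv) (wE _ _ Hv) subrK (binf_nat charK).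
  by rewrite scalerA -scalerBl rmorphB rmorphM mulrC.
rewrite leq_eqVlt => /orP[/eqP ->|]; last first.
  by rewrite addnS ltnS => le_n; rewrite bin_small ?mul0r ?subr0 ?fE // addnS ltnS.
by rewrite binn mul1r subrr addnS gtn_eqF // ltnS leq_addr.
Qed.

Lemma kostant_int_projection i (L : seq int) z : exists2 u, kostant C u &
  forall v y, y \in L -> act (cH C i) v = y%:~R *: v -> uact act u v = (y == z)%:R *: v.
Proof.
(* After adding [s], the eigenvalues in [z :: L] become natural numbers at most 2s, so it is enough
   for the projection onto the value z + s to be exact up to z + s + 2s. *)
pose s := \max_(y <- z :: L) `|y|%N.
have sP y : y \in z :: L -> (`|y| <= s)%N.
  by move=> yL; rewrite /s (big_rem y) //= leq_maxl.
have [u [f [Ku uE fE]]] := kostant_nat_projection i s `|(z + s)%R|%N s.*2.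
exists u => // v y yL Hv.
have zs := sP z (mem_head _ _); have ys := sP y (mem_behead (s := z :: L) yL).
rewrite (uE _ `|(y + s)%R|%N); last first.
  rewrite Hv; congr (_ *: _); rewrite -[s%:R]/(s%:~R) -[_%:R]/((Posz _)%:~R) -intrB.
  by congr _%:~R; lia.
rewrite fE; last by lia.
have -> : (`|(y + s)%R| == `|(z + s)%R|)%N = (y == z) by lia.
by case: (y == z).
Qed.

Definition integral_weight mu : Prop := forall i, is_integer (mu (vsproj h (cH C i)) : K).

(** The projections onto one eigenvalue of each H_i are multiplied together; weights are separated
    by their values at the H_i, since these span the Cartan subalgebra. *)
Lemma kostant_projection (L : seq hdual) mu :
  integral_weight mu -> (forall nu, nu \in L -> integral_weight nu) ->
  exists2 u, kostant C u &
    forall v nu, nu \in L -> weight_vector nu v -> uact act u v = (nu == mu)%:R *: v.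
Proof.
move=> Imu IL.
have /choice[f fE] : forall p : hdual * 'I_(\dim h), exists z : int,
    integral_weight p.1 -> p.1 (vsproj h (cH C p.2)) = z%:~R :> K.
  move=> [nu i] /=; have [Inu|] := pselect (integral_weight nu); last by exists 0.
  by have [z Ez] := Inu i; exists z.
have /choice[u uP] : forall i, exists u, kostant C u /\ forall v y,
    y \in [seq f (nu, i) | nu <- L] -> act (cH C i) v = y%:~R *: v ->
    uact act u v = (y == f (mu, i))%:R *: v.
  move=> i; have [u Ku uE] := kostant_int_projection i [seq f (nu, i) | nu <- L] (f (mu, i)).
  by exists u.
exists (\prod_i u i) => [|v nu nuL nuv].
  by apply: subring_gen_prod => i; case: (uP i).
rewrite (uact_prod_eigen actP _ (c := fun i => (f (nu, i) == f (mu, i))%:R)); last first.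
  move=> i; apply: (uP i).2; first exact: map_f.
  rewrite -(fE (nu, i)) /=; last exact: IL.
  by have := nuv (vsproj h (cH C i)); rewrite vsprojK ?cH_cartan.
congr (_ *: _); case: eqP => [->|/eqP neq]; first by rewrite big1 // => i _; rewrite eqxx.
have [i neq_i] : exists i, f (nu, i) != f (mu, i).
  apply/existsP; apply: contraNT neq; rewrite negb_exists => /forallP E.
  apply/eqP/hdual_eq => i; have /eqP Ei := negbNE (E i).
  by rewrite (fE (nu, i) (IL _ nuL)) (fE (mu, i) Imu) Ei.
by rewrite (bigD1 i) //= (negbTE neq_i) mul0r.
Qed.

Hypothesis ratV : rational C V.

Lemma weight_integral mu : is_weight V mu -> integral_weight mu.
Proof. by move=> wmu i; have [_ /(_ mu wmu i)] := ratV. Qed.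

(** [rational] decomposes one vector at a time; decomposing the vectors of a basis gives a finite
    spanning set. Zero summands are dropped because only a nonzero vector witnesses a weight. *)
Lemma weight_spanning : exists (S : seq V) (L : seq hdual),
  [/\ <<S>>%VS = fullv, forall mu, mu \in L -> is_weight V mu
    & forall w, w \in S -> exists2 mu, mu \in L & weight_vector mu w].
Proof.
have [S spanS wS] : exists2 S : seq V, (<<S>>%VS = fullv) &
    forall w, w \in S -> w <> 0 /\ exists mu : hdual, weight_vector mu w.
  suff span_seq (B : seq V) : exists2 S : seq V, {subset B <= <<S>>%VS} &
      forall w, w \in S -> w <> 0 /\ exists mu : hdual, weight_vector mu w.
    have [S subS wS] := span_seq (vbasis {:V}); exists S => //; apply/eqP; rewrite eqEsubv subvf -(span_basis (vbasisP {:V})).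
    exact/span_subvP.
  elim: B => [|v B [S subS wS]]; first by exists [::].
  have [s [ws Ev]] := proj1 ratV v.
  exists ([seq w <- s | w != 0] ++ S) => [w|w]; last first.
    by rewrite mem_cat mem_filter => /orP[/andP[/eqP w0 /ws]|/wS].
  rewrite in_cons span_cat => /orP[/eqP ->|/subS wS']; last first.
    by move: wS'; apply/subvP/addvSr.
  have /subvP := addvSl <<[seq w <- s | w != 0]>> <<S>>; apply.
  rewrite Ev big_seq; apply: memv_suml => x xs; have [->|x0] := eqVneq x 0.
    exact: mem0v.
  by rewrite memv_span // mem_filter x0.
exists S; suff [L HL HS] : exists2 L : seq hdual, forall mu, mu \in L -> is_weight V mu &
    forall w, w \in S -> exists2 mu, mu \in L & weight_vector mu w by exists L.
elim: S wS {spanS} => [|w S IHS] wS; first by exists [::].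
have [w0 [mu wmu]] := wS w (mem_head _ _).
have [|L HL HS] := IHS; first by move=> x xS; apply: wS; rewrite in_cons xS orbT.
exists (mu :: L) => [nu|x].
  by rewrite in_cons => /orP[/eqP ->|/HL //]; exists w.
rewrite in_cons => /orP[/eqP ->|/HS[nu nuL xnu]]; first by exists mu; rewrite ?mem_head.
by exists nu; rewrite // in_cons nuL orbT.
Qed.

(** For a weight [mu], [p mu] is the action of an element of the Kostant superalgebra chosen without
    reference to a lattice, so it preserves all admissible lattices at once. By linearity its
    properties are checked on a finite spanning set of weight vectors. *)
Lemma weight_decomposition : exists (L : seq hdual) (p : hdual -> V -> V),
  [/\ uniq L, forall mu, mu \in L <-> is_weight V mu,
      forall mu v, is_weight V mu ->
        weight_vector mu (p mu v) /\ forall M, admissible C M -> M v -> M (p mu v),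
      forall mu nu v, is_weight V mu -> weight_vector nu v ->
        p mu v = (nu == mu)%:R *: v
    & (forall mu c v w, p mu (c *: v + w) = c *: p mu v + p mu w) /\
      forall v, v = \sum_(mu <- L) p mu v].
Proof.
have [S [L [spanS HL HS]]] := weight_spanning.
have IL nu : nu \in L -> integral_weight nu by move/HL/weight_integral.
have LP mu : mu \in L <-> is_weight V mu.
  split=> [/HL //|wmu]; case: (wmu) => v v0 mu_v; have Imu := weight_integral wmu.
  (* For [mu] outside [L], this projection fixes the vectors of weight [mu] and yet kills the
     spanning set, whose weights are in [L]. *)
  have [|u Ku uE] := @kostant_projection (mu :: L) mu Imu.
    by move=> nu; rewrite in_cons => /orP[/eqP ->|/IL].
  apply: contrapT => /negP muL; case: v0.
  have := uE v mu (mem_head _ _) mu_v; rewrite eqxx scale1r => <-.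
  have: v \in <<S>>%VS by rewrite spanS memvf.
  move: v {mu_v}; apply: span_ind => [|c v w uv uw|w wS].
  - exact: (uact0r actP).
  - by rewrite (uact_linear actP) // uv uw scaler0 addr0.
  have [nu nuL nu_w] := HS w wS; rewrite (uE _ nu) //; last by rewrite in_cons nuL orbT.
  by case: eqP nuL muL => [-> ->|]; rewrite ?scale0r.
have /choice[u uP] : forall mu, exists u, is_weight V mu -> kostant C u /\
    forall v nu, nu \in L -> weight_vector nu v -> uact act u v = (nu == mu)%:R *: v.
  move=> mu; have [wmu|] := pselect (is_weight V mu); last by exists 0.
  by have [u Ku uE] := kostant_projection (weight_integral wmu) IL; exists u.
have uE mu nu v : is_weight V mu -> weight_vector nu v ->
    uact act (u mu) v = (nu == mu)%:R *: v.
  move=> wmu nu_v; have [->|v0] := eqVneq v 0; first by rewrite (uact0r actP) ?scaler0.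
  by apply: (uP mu wmu).2 => //; apply/LP; exists v => //; apply/eqP.
exists (undup L), (fun mu => uact act (u mu)); split=> //.
- exact: undup_uniq.
- by move=> mu; rewrite mem_undup; apply: LP.
- move=> mu v wmu; split; last by move=> M [_ KM] Mv; apply: KM => //; case: (uP mu wmu).
  have: v \in <<S>>%VS by rewrite spanS memvf.
  move: v; apply: span_ind => [|c v w wv ww y|w wS].
  + by move=> y; rewrite (uact0r actP) // scaler0 (act0r actP).
  + rewrite (uact_linear actP) // (actDr actP) // (actZr actP) // wv ww scalerDr !scalerA.
    by rewrite [c * _]mulrC.
  have [nu nuL nu_w] := HS w wS; rewrite (uE _ nu) //.
  by case: eqP => [<-|_] y; rewrite ?scale1r // scale0r scaler0 (act0r actP).
split=> [mu c v w|v]; first exact: (uact_linear actP).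
have: v \in <<S>>%VS by rewrite spanS memvf.
move: v; apply: span_ind => [|c v w Ev Ew|w wS].
- by rewrite big1 // => mu _; rewrite (uact0r actP).
- rewrite {1}Ev {1}Ew scaler_sumr -big_split; apply: eq_bigr => mu _.
  by rewrite (uact_linear actP).
have [nu nuL nu_w] := HS w wS; rewrite (bigD1_seq nu) ?undup_uniq ?mem_undup //=.
rewrite (uE _ nu) ?eqxx ?scale1r; [|exact/LP|by []].
rewrite big_seq_cond big1 ?addr0 // => mu /andP[]; rewrite mem_undup => /LP wmu neq.
by rewrite (uE _ nu) // eq_sym (negbTE neq) scale0r.
Qed.

End Weights.

Lemma free_sum_eq0 (K : fieldType) (V : vectType K) (I : eqType) (r : seq I)
    (F : I -> V) (c : I -> K) :
  free [seq F i | i <- r] -> \sum_(i <- r) c i *: F i = 0 ->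
  forall i, i \in r -> c i = 0.
Proof.
elim: r => [|j r IHr] //=; rewrite free_cons big_cons => /andP[Fj free_r] E0.
have cj0 : c j = 0.
  apply: contraNeq Fj => cj; have -> : F j = - (c j)^-1 *: \sum_(i <- r) c i *: F i.
    have := congr1 ( *:%R (c j)^-1) E0; rewrite scalerDr scalerA mulVf // scale1r scaler0.
    by move/eqP; rewrite addr_eq0 scaleNr => /eqP.
  rewrite memvZ // big_seq; apply: memv_suml => i ir.
  by rewrite memvZ // memv_span // map_f.
move=> i; rewrite in_cons => /orP[/eqP -> //|]; apply: IHr => //.
by move: E0; rewrite cj0 scale0r add0r.
Qed.

(** * Components of the elements of the stabilizer *)

Section Adjoint.
Variables (K : fieldType) (g : lieSuper K).

Lemma adjoint_representation : is_representation (@br K g).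
Proof.
split=> [c x y v|c x v w|a b x y v xa yb]; first exact: br_linearl.
  exact: br_linearr.
by rewrite (br_jacobi _ xa yb) addrK.
Qed.

Lemma br_even_cartan (C : chevalleyBasis g) y b (x : g) :
  y \in cartan C -> x \in lpart g b -> br x y = - br y x.
Proof.
case: (cartanP C) => /subvP h0 _ _ _ yh xb.
by rewrite (br_skew xb (h0 _ yh)) andbF expr0 scale1r.
Qed.

End Adjoint.

Section RootVectors.
Variables (K : fieldType) (g : lieSuper K) (C : chevalleyBasis g).

Local Notation h := (cartan C).
Local Notation roots := (croots C).
Local Notation X := (cX C).
Implicit Types (al be : lat (cdatum C)) (c : lat (cdatum C) -> K).

Lemma cX_lpart al : al \in roots -> exists b, X al \in lpart g b.
Proof.
case: (chevalleyP C) => [[_ XP] _ _ _ _] /XP[Xe|Xo]; first by exists false.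
by exists true.
Qed.

Lemma cX_free : free [seq X al | al <- roots].
Proof.
by case: (chevalleyP C) => [[/basis_free/catr_free]].
Qed.

Lemma cX_neq0 al : al \in roots -> X al != 0.
Proof.
by move=> alR; apply: (free_not0 cX_free); apply: map_f.
Qed.

Lemma cartan_root_direct : (h :&: <<[seq X al | al <- roots]>>)%VS = 0%VS.
Proof.
case: (chevalleyP C) => [[bg _] [bH _] _ _ _]; rewrite -(span_basis bH).
by have := basis_free bg; rewrite cat_free => /and3P[_ _ /directv_addP].
Qed.

Lemma root_decomposition (x : g) : exists2 y, y \in h &
  exists c, x = y + \sum_(al <- roots) c al *: X al.
Proof.
case: (chevalleyP C) => [[bg _] [bH _] _ _ _].
have : x \in fullv by rewrite memvf.
rewrite -(span_basis bg) span_cat (span_basis bH) => /memv_addP[y yh [z zX ->]].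
exists y => //; have [k -> _] := free_span cX_free zX.
by exists (fun al => k (X al)); rewrite big_map.
Qed.

Lemma root_decomposition_eq0 (y : g) c :
  y \in h -> y + \sum_(al <- roots) c al *: X al = 0 ->
  y = 0 /\ forall al, al \in roots -> c al = 0.
Proof.
move=> yh E0; set z := \sum_(al <- roots) _ in E0.
have zX : z \in <<[seq X al | al <- roots]>>%VS.
  by rewrite /z big_seq; apply: memv_suml => al alR; rewrite memvZ ?memv_span ?map_f.
have y0 : y = 0.
  apply/eqP; rewrite -memv0 -cartan_root_direct memv_cap yh /=.
  by rewrite -[y]opprK memvN (_ : - y = z) // -[LHS]addr0 -E0 addKr.
split=> //; apply: (free_sum_eq0 cX_free).
by move: E0; rewrite y0 add0r.
Qed.

(** A Chevalley basis prescribes only the brackets with the H_i. Since [wt] is an arbitrary function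
    in a [rootDatum], its linearity is assumed here; it is proved model by model in [wt_linear]. *)
Lemma br_cartan_cX al y : al \in roots -> y \in h ->
  (forall d x z, wt al (d *: x + z) = d * wt al x + wt al z) ->
  br y (X al) = wt al y *: X al.
Proof.
move=> alR /(cartan_coord)[c ->] wtL.
have adP := adjoint_representation g.
have wt0 : wt al (0 : g) = 0.
  by have := wtL (-1) 0 0; rewrite scaler0 addr0 mulN1r addNr.
have wtD x z : wt al (x + z) = wt al x + wt al z.
  by rewrite -[x]scale1r wtL mul1r scale1r.
have wtZ d x : wt al (d *: x) = d * wt al x.
  by rewrite -[_ *: x]addr0 wtL wt0 addr0.
case: (chevalleyP C) => _ _ [_ HX] _ _.
rewrite (act_suml adP) (big_morph (@wt _ _ (cdatum C) al) wtD wt0) scaler_suml.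
by apply: eq_bigr => i _; rewrite (actZl adP) HX // wtZ scalerA.
Qed.

End RootVectors.

(** * Stability of the Cartan part and of the root components *)

Section Stabilizer.
Variables (K : fieldType) (charK : [pchar K] =i pred0).
Variables (g : lieSuper K) (C : chevalleyBasis g) (V : superModule g).
Hypotheses (ratV : rational C V) (faithV : faithful V).
Variables (M : V -> Prop) (admM : admissible C M).

Local Notation h := (cartan C).
Local Notation hdual := 'Hom(subvs_of h, K^o).
Local Notation act := (@mact K g V).
Local Notation roots := (croots C).
Local Notation X := (cX C).
Local Notation stab := (stabilizer M).
Let actP := @mactP K g V.
Let latM : is_lattice M := admM.1.

Implicit Types (mu nu : hdual) (v w : V) (al be : lat (cdatum C)).

Lemma stab0 : stab 0.
Proof. by move=> v _; rewrite (act0l actP); apply: lattice0. Qed.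

Lemma stabD x y : stab x -> stab y -> stab (x + y).
Proof. by move=> Sx Sy v Mv; rewrite (actDl actP); apply: latticeD; [|apply: Sx|apply: Sy]. Qed.

Lemma stabMz x z : stab x -> stab (x *~ z).
Proof.
move=> Sx v Mv; rewrite -scaler_int (actZl actP) scaler_int.
by apply: latticeMz => //; apply: Sx.
Qed.

Lemma stabN x : stab x -> stab (- x).
Proof. by move=> Sx; rewrite -[x]mulr1z -mulrNz; apply: stabMz. Qed.

Lemma stabB x y : stab x -> stab y -> stab (x - y).
Proof. by move=> Sx Sy; apply: stabD Sx (stabN Sy). Qed.

Lemma stab_sum (I : eqType) (r : seq I) (F : I -> g) :
  (forall i, i \in r -> stab (F i)) -> stab (\sum_(i <- r) F i).
Proof.
move=> SF; rewrite big_seq; apply: big_ind => //; first exact: stab0.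
exact: stabD.
Qed.

Lemma stab_br a b x y : x \in lpart g a -> y \in lpart g b ->
  stab x -> stab y -> stab (br x y).
Proof.
move=> xa yb Sx Sy v Mv; case: actP => _ _ /(_ _ _ x y v xa yb) ->.
have Mxy : M (act x (act y v)) by apply/Sx/Sy.
have Myx : M (act y (act x v)) by apply/Sy/Sx.
by case: (a && b); rewrite ?expr0 ?expr1 ?scaleN1r ?scale1r ?opprK;
   [apply: latticeD | apply: latticeB].
Qed.

Lemma stab_cX al : al \in roots -> stab (X al).
Proof.
move=> /crootsP rt v Mv; rewrite -(uact_inj actP); apply: admM.2 => //.
apply: subring_gen_in; case: rt => rt; last by constructor 2; exists al.
constructor 1; exists al, 1; split=> //.
by rewrite /divided_power (_ : 1`!%:R = 1) ?invr1 ?scale1r ?expr1.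
Qed.

Lemma mact_cartan mu v y : weight_vector mu v -> y \in h ->
  act y v = (mu (vsproj h y) : K) *: v.
Proof. by move=> wv yh; have := wv (vsproj h y); rewrite vsprojK. Qed.

(** A basis of [M] spans [V], so the projection onto the weight [mu], which preserves [M], cannot
    kill all of it. *)
Lemma weight_vector_in_lattice mu : is_weight V mu ->
  exists v, [/\ v != 0, M v & weight_vector mu v].
Proof.
move=> wmu; case: (wmu) => v v0 mu_v.
have [L [p [_ LP pM pE [pL _]]]] := weight_decomposition charK ratV.
case: latM => b [bV bM].
suff /hasP[x xb px0] : has (fun x => p mu x != 0) b.
  have [wpx Mpx] := pM mu x wmu; exists (p mu x); split=> //; apply: Mpx => //.
  exact/bM/Zspan_in.
apply: contra_notT v0 => /hasPn p0.
have Epv := pE mu mu v wmu mu_v; rewrite eqxx scale1r in Epv; rewrite -Epv.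
have: v \in <<b>>%VS by rewrite (span_basis bV) memvf.
have pmu0 : p mu 0 = 0 by have := pL mu (-1) 0 0; rewrite scaler0 addr0 scaleN1r addNr.
move: v {Epv mu_v}; apply: span_ind => [//|c v w pv pw|w wb].
  by rewrite pL pv pw scaler0 addr0.
by have /p0 := wb; rewrite negbK => /eqP.
Qed.

Lemma stab_cartan y : y \in h -> stab y <->
  forall mu, is_weight V mu -> exists z : int, mu (vsproj h y) = z%:~R :> K.
Proof.
move=> yh; split=> [Sy mu wmu|Iy v Mv].
  have [v [v0 Mv mu_v]] := weight_vector_in_lattice wmu.
  apply: (lattice_powers_integral charK latM v0) => n.
  elim: n => [|n IHn]; first by rewrite expr0 scale1r.
  rewrite exprSr -scalerA -(mact_cartan mu_v yh) -(actZr actP).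
  exact: Sy.
have [L [p [_ LP pM _ [_ pD]]]] := weight_decomposition charK ratV.
rewrite (pD v) (act_sumr actP); apply: lattice_sum => // mu /LP wmu.
have [wp Mp] := pM mu v wmu; rewrite (mact_cartan wp yh).
by have [z ->] := Iy mu wmu; rewrite scaler_int; apply: latticeMz => //; apply: Mp.
Qed.

Section WithWeights.
(** The root as a functional on the Cartan subalgebra. For P(n) this is the restriction from the
    free module on the epsilon_i, which has a kernel; hence the hypotheses [whd_inj] and
    [whd_neq0]. *)
Variable whd : lat (cdatum C) -> hdual.
Hypothesis whdE : forall al y, y \in h -> wt al y = whd al (vsproj h y).
Hypothesis br_cX : forall al y, al \in roots -> y \in h -> br y (X al) = wt al y *: X al.
Hypothesis whd_inj : {in roots &, injective whd}.
Hypothesis whd_neq0 : forall al, al \in roots -> whd al != 0.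

Lemma weight_shift al mu v : al \in roots -> weight_vector mu v ->
  weight_vector (whd al + mu) (act (X al) v).
Proof.
move=> alR wv y; have yh := subvsP y.
have [b Xb] := cX_lpart alR.
have y0 : vsval y \in lpart g false by case: (cartanP C) => /subvP h0 _ _ _; apply: h0.
have [_ _ /(_ false b (vsval y) (X al) v y0 Xb)] := actP.
rewrite br_cX // (actZl actP) expr0 scale1r => /eqP; rewrite eq_sym subr_eq => /eqP ->.
by rewrite wv (actZr actP) -scalerDl whdE // vsvalK add_lfunE.
Qed.

(** For w in M of weight mu, the component of weight al + mu of the image of w is c_al X_al w: the
    Cartan part contributes in weight mu, and every other root in another weight. Unless X_al w
    vanishes, al + mu is a weight of [V], so the projection onto it is available. *)
Lemma stab_components y (c : lat (cdatum C) -> K) : y \in h ->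
  stab (y + \sum_(al <- roots) c al *: X al) ->
  stab y /\ forall al, al \in roots -> stab (c al *: X al).
Proof.
move=> yh Sx; have [L [p [_ LP pM pE [pL pD]]]] := weight_decomposition charK ratV.
have SX al : al \in roots -> stab (c al *: X al).
  move=> alR v Mv; rewrite (pD v) (act_sumr actP); apply: lattice_sum => // mu /LP wmu.
  have [wp /(_ M admM Mv) Mp] := pM mu v wmu; set w := p mu v in wp Mp *.
  rewrite (actZl actP); have [->|Xw0] := eqVneq (act (X al) w) 0.
    by rewrite scaler0; apply: lattice0.
  have wnu : is_weight V (whd al + mu).
    by exists (act (X al) w); [apply/eqP | apply: weight_shift].
  have [_ /(_ M admM (Sx w Mp))] := pM _ (act (y + \sum_(al <- roots) c al *: X al) w) wnu.
  have qL := pL (whd al + mu).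
  have q0 : p (whd al + mu) 0 = 0.
    by have := qL (-1) 0 0; rewrite scaler0 addr0 scaleN1r addNr.
  have qD u u' : p (whd al + mu) (u + u') = p (whd al + mu) u + p (whd al + mu) u'.
    by rewrite -[u]scale1r qL !scale1r.
  rewrite (actDl actP) (act_suml actP) qD (mact_cartan wp yh).
  rewrite (pE _ mu) //; last first.
    by move=> z; rewrite (actZr actP) wp !scalerA mulrC.
  rewrite -subr_eq0 opprD addrCA subrr addr0 oppr_eq0 (negbTE (whd_neq0 alR)) scale0r add0r.
  rewrite (big_morph _ qD q0) (bigD1_seq al) ?croots_uniq //=.
  rewrite (actZl actP) (pE _ (whd al + mu)) ?eqxx ?scale1r //; last first.
    by move=> z; rewrite (actZr actP) (weight_shift alR wp) !scalerA mulrC.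
  rewrite big_seq_cond big1 ?addr0 // => be /andP[beR neq].
  rewrite (actZl actP) (pE _ (whd be + mu)) //; last first.
    by move=> z; rewrite (actZr actP) (weight_shift beR wp) !scalerA mulrC.
  case: eqP => [/addIr /(whd_inj beR alR) E|_]; last by rewrite scale0r.
  by rewrite E eqxx in neq.
split=> //; have -> : y = y + \sum_(al <- roots) c al *: X al - \sum_(al <- roots) c al *: X al.
  by rewrite addrK.
by apply: stabB => //; apply: stab_sum.
Qed.

(** By faithfulness X_al does not kill every weight space, so mu and al + mu are both weights for
    some mu, and al(y) is the difference of their integral values at y. *)
Lemma root_integral_pairing al y : al \in roots -> y \in h -> stab y -> is_integer (wt al y).
Proof.
move=> alR yh /(stab_cartan yh) Iy.
have [L [p [_ LP pM _ [_ pD]]]] := weight_decomposition charK ratV.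
have [v Xv] : exists v, act (X al) v <> 0.
  apply/not_existsP => X0; have := cX_neq0 alR; rewrite (faithV (x := X al)) ?eqxx // => v.
  exact: contrapT (X0 v).
have /hasP[mu /LP wmu Xp0] : has (fun mu => act (X al) (p mu v) != 0) L.
  apply: contra_notT Xv => /hasPn X0; rewrite (pD v) (act_sumr actP) big_seq big1 //.
  by move=> mu /X0; rewrite negbK => /eqP.
have [wp _] := pM mu v wmu.
have wnu : is_weight V (whd al + mu).
  by exists (act (X al) (p mu v)); [apply/eqP | apply: weight_shift].
have -> : wt al y = (whd al + mu) (vsproj h y) - mu (vsproj h y).
  by rewrite add_lfunE addrK whdE.
by apply: is_integerB; apply: Iy.
Qed.

End WithWeights.
End Stabilizer.

(** * Root data *)

Section RootData.
Variables (K : fieldType) (charK : [pchar K] =i pred0) (g : lieSuper K).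
Implicit Types (C : chevalleyBasis g).

Lemma wt_linear C (al : lat (cdatum C)) d x z :
  wt al (d *: x + z) = d * wt al x + wt al z.
Proof.
case: C al => h hP [B|n phi] mP R roots Ru RP sim pos dist posP cr crP H X chP /= al.
  by rewrite /hdual_wt !linearP.
rewrite /P_wt mulr_sumr -big_split; apply: eq_bigr => i _ /=.
by rewrite linearP !mxE /=; ring.
Qed.

Lemma wtD C (al be : lat (cdatum C)) x : wt (al + be) x = wt al x + wt be x.
Proof.
case: C al be => h hP [B|n phi] mP R roots Ru RP sim pos dist posP cr crP H X chP /= al be.
  by rewrite /hdual_wt add_lfunE.
rewrite /P_wt -big_split; apply: eq_bigr => i _ /=.
by rewrite mxE intrD mulrDl.
Qed.

Lemma wt0 C x : wt (0 : lat (cdatum C)) x = 0.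
Proof. by apply: (addrI (wt (0 : lat (cdatum C)) x)); rewrite -wtD !addr0. Qed.

Lemma wtN C (al : lat (cdatum C)) x : wt (- al) x = - wt al x.
Proof. by apply/eqP; rewrite -addr_eq0 -wtD addNr wt0. Qed.

Lemma wtZ C (al : lat (cdatum C)) d x : wt al (d *: x) = d * wt al x.
Proof.
have wt_0 : wt al 0 = 0 by have := wt_linear al (-1) 0 0; rewrite scaler0 addr0 mulN1r addNr.
by have := wt_linear al d x 0; rewrite addr0 wt_0 addr0.
Qed.

Lemma br_cX C (al : lat (cdatum C)) y : al \in croots C -> y \in cartan C ->
  br y (cX C al) = wt al y *: cX C al.
Proof. by move=> alR yh; apply: br_cartan_cX => // d x z; apply: wt_linear. Qed.

Lemma cartan_comm C y z : y \in cartan C -> z \in cartan C -> br y z = 0.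
Proof.
have adP := adjoint_representation g.
case: (chevalleyP C) => _ _ [HH _] _ _ /cartan_coord[c ->] /cartan_coord[d ->].
rewrite (act_suml adP) big1 // => i _; rewrite (actZl adP) (act_sumr adP) big1 ?scaler0 //.
by move=> j _; rewrite (actZr adP) HH scaler0.
Qed.

Lemma br_cX_opp C (al : lat (cdatum C)) : al \in croots C -> - al \in croots C ->
  br (cX C al) (cX C (- al)) = ccoroot C al \/ br (cX C al) (cX C (- al)) = - ccoroot C al.
Proof.
move=> alR nalR; case: (chevalleyP C) => _ _ _ /(_ al alR nalR)[E1 E2] _.
by have [/E1|/E2] := pselect (odroot al /\ al \notin cpos C); [right | left].
Qed.

Lemma weight_functional C : exists whd : lat (cdatum C) -> 'Hom(subvs_of (cartan C), K^o),
  forall al y, y \in cartan C -> wt al y = whd al (vsproj (cartan C) y).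
Proof.
suff H : forall al : lat (cdatum C), exists f : 'Hom(subvs_of (cartan C), K^o),
    forall y, y \in cartan C -> wt al y = f (vsproj (cartan C) y).
  by have [f fE] := choice H; exists f.
move=> al; pose f (y : subvs_of (cartan C)) : K^o := wt al (vsval y).
have f_lin : linear f by move=> d x z; rewrite /f linearP wt_linear.
pose F : {linear subvs_of (cartan C) -> K^o} :=
  HB.pack f (GRing.isLinear.Build K (subvs_of (cartan C)) K^o _ f f_lin).
by exists (linfun F) => y yh; rewrite lfunE /= /f vsprojK.
Qed.

End RootData.

(* The root data depend on the model of C through the type of [lat]; this
   statement makes those of the basic model available without destructing C. *)
Lemma basic_datumP (K : fieldType) (g : lieSuper K) (C : chevalleyBasis g) :
  (forall n, ~ type_P g n) ->
  exists B : g -> g -> K,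
  [/\ invariant_form B,
      forall al be : lat (cdatum C),
        (forall y, y \in cartan C -> wt al y = wt be y) -> al = be,
      forall al : lat (cdatum C), al != 0 ->
        (exists x, [/\ x <> 0, x \in lpart g false & wt_space (cartan C) (wt al) x]) ->
        evroot al,
      forall al, al \in croots C ->
        [/\ exists t c, form_dual (cartan C) B (wt al) t /\ ccoroot C al = c *: t,
            ~ isotropic (cartan C) al -> wt al (ccoroot C al) = 2,
            isotropic (cartan C) al -> forall c : K,
              Zspan (fun d => exists2 be, be \in croots C & d = wt be (ccoroot C al)) c
              <-> (exists z : int, c = z%:~R)
          & ccoroot C (- al) = - ccoroot C al]
    & (forall al : lat (cdatum C),
        isotropic (cartan C) al <-> sqnorm0 (cartan C) B (wt al)) /\
      forall al be : lat (cdatum C), ~ exceptional al be].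
Proof.
move=> notP.
case: C => h hP [B|n phi] mP R roots Ru RP sim pos dist posP cr crP H X chP;
  last by have [isoP _] := mP; case: (notP n); exists phi.
exists B; split=> //=; first by have [] := mP.
- move=> al be E; apply/lfunP => y; rewrite -(vsvalK y).
  exact: E (subvsP y).
- by move=> al /eqP al0 Ex; split.
- move=> al /RP /crP[Ht H2 HZ HN]; split=> // /HZ {}HZ c; rewrite -HZ.
  by split=> -[s [sP ->]]; exists s; split=> // p /sP[be beR ->];
     exists be => //; apply/RP.
by split=> [al|al be []]; split.
Qed.

(** * Roots and their opposites in the presence of an invariant form *)

Section Basic.
Variables (K : fieldType) (charK : [pchar K] =i pred0) (g : lieSuper K).
Variable C : chevalleyBasis g.
Hypothesis notP : forall n, ~ type_P g n.

Local Notation h := (cartan C).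
Local Notation roots := (croots C).
Local Notation X := (cX C).
Local Notation cr := (ccoroot C).
Implicit Types (al be : lat (cdatum C)).

(** If 0 were a root, it would be isotropic with a coroot equal to its own opposite, hence zero; but
    the values of the roots at the coroot of an isotropic root generate Z. *)
Lemma basic_zero_not_root : 0 \notin roots.
Proof.
apply/negP => R0; have [B [Binv _ _ crP [isoP _]]] := basic_datumP C notP.
have [_ _ H0 crN] := crP 0 R0; rewrite oppr0 in crN.
have cr0 : cr 0 = 0.
  move/eqP: crN; rewrite -addr_eq0 -mulr2n -scaler_nat scaler_eq0.
  by rewrite (natr_eq0_char0 charK) => /eqP.
have B0l x : B 0 x = 0.
  case: Binv => /(_ (-1) 0 0 x)[+ _] _ _ _ _.
  by rewrite scaler0 addr0 mulN1r addNr.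
have /H0/(_ 1)[_ H1] : isotropic h (0 : lat (cdatum C)).
  apply/isoP; exists 0; last exact: B0l.
  by split=> [|y _]; rewrite ?mem0v ?B0l ?wt0.
have /H1[s [sP E1]] : exists z : int, 1 = z%:~R :> K by exists 1.
have /eqP := oner_neq0 K; apply; rewrite E1 big_seq big1 // => p /sP[be _ ->].
by rewrite cr0 -[0 : g](scale0r 0) wtZ mul0r mul0rz.
Qed.

(** If X_al pairs nontrivially with a vector of weight w, invariance gives al + w = 0. Nondegeneracy
    provides a partner, which may be taken in the Cartan subalgebra or among the root vectors. The
    first option would make al zero; in the second, the root of the partner is -al. *)
Lemma basic_opp_root al : al \in roots -> - al \in roots.
Proof.
move=> alR; have [B [[Blin _ _ Binv Bnd] wt_inj _ _ _]] := basic_datumP C notP.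
have BD x y z : B x (y + z) = B x y + B x z.
  by have [_] := Blin 1 y z x; rewrite scale1r mul1r.
have B0 x : B x 0 = 0 by apply: (addrI (B x 0)); rewrite -BD !addr0.
have BZ c x y : B x (c *: y) = c * B x y.
  by have [_] := Blin c y 0 x; rewrite !addr0 B0 addr0.
have BZl c x y : B (c *: x) y = c * B x y.
  have B0l z : B 0 z = 0.
    by have [+ _] := Blin (-1) 0 0 z; rewrite scaler0 addr0 mulN1r addNr.
  by have [+ _] := Blin c x 0 y; rewrite !addr0 B0l addr0.
have pair z (w : g -> K) : B (X al) z != 0 -> (forall y, y \in h -> br y z = w y *: z) ->
    forall y, y \in h -> wt al y = - w y.
  move=> Bz wz y yh; have [b Xb] := cX_lpart alR.
  have : B (br y (X al)) z = - B (X al) (br y z).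
    by rewrite -Binv (br_even_cartan yh Xb) -scaleN1r BZl mulN1r opprK.
  rewrite br_cX // wz // BZl BZ -mulNr => /eqP; rewrite (inj_eq (mulIf Bz)).
  by move/eqP.
have [z Bz] : exists z, B (X al) z <> 0.
  apply/not_existsP => B0X; have /eqP[] := cX_neq0 alR; apply: Bnd => z.
  exact: contrapT (B0X z).
have [y yh [c Ez]] := root_decomposition C z.
have [By0|By] := eqVneq (B (X al) y) 0; last first.
  case/negP: basic_zero_not_root; rewrite (_ : 0 = al) //; apply: wt_inj => y' y'h.
  rewrite wt0 (pair y (fun=> 0) By) ?oppr0 // => u uh.
  by rewrite scale0r (cartan_comm uh yh).
have /hasP[be beR Bbe] : has (fun be => B (X al) (X be) != 0) roots.
  apply: contra_notT Bz => /hasPn B0be; rewrite Ez BD By0 add0r.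
  rewrite (big_morph _ (BD (X al)) (B0 _)) big_seq big1 // => be /B0be.
  by rewrite negbK BZ => /eqP ->; rewrite mulr0.
rewrite (_ : - al = be) //; apply: wt_inj => y' y'h.
rewrite wtN (pair _ (wt be) Bbe) ?opprK // => u uh.
exact: br_cX.
Qed.

Lemma basic_cX_even al : al \in roots -> X al \in lpart g false -> evroot al.
Proof.
move=> alR Xe; have [B [_ _ evP _ _]] := basic_datumP C notP; apply: evP.
  by apply: contraTneq alR => ->; apply: basic_zero_not_root.
exists (X al); split=> //; first exact/eqP/cX_neq0.
by move=> y yh; apply: br_cX.
Qed.

Lemma basic_isotropicN al : isotropic h (- al) -> isotropic h al.
Proof.
have [B [[Blin _ _ _ _] _ _ _ [isoP _]]] := basic_datumP C notP.
have BNl x z : B (- x) z = - B x z.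
  have B0l u : B 0 u = 0.
    by have [+ _] := Blin (-1) 0 0 u; rewrite scaler0 addr0 mulN1r addNr.
  by have [+ _] := Blin (-1) x 0 z; rewrite addr0 scaleN1r B0l addr0 mulN1r.
have BNr x z : B z (- x) = - B z x.
  have B0r u : B u 0 = 0.
    by have [_ +] := Blin (-1) 0 0 u; rewrite scaler0 addr0 mulN1r addNr.
  by have [_ +] := Blin (-1) x 0 z; rewrite addr0 scaleN1r B0r addr0 mulN1r.
case/isoP => t [th tE] tt; apply/isoP; exists (- t); last by rewrite BNl BNr opprK.
split=> [|y yh]; first by rewrite memvN.
by rewrite BNl tE // wtN opprK.
Qed.

End Basic.

(** * Mechanisms forcing the coefficient of a root vector to be integral *)

Section RootCases.
Variables (K : fieldType) (charK : [pchar K] =i pred0) (g : lieSuper K).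
Variable C : chevalleyBasis g.

Local Notation h := (cartan C).
Local Notation roots := (croots C).
Local Notation X := (cX C).
Local Notation cr := (ccoroot C).
Implicit Types (al be : lat (cdatum C)).

Let adP := adjoint_representation g.

Lemma lpart_cap0 (x : g) : x \in lpart g false -> x \in lpart g true -> x = 0.
Proof. by move=> x0 x1; apply/eqP; rewrite -memv0 -(lpart_cap g) memv_cap x0. Qed.

(** The bracket of X_al and X_{-al} is the coroot up to sign, a nonzero even element, so the two
    parities agree. *)
Lemma cX_opp_lpart b al : al \in roots -> - al \in roots -> cr al \in h -> cr al != 0 ->
  X al \in lpart g b -> X (- al) \in lpart g b.
Proof.
move=> alR nalR crh cr0 Xb; have [b' Yb] := cX_lpart nalR.
suff -> : b = b' by [].
have hE : cr al \in lpart g false by case: (cartanP C) => /subvP hE _ _ _; apply: hE.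
have E : cr al \in lpart g (b (+) b').
  have := br_part Xb Yb.
  by case: (br_cX_opp alR nalR) => ->; rewrite ?memvN.
case: b b' E {Xb Yb} => -[] //= E; by rewrite (lpart_cap0 hE E) eqxx in cr0.
Qed.

(** If c X_al stabilizes the lattice, so does c H_al, and all c be(H_al) are integers. When 1 is an
    integral combination of the be(H_al), c is therefore an integer. *)
Variant unit_pairing al : Prop := UnitPairing of - al \in roots & cr al \in h &
  Zspan (fun d => exists2 be, be \in roots & d = wt be (cr al)) 1.

(* The reasons why [c *: X al] can stabilize an admissible lattice only if [c] is
   an integer. *)
Variant root_case al : Prop :=
| RootUnit of unit_pairing al
| RootShift be al' of be \in roots & al' \in roots & unit_pairing al' &
    (br (X be) (X al) = X al' \/ br (X be) (X al) = - X al')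
| RootOdd be of be \in roots & - al \in roots & cr al \in h & wt al (cr al) = 2 &
    (br (X be) (X al) = X (- al) \/ br (X be) (X al) = - X (- al))
| RootEven of - al \in roots & cr al \in h & wt al (cr al) = 2 & cr (- al) = - cr al &
    X al \in lpart g false & X (- al) \in lpart g false & evroot (- al).

Lemma eq_natr_sign m n :
  ((m%:R : K) = n%:R \/ (m%:R : K) = - n%:R) -> (0 < n)%N -> m = n.
Proof.
case=> /eqP.
  rewrite -subr_eq0 => E _; have [le_nm|/ltnW le_mn] := leqP n m.
    by move: E; rewrite -natrB // (natr_eq0_char0 charK); lia.
  by move: E; rewrite -oppr_eq0 opprB -natrB // (natr_eq0_char0 charK); lia.
by rewrite -addr_eq0 -natrD (natr_eq0_char0 charK); lia.
Qed.

Hypothesis notP : forall n, ~ type_P g n.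

(* With [Y = X (- al)] odd, [2 [Y, [Y, X al]] = [[Y, Y], X al]] is [4 Y] up to sign, and
   the string of [- al] through itself contains [- al, 0, al, 2 al], so
   [[Y, Y]] already accounts for the factor 4. *)
Lemma basic_odd_case al : al \in roots -> X al \in lpart g true ->
  cr al \in h -> wt al (cr al) = 2 -> cr (- al) = - cr al -> ~ isotropic h al ->
  exists2 be, be \in roots &
    (br (X be) (X al) = X (- al) \/ br (X be) (X al) = - X (- al)).
Proof.
move=> alR Xo crh cr2 crN niso; have nalR := basic_opp_root charK notP alR.
have [_ [_ _ _ _ [_ nexc]]] := basic_datumP C notP.
have two0 : (2 : K) != 0 by rewrite (natr_eq0_char0 charK).
have cr0 : cr al != 0.
  by apply: contra_neq two0 => E; rewrite -cr2 E -[0 : g](scale0r 0) wtZ mul0r.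
have Yo := cX_opp_lpart alR nalR crh cr0 Xo.
set Y := X (- al) in Yo *.
have al_neq : - al != al.
  apply: contra_neq two0 => E; have := congr1 (fun la => wt la (cr al)) E.
  rewrite /= wtN cr2 => /eqP; rewrite eq_sym -addr_eq0 -natrD.
  by rewrite (natr_eq0_char0 charK).
have al0 : al != 0.
  by apply: contraTneq alR => ->; apply: basic_zero_not_root.
have brY : br Y (br Y (X al)) = 2 *: Y \/ br Y (br Y (X al)) = - (2 *: Y).
  have E : br Y (cr al) = 2 *: Y.
    rewrite (br_even_cartan crh Yo) (br_cX nalR crh) wtN cr2.
    by rewrite scaleNr opprK.
  have := br_cX_opp nalR; rewrite opprK crN => /(_ alR)[] ->.
    by right; rewrite -scaleN1r (actZr adP) E scaleN1r.
  by left; rewrite opprK.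
have jac : br (br Y Y) (X al) = 4 *: Y \/ br (br Y Y) (X al) = - (4 *: Y).
  have /eqP := br_jacobi (X al) Yo Yo; rewrite /= expr1 scaleN1r eq_sym subr_eq.
  move/eqP => ->; case: brY => ->; [left|right].
    by rewrite -scalerDl -natrD.
  by rewrite -opprD -scalerDl -natrD.
have four0 : (4 : K) != 0 by rewrite (natr_eq0_char0 charK).
have Y0 : Y != 0 by apply: cX_neq0.
case: (chevalleyP C) => _ _ _ _ brXX.
have nal_neq : - al <> - - al by apply/eqP; rewrite opprK.
have [brYY0 brYY] := brXX _ _ nalR nalR nal_neq.
(* Otherwise [Y, Y] would vanish, against [jac]. *)
have deR : - al + - al \in roots.
  apply: contraT => /brYY0 E; case: jac => /eqP; rewrite -/Y in E; rewrite E (act0l adP).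
    by rewrite eq_sym scaler_eq0 (negbTE four0) (negbTE Y0).
  by rewrite eq_sym oppr_eq0 scaler_eq0 (negbTE four0) (negbTE Y0).
exists (- al + - al) => //.
have [c' Ec' [/(_ (or_introl _))c'P _]] := brYY deR.
have [|r' [_ r'max] [_ /(_ (nexc _ _)) c'r]] := c'P.
  by move=> /(basic_isotropicN notP).
have {brXX} := brXX _ _ deR alR; rewrite addrNK.
case=> [E|_ /(_ nalR)[d Ed [/(_ (or_intror niso)) [r _ [_ /(_ (nexc _ _)) dr]] _]]].
  case/negP: al0; rewrite -oppr_eq0; apply/eqP/(addrI (- al)).
  by rewrite addr0.
have r'3 : (3 <= r')%N.
  rewrite leqNgt; apply/negP => r'lt; apply: r'max.
  have : r' \in [:: 0; 1; 2]%N by move: r'lt; clear; case: r' => [|[|[|]]].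
  rewrite !inE => /or3P[]/eqP ->; rewrite mulNrn opprK.
  - by rewrite mulr1n addNr; right.
  - by left; apply/crootsP; rewrite mulr2n addKr.
  - left; apply/crootsP; rewrite !mulrS mulr0n addr0 addKr -[al + al]opprK opprD.
    exact: basic_opp_root.
have cd : (c' * d = 4 \/ c' * d = - 4).
  move: jac; rewrite -/Y Ec' (actZl adP) Ed scalerA => -[] /eqP.
    by rewrite -subr_eq0 -scalerBl scaler_eq0 (negbTE Y0) orbF subr_eq0 => /eqP ->; left.
  by rewrite -addr_eq0 -scalerDl scaler_eq0 (negbTE Y0) orbF addr_eq0 => /eqP ->; right.
(* Up to sign, r'+1 and r+1 are the constants of [Y, Y] and of its root vector bracketed with X al.
   As r'+1 is at least 4, the second constant is 1 up to sign. *)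
have rr : (r'.+1 * r.+1 = 4)%N.
  have neg (x : K) : - x = 4 \/ - x = - 4 -> x = 4 \/ x = - 4.
    by case=> [<-|/oppr_inj]; [right; rewrite opprK | left].
  apply: eq_natr_sign => //; rewrite natrM.
  by case: c'r cd => ->; case: dr => ->; rewrite ?mulrN ?mulNr ?opprK //; apply: neg.
have r0 : r = 0%N by move: rr r'3; clear; nia.
rewrite r0 in dr; rewrite Ed.
by case: dr => ->; rewrite ?scaleN1r ?scale1r; [left|right].
Qed.

Lemma basic_root_case al : al \in roots -> root_case al.
Proof.
move=> alR; have nalR := basic_opp_root charK notP alR.
have [B [_ _ _ crP _]] := basic_datumP C notP.
have [[t [c [[th _] crE]]] cr2 crZ crN] := crP al alR.
have crh : cr al \in h by rewrite crE memvZ.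
have [iso|niso] := pselect (isotropic h al).
  by apply: RootUnit; split=> //; apply/(crZ iso); exists 1.
have {}cr2 := cr2 niso.
have cr0 : cr al != 0.
  have : (2 : K) != 0 by rewrite (natr_eq0_char0 charK).
  by apply: contra_neq => E; rewrite -cr2 E -[0 : g](scale0r 0) wtZ mul0r.
have [[] Xb] := cX_lpart alR.
  by have [be beR E] := basic_odd_case alR Xb crh cr2 crN niso; apply: RootOdd E.
have Yb := cX_opp_lpart alR nalR crh cr0 Xb.
by apply: RootEven => //; apply: basic_cX_even.
Qed.

End RootCases.

(** * Integrality of the coefficients of root vectors *)

Section RootCoefficients.
Variables (K : fieldType) (charK : [pchar K] =i pred0).
Variables (g : lieSuper K) (C : chevalleyBasis g) (V : superModule g).
Hypotheses (ratV : rational C V) (faithV : faithful V).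
Variables (M : V -> Prop) (admM : admissible C M).

Local Notation h := (cartan C).
Local Notation act := (@mact K g V).
Local Notation roots := (croots C).
Local Notation X := (cX C).
Local Notation cr := (ccoroot C).
Local Notation stab := (stabilizer M).
Let actP := @mactP K g V.
Let adP := adjoint_representation g.
Let latM : is_lattice M := admM.1.

Implicit Types (al be : lat (cdatum C)).

Lemma stab_wt_integral al y : al \in roots -> y \in h -> stab y -> is_integer (wt al y).
Proof.
have [whd whdE] := weight_functional C; move=> alR yh Sy.
apply: (root_integral_pairing charK ratV faithV admM whdE _ alR yh Sy).
by move=> be z; apply: br_cX.
Qed.

Lemma stab_br_cX be al al' c : be \in roots -> al \in roots ->
  (br (X be) (X al) = X al' \/ br (X be) (X al) = - X al') ->
  stab (c *: X al) -> stab (c *: X al').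
Proof.
move=> beR alR E Sc; have [b Xb] := cX_lpart beR; have [a Xa] := cX_lpart alR.
have := stab_br admM Xb (memvZ c Xa) (stab_cX admM beR) Sc.
rewrite (actZr adP); case: E => -> // /(stabN admM).
by rewrite scalerN opprK.
Qed.

Lemma stab_coroot al c d : al \in roots -> - al \in roots ->
  stab (c *: X al) -> stab (d *: X (- al)) -> stab ((c * d) *: cr al).
Proof.
move=> alR nalR Sc Sd; have [b Xb] := cX_lpart alR; have [a Xa] := cX_lpart nalR.
have := stab_br admM (memvZ c Xb) (memvZ d Xa) Sc Sd.
rewrite (actZr adP) (actZl adP) scalerA mulrC.
case: (br_cX_opp alR nalR) => -> // /(stabN admM).
by rewrite scalerN opprK.
Qed.

Lemma stab_coroot1 al c : al \in roots -> - al \in roots ->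
  stab (c *: X al) -> stab (c *: cr al).
Proof.
move=> alR nalR Sc; rewrite -[c]mulr1; apply: stab_coroot => //.
by rewrite scale1r; apply: stab_cX.
Qed.

Lemma unit_pairing_integral al c : al \in roots -> unit_pairing al ->
  stab (c *: X al) -> is_integer c.
Proof.
move=> alR [nalR crh [s [sP E1]]] Sc; have Scr := stab_coroot1 alR nalR Sc.
rewrite -[c]mulr1 E1 mulr_sumr; apply: is_integer_sum => p ps _.
have [be beR ->] := sP p ps; rewrite -mulrzr mulrA; apply: is_integerM; last first.
  exact: is_integer_int.
by rewrite -wtZ; apply: stab_wt_integral => //; apply: memvZ.
Qed.

(* With [F2] the divided square of [F = X (- al)], the operator
   [F2 E - F E F + E F2] is half of [[F, [F, E]]], that is [F] up to sign. *)
Lemma stab_opp_even al c : al \in roots -> - al \in roots -> cr al \in h ->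
  wt al (cr al) = 2 -> cr (- al) = - cr al ->
  X al \in lpart g false -> X (- al) \in lpart g false -> evroot (- al) ->
  stab (c *: X al) -> stab (c *: X (- al)).
Proof.
move=> alR nalR crh cr2 crN Xe Ye evY Sc.
have two0 : (2 : K) != 0 by rewrite (natr_eq0_char0 charK).
have [e Ee eE] : exists2 e : K, e = 1 \/ e = -1 & br (X (- al)) (X al) = e *: cr al.
  have := br_cX_opp nalR; rewrite opprK crN => /(_ alR)[] ->.
    by exists (-1); rewrite ?scaleN1r //; right.
  by exists 1; rewrite ?scale1r ?opprK //; left.
set E := act (X al); set F := act (X (- al)); set A := act (e *: cr al).
have FE w : F (E w) = E (F w) + A w.
  have [_ _ /(_ _ _ _ _ w Ye Xe)] := actP.
  by rewrite eE expr0 scale1r -/E -/F -/A => ->; rewrite addrC subrK.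
have he : cr al \in lpart g false by case: (cartanP C) => /subvP he _ _ _; apply: he.
have FA w : F (A w) = A (F w) + (2 * e) *: F w.
  have [_ _ /(_ _ _ _ _ w Ye (memvZ e he))] := actP.
  rewrite -/A (actZr adP) (br_even_cartan crh Ye) (br_cX nalR crh) wtN cr2 scaleNr opprK.
  rewrite scalerA (actZl actP) expr0 scale1r -/F [e * 2]mulrC => ->.
  by rewrite addrC subrK.
pose F2 := uact act (divided_power (uinj (X (- al))) 2).
have F2E w : 2 *: F2 w = F (F w).
  rewrite /F2 (uact_divided_powerS actP) (uact_divided_powerS actP).
  rewrite (uact_divided_power0 actP) scalerA divff // scale1r (actZr actP).
  by rewrite invr1 scale1r.
have key w : F2 (E w) - F (E (F w)) + E (F2 w) = e *: F w.
  have FD x y : F (x + y) = F x + F y by apply: (actDr actP).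
  have EZ d x : E (d *: x) = d *: E x by apply: (actZr actP).
  apply: (scalerI two0); rewrite scalerDr scalerBr F2E -EZ F2E.
  rewrite FE FD FE FA scalerA; set p := E _; set q := A (F w); set r := (2 * e) *: _.
  rewrite scaler_nat mulr2n [p + q + (q + r)]addrC addrKA.
  by rewrite [q + r]addrC [p + q]addrC addrKA subrK.
have Ke : kostant C (divided_power (uinj (X (- al))) 2).
  by apply: subring_gen_in; constructor 1; exists (- al), 2.
have MF2 v : M v -> M (F2 v) by apply: admM.2.
have MF v : M v -> M (F v) by apply: stab_cX.
have McE v : M v -> M (c *: E v) by move/Sc; rewrite (actZl actP).
suff Se : stab ((e * c) *: X (- al)).
  by case: Ee Se => ->; rewrite ?mul1r // mulN1r scaleNr => /(stabN admM); rewrite opprK.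
(* Each term of [key] contains E exactly once, so the factor [c] can be attached to that E, and
   every term then preserves the lattice. *)
move=> v Mv; rewrite (actZl actP) mulrC -scalerA -/F -key scalerDr scalerBr.
apply: latticeD (McE _ (MF2 _ Mv)) => //; apply: latticeB => //.
  by rewrite -(uactZr actP); apply/MF2/McE.
by rewrite -(actZr actP); apply/MF/McE/MF.
Qed.

(** If 2c = m and 2c^2 = n, then m^2 = 2n, so m is even. *)
Lemma double_square_integral (c : K) : is_integer (2 * c) -> is_integer (2 * (c * c)) -> is_integer c.
Proof.
case=> m Em [n En]; have two0 : (2 : K) != 0 by rewrite (natr_eq0_char0 charK).
have Emn : m * m = 2 * n.
  by apply: (intr_inj_char0 charK); rewrite !intrM -Em -En; ring.
have [k Ek] : exists k, m = 2 * k by exists (m %/ 2)%Z; nia.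
by exists k; apply: (mulfI two0); rewrite Em Ek intrM.
Qed.

Lemma stab_opp_integral al c : al \in roots -> - al \in roots -> cr al \in h ->
  wt al (cr al) = 2 -> stab (c *: X al) -> stab (c *: X (- al)) -> is_integer c.
Proof.
move=> alR nalR crh cr2 Sc Snc; apply: double_square_integral.
  rewrite mulrC -cr2 -wtZ; apply: stab_wt_integral => //; first exact: memvZ.
  exact: stab_coroot1.
rewrite mulrC -cr2 -wtZ; apply: stab_wt_integral => //; first exact: memvZ.
exact: stab_coroot.
Qed.

Lemma root_case_integral al c : al \in roots -> root_case al ->
  stab (c *: X al) -> is_integer c.
Proof.
move=> alR [unit|be al' beR al'R unit E|be beR nalR crh cr2 E|nalR crh cr2 crN Xe Ye evY] Sc.
- exact: unit_pairing_integral Sc.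
- by apply: (unit_pairing_integral al'R unit); apply: stab_br_cX E Sc.
- by apply: (stab_opp_integral alR nalR crh cr2 Sc); apply: stab_br_cX E Sc.
- by apply: (stab_opp_integral alR nalR crh cr2 Sc); apply: stab_opp_even Sc.
Qed.

End RootCoefficients.

(** * The roots of P(n) *)

Section StrangeRoots.
Variable n : nat.
Implicit Types (la mu : 'rV[int]_n.+1) (i j k : 'I_n.+1).

Definition P_root la := P_evroot la \/ P_odroot la.

Lemma P_entries i j k :
  [/\ P_alpha i j 0 k = (k == i)%:Z - (k == j)%:Z,
      P_beta i j 0 k = (k == i)%:Z + (k == j)%:Z
    & P_gamma i 0 k = 2 * (k == i)%:Z].
Proof. by split; rewrite ?mulr2n !mxE eqxx /= 1?eq_sym //; lia. Qed.

(** The invariant that separates the roots of P(n) on the Cartan subalgebra: weights that agree on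
    the trace zero diagonal matrices differ by a constant row, whose coordinate sum is a multiple of
    n + 1, whereas roots have coordinate sum 0, 2 or -2. *)
Definition coord_sum la := \sum_k la 0 k.

Lemma coord_sumD la mu : coord_sum (la + mu) = coord_sum la + coord_sum mu.
Proof. by rewrite -big_split; apply: eq_bigr => k _; rewrite mxE. Qed.

Lemma coord_sumN la : coord_sum (- la) = - coord_sum la.
Proof. by rewrite -sumrN; apply: eq_bigr => k _; rewrite mxE. Qed.

Lemma coord_sum_delta i : coord_sum (delta_mx 0 i) = 1.
Proof.
rewrite /coord_sum (bigD1 i) //= mxE !eqxx big1 ?addr0 // => k ki.
by rewrite mxE (negbTE ki) andbF.
Qed.

Lemma coord_sum_P i j :
  [/\ coord_sum (P_alpha i j) = 0, coord_sum (P_beta i j) = 2 & coord_sum (P_gamma i) = 2].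
Proof.
by rewrite /P_alpha /P_beta /P_gamma mulr2n !coord_sumD coord_sumN !coord_sum_delta.
Qed.

Lemma P_root_coord_sum la : P_root la ->
  [/\ la != 0, (coord_sum la \in [:: 0; 2; -2]) & forall k, -2 <= la 0 k <= 2].
Proof.
have s0 mu : coord_sum mu != 0 -> mu != 0.
  apply: contra_neq => ->; apply: (addrI (coord_sum (0 : 'rV[int]_n.+1))).
  by rewrite -coord_sumD !addr0.
case=> [[i [j [ij ->]]]|[[[i [j [_ ->]]]|[i ->]]|[i [j [_ ->]]]]].
- have [sE _ _] := coord_sum_P i j; split=> [||k]; last first.
  + by have [-> _ _] := P_entries i j k; do 2!case: eqP.
  + by rewrite sE.
  apply/eqP => /matrixP/(_ 0 i); have [-> _ _] := P_entries i j i.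
  by rewrite mxE eqxx (negbTE ij).
- have [_ sE _] := coord_sum_P i j; split; rewrite ?s0 ?sE // => k.
  by have [_ -> _] := P_entries i j k; do 2!case: eqP.
- have [_ _ sE] := coord_sum_P i i; split; rewrite ?s0 ?sE // => k.
  by have [_ _ ->] := P_entries i i k; case: eqP.
have [_ sE _] := coord_sum_P i j; split; rewrite ?s0 ?coord_sumN ?sE // => k.
by rewrite mxE; have [_ -> _] := P_entries i j k; do 2!case: eqP.
Qed.

Lemma P_alpha_opp i j : - P_alpha i j = P_alpha j i.
Proof. by rewrite /P_alpha opprB. Qed.

Lemma ord_third i j : (2 <= n)%N -> exists k, k != i /\ k != j.
Proof.
move=> n2; suff /existsP[k /andP[ki kj]] : [exists k, (k != i) && (k != j)] by exists k.
apply: contraT; rewrite negb_exists => /forallP kij.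
have : (#|'I_n.+1| <= #|[set i; j]|)%N.
  rewrite -cardsT; apply/subset_leq_card/subsetP => k _.
  by have := kij k; rewrite negb_and !negbK !inE.
by rewrite card_ord cards2; case: (i != j); lia.
Qed.

End StrangeRoots.

(** * Restriction of the roots of P(n) to the Cartan subalgebra *)

Section StrangeDatum.
Variables (K : fieldType) (charK : [pchar K] =i pred0) (g : lieSuper K).
Variables (h : {vspace g}) (n : nat) (phi : 'Hom(g, 'M[K]_(n.+1 + n.+1))).
Hypotheses (isoP : iso_P phi) (h_diag : forall x, x \in h <-> is_diag_mx (phi x)).
Implicit Types (la mu : 'rV[int]_n.+1) (i j k : 'I_n.+1).

Let n2 : (2 <= n)%N. Proof. by case: isoP. Qed.

Lemma diag_delta i j : is_diag_mx (delta_mx i i - delta_mx j j : 'M[K]_n.+1).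
Proof.
apply/is_diag_mxP => k l kl; rewrite !mxE.
have kl_neq m : (k == m) && (l == m) = false.
  by apply/negP => /andP[/eqP kE /eqP lE]; rewrite kE lE eqxx in kl.
by rewrite !kl_neq subrr.
Qed.

Lemma P_cartan_block (x : g) i j :
  phi x = block_mx (delta_mx i i - delta_mx j j) 0 0 (- (delta_mx i i - delta_mx j j)) ->
  x \in h.
Proof.
move=> Ex; apply/h_diag; rewrite Ex is_diag_block_mx // !eqxx /= diag_delta.
by rewrite opprB diag_delta.
Qed.

Lemma P_wt_block la (x : g) i j :
  ulsubmx (phi x) = delta_mx i i - delta_mx j j ->
  P_wt phi la x = (la 0 i - la 0 j)%:~R.
Proof.
have sum_delta k : \sum_l (la 0 l)%:~R * (delta_mx k k l l : K) = (la 0 k)%:~R.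
  rewrite (bigD1 k) //= mxE !eqxx mulr1 big1 ?addr0 // => l lk.
  by rewrite mxE (negbTE lk) mulr0.
rewrite /P_wt intrB => ->; rewrite -!sum_delta -sumrB; apply: eq_bigr => l _.
by rewrite !mxE mulrBr.
Qed.

Lemma P_cartan_elt i j : exists2 x, x \in h &
  ulsubmx (phi x) = delta_mx i i - delta_mx j j.
Proof.
have [_ _ imP _ _] := isoP.
set D : 'M[K]_n.+1 := delta_mx i i - delta_mx j j.
have [x Ex] : exists x, phi x = block_mx D 0 0 (- D).
  apply/imP; exists D, 0, 0; split; rewrite ?trmx0 ?oppr0 //.
    have tr_delta k : \tr (delta_mx k k : 'M[K]_n.+1) = 1.
      rewrite /mxtrace (bigD1 k) //= mxE !eqxx big1 ?addr0 // => l lk.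
      by rewrite mxE (negbTE lk).
    by rewrite /D raddfB /= !tr_delta subrr.
  by congr (block_mx _ _ _ (- _)); rewrite /D linearB /= !trmx_delta.
by exists x; [apply: P_cartan_block Ex | rewrite Ex block_mxKul].
Qed.

Lemma P_wt_eq la mu : (forall x, x \in h -> P_wt phi la x = P_wt phi mu x) ->
  exists c, la = mu + const_mx c.
Proof.
move=> E; exists (la 0 0 - mu 0 0); apply/rowP => i; rewrite !mxE.
have [x xh xE] := P_cartan_elt i 0; have := E x xh.
rewrite !(P_wt_block _ xE) => /(intr_inj_char0 charK)/eqP.
by rewrite subr_eq -addrA [- _ + _]addrC => /eqP.
Qed.

Lemma P_wt_root_neq0 la : P_root la -> ~ (forall x, x \in h -> P_wt phi la x = 0).
Proof.
move=> /P_root_coord_sum[la0 s_la _] E.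
have [c Ec] : exists c, la = 0 + const_mx c.
  apply: P_wt_eq => x xh; rewrite E // /P_wt big1 // => i _.
  by rewrite mxE mul0r.
rewrite add0r in Ec; move: s_la; have -> : coord_sum la = c * n.+1%:Z.
  rewrite /coord_sum Ec; under eq_bigr do rewrite mxE.
  by rewrite sumr_const card_ord -mulr_natr natz.
have [c0|c0] := eqVneq c 0; first by rewrite Ec c0 eqxx in la0.
by rewrite !inE => /or3P[] /eqP; have := n2; nia.
Qed.

(** The coordinate sums of two roots differ by 0, 2 or 4 in absolute value. A nonzero multiple of n
    + 1 >= 3 is among these only if n + 1 = 4, and for n = 3 the roots beta_12 and -beta_34 do agree
    on the Cartan subalgebra. *)
Lemma P_wt_root_inj la mu : n <> 3%N -> P_root la -> P_root mu ->
  (forall x, x \in h -> P_wt phi la x = P_wt phi mu x) -> la = mu.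
Proof.
move=> n3 /P_root_coord_sum[_ s_la _] /P_root_coord_sum[_ s_mu _] /P_wt_eq[c Ec].
have : coord_sum la = coord_sum mu + c * n.+1%:Z.
  rewrite Ec coord_sumD; congr (_ + _); rewrite /coord_sum.
  by under eq_bigr do rewrite mxE; rewrite sumr_const card_ord -mulr_natr natz.
have [c0 _|c0] := eqVneq c 0; first by rewrite Ec c0 addr0.
move: s_la s_mu; rewrite !inE => /or3P[] /eqP -> /or3P[] /eqP ->; have := n2; nia.
Qed.

(** The dual element t need not be computed. For x = E_ii - E_jj the form of t and x is t_ii - t_jj
    = alpha(t), the square norm of t, while by duality it is alpha(x) = 2. *)
Lemma P_alpha_anisotropic i j : i != j ->
  ~ sqnorm0 h (P_form phi) (P_wt phi (P_alpha i j)).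
Proof.
move=> ij [t [th tE] tt].
have tr_delta (A : 'M[K]_n.+1) k : \tr (A *m delta_mx k k) = A k k.
  rewrite /mxtrace (bigD1 k) //= mxE (bigD1 k) //= mxE !eqxx mulr1.
  rewrite !big1 ?addr0 // => [l lk|l lk]; last by rewrite mxE (negbTE lk) mulr0.
  by rewrite mxE big1 // => m _; rewrite mxE (negbTE lk) andbF mulr0.
have [x xh xE] := P_cartan_elt i j.
have : P_form phi t x = 0.
  rewrite /P_form xE mulmxBr raddfB /= !tr_delta -tt tE // /P_wt.
  transitivity (\sum_k ((k == i)%:R - (k == j)%:R) * (ulsubmx (phi t) k k)).
    under eq_bigr do rewrite mulrBl; rewrite sumrB.
    by congr (_ - _); [rewrite (bigD1 i)|rewrite (bigD1 j)]; rewrite //= eqxx mul1r big1 ?addr0 //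
       => k /negbTE ->; rewrite mul0r.
  apply: eq_bigr => k _; have [-> _ _] := P_entries i j k.
  by rewrite intrB.
rewrite tE // (P_wt_block _ xE); have [-> _ _] := P_entries i j i.
have [-> _ _] := P_entries i j j.
rewrite !eqxx [j == i]eq_sym (negbTE ij) => /eqP.
by rewrite (intr_eq0_char0 charK).
Qed.

Lemma P_alpha_coroot cr i j : P_coroot phi cr -> i != j ->
  cr (P_alpha i j) \in h /\
  forall la, P_wt phi la (cr (P_alpha i j)) = (la 0 i - la 0 j)%:~R.
Proof.
case=> crA _ ij; have E := crA i j ij; split; first exact: P_cartan_block E.
by move=> la; apply: P_wt_block; rewrite E block_mxKul.
Qed.

End StrangeDatum.

(** * Separation and classification of roots in both models *)

Section AllRoots.
Variables (K : fieldType) (charK : [pchar K] =i pred0) (g : lieSuper K).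
Implicit Type C : chevalleyBasis g.

Lemma wt_root_neq0 C (al : lat (cdatum C)) : al \in croots C ->
  ~ (forall y, y \in cartan C -> wt al y = 0).
Proof.
have [notP|/existsNP[k /contrapT isP]] := pselect (forall n, ~ type_P g n).
  move=> alR E; have [B [_ wt_inj _ _ _]] := basic_datumP C notP.
  case/negP: (basic_zero_not_root charK C notP); rewrite (_ : 0 = al) //.
  by apply: wt_inj => y yh; rewrite wt0 E.
case: C al => h hP [B|n phi] mP R roots Ru RP sim pos dist posP cr crP H X chP /= al.
  by have [/(_ k)] := mP.
have [isoP h_diag] := mP.
by move=> /RP; apply: (P_wt_root_neq0 charK isoP h_diag).
Qed.

Lemma wt_root_inj C (al be : lat (cdatum C)) : ~ type_P g 3 ->
  al \in croots C -> be \in croots C ->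
  (forall y, y \in cartan C -> wt al y = wt be y) -> al = be.
Proof.
move=> notP3.
have [notP|/existsNP[k /contrapT isP]] := pselect (forall n, ~ type_P g n).
  by move=> _ _ E; have [B [_ wt_inj _ _ _]] := basic_datumP C notP; apply: wt_inj.
case: C al be => h hP [B|n phi] mP R roots Ru RP sim pos dist posP cr crP H X chP /= al be.
  by have [/(_ k)] := mP.
have [isoP h_diag] := mP.
move=> /RP alR /RP beR; apply: (P_wt_root_inj charK isoP h_diag) => // n3.
by apply: notP3; rewrite -n3; exists phi.
Qed.

Lemma strange_root_case C n (al : lat (cdatum C)) : type_P g n ->
  al \in croots C -> root_case al.
Proof.
move=> isP.
case: C al => h hP [B|k phi] mP R roots Ru RP sim pos dist posP cr crP H X chP /= al.
  by have [/(_ n)] := mP.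
have [isoP h_diag] := mP; have k2 : (2 <= k)%N by case: isoP.
have crA i j := P_alpha_coroot h_diag crP (i := i) (j := j).
have [_ crB] := crP.
have alphaR i j : i != j -> P_alpha i j \in roots.
  by move=> ij; apply/RP; left; exists i, j.
have betaR (i j : 'I_k.+1) : (i < j)%N -> P_beta i j \in roots.
  by move=> ij; apply/RP; right; left; left; exists i, j.
have nbetaR (i j : 'I_k.+1) : (i < j)%N -> - P_beta i j \in roots.
  by move=> ij; apply/RP; right; right; exists i, j.
(* The coroot of -beta_ij is the opposite of that of alpha_ij, whence the sign [s]. A third index
   [l] gives a root, alpha_il or alpha_li, with value exactly 1 at [z]. *)
have pairA (z : g) (s : bool) i j : i != j -> z = (if s then - cr (P_alpha i j) else cr (P_alpha i j)) ->
    z \in h /\ Zspan (fun d => exists2 be, be \in roots & d = P_wt phi be z) 1.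
  move=> ij ->; have [Hh HW] := crA i j ij; split; first by case: s; rewrite ?memvN.
  have [l [li lj]] := ord_third i j k2.
  have PwtN la x : P_wt phi la (- x) = - P_wt phi la x.
    rewrite /P_wt -sumrN; apply: eq_bigr => m _.
    by rewrite linearN !mxE mulrN.
  apply: Zspan_in; case: s; last first.
    exists (P_alpha i l); first by apply: alphaR; rewrite eq_sym.
    rewrite HW; have [-> _ _] := P_entries i l i; have [-> _ _] := P_entries i l j.
    by rewrite eqxx ![_ == l]eq_sym (negbTE li) (negbTE lj) [j == i]eq_sym (negbTE ij).
  exists (P_alpha l i); first exact: alphaR.
  rewrite PwtN HW -mulrNz; have [-> _ _] := P_entries l i i; have [-> _ _] := P_entries l i j.
  by rewrite eqxx ![_ == l]eq_sym (negbTE li) (negbTE lj) [j == i]eq_sym (negbTE ij).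
have unitB (i j : 'I_k.+1) : (i < j)%N ->
    unit_pairing (C := ChevalleyBasis hP mP Ru RP dist posP crP chP) (P_beta i j).
  move=> ij; have [E1 E2] := crB i j ij; have ij' : i != j by rewrite neq_ltn ij.
  by have [Hh HZ] := pairA _ false i j ij' E1; split=> //=; apply: nbetaR.
have stringA i j (ij : i != j) : ~ isotropic h (R := P_datum phi) (P_alpha i j).
  exact: (P_alpha_anisotropic charK isoP h_diag).
move=> /RP[[i [j [ij ->]]]|[[[i [j [ij ->]]]|[i ->]]|[i [j [ij ->]]]]].
- apply: RootUnit; have [Hh HZ] := pairA _ false i j ij erefl; split=> //=.
  by rewrite P_alpha_opp; apply: alphaR; rewrite eq_sym.
- exact/RootUnit/unitB.
- have [j [ji _]] := ord_third i i k2.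
  have [b [bR unitb Eb]] : exists b, [/\ b \in roots,
      unit_pairing (C := ChevalleyBasis hP mP Ru RP dist posP crP chP) b
      & P_alpha j i + P_gamma i = b].
    have E : P_alpha j i + P_gamma i = P_beta j i.
      by rewrite /P_alpha /P_gamma /P_beta mulr2n addrA subrK.
    have [lt_ij|lt_ji|] := ltngtP i j; first 1 last.
    + by exists (P_beta j i); split=> //; [apply: betaR | apply: unitB].
    + by move/val_inj => Eij; rewrite Eij eqxx in ji.
    exists (P_beta i j); split; [exact: betaR | exact: unitB|].
    by rewrite E /P_beta addrC.
  have gR : P_gamma i \in roots by apply/RP; right; left; right; exists i.
  have neq : P_alpha j i <> - P_gamma i.
    move/(congr1 (@coord_sum k)); rewrite coord_sumN.
    by have [-> _ _] := coord_sum_P j i; have [_ _ ->] := coord_sum_P i i.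
  have [_ _ _ _ /(_ _ _ (alphaR _ _ ji) gR neq)[_]] := chP.
  rewrite Eb => /(_ bR)[c Ec [/(_ (or_introl (stringA _ _ ji)))[r [r0 _] [_ cP]] _]].
  (* The string cannot go back one step: gamma_i - alpha_ji has coordinate 3 at i, too large for a
     root, and coordinate sum 2, so it is not zero either. *)
  have {}r0 : r = 0%N.
    case: r r0 {cP} => // r /(_ 1%N isT) [].
      rewrite mulr1n => /P_root_coord_sum[_ _ /(_ i)].
      rewrite mxE [(- P_alpha j i) 0 i]mxE; have [_ _ ->] := P_entries i i i.
      have [-> _ _] := P_entries j i i.
      by rewrite eqxx [i == j]eq_sym (negbTE ji).
    move/(congr1 (@coord_sum k)); rewrite coord_sumD coord_sumN.
    have [_ _ ->] := coord_sum_P i i; have [-> _ _] := coord_sum_P j i.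
    have -> : coord_sum (0 : 'rV_k.+1) = 0; last by [].
    by rewrite /coord_sum big1 // => l _; rewrite mxE.
  apply: (RootShift (C := ChevalleyBasis hP mP Ru RP dist posP crP chP) (alphaR _ _ ji) bR unitb).
  rewrite /= Ec; case: cP => [|->|->]; rewrite ?r0 ?scaleN1r ?scale1r; [|by left|by right].
  (* The pair is not exceptional: alpha_ji has coordinate sum 0, while the first member of an
     exceptional pair is a beta, with sum 2. *)
  case=> l [m [lm + _]] => /(congr1 (@coord_sum k)).
  by have [-> _ _] := coord_sum_P j i; have [_ -> _] := coord_sum_P m l.
have [E1 E2] := crB i j ij; have ij' : i != j by rewrite neq_ltn ij.
have [Hh HZ] := pairA _ true i j ij' E2; apply: RootUnit; split=> //=.
by rewrite opprK; apply: betaR.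
Qed.

Lemma root_caseP C (al : lat (cdatum C)) : al \in croots C -> root_case al.
Proof.
have [notP|/existsNP[k /contrapT isP]] := pselect (forall n, ~ type_P g n).
  exact: basic_root_case.
exact: strange_root_case isP.
Qed.

End AllRoots.

Lemma Zspan_ind (V : zmodType) (S P : V -> Prop) :
  P 0 -> (forall v w, P v -> P w -> P (v + w)) ->
  (forall v (z : int), P v -> P (v *~ z)) -> (forall v, S v -> P v) ->
  forall v, Zspan S v -> P v.
Proof.
move=> P0 PD PM SP _ [s [Ss ->]]; rewrite big_seq.
by apply: big_ind => // p ps; apply: PM; apply: SP; apply: Ss.
Qed.

(** * The stabilizer of an admissible lattice *)

Section StabilizerLattice.
Variables (K : fieldType) (charK : [pchar K] =i pred0).
Variables (g : lieSuper K) (C : chevalleyBasis g) (V : superModule g).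
Hypotheses (notP3 : ~ type_P g 3) (ratV : rational C V) (faithV : faithful V).

Local Notation h := (cartan C).
Local Notation act := (@mact K g V).
Local Notation roots := (croots C).
Local Notation X := (cX C).
Let actP := @mactP K g V.
Implicit Types M : V -> Prop.

Lemma integral_cartanP M y : admissible C M ->
  integral_cartan C V y <-> y \in h /\ stabilizer M y.
Proof.
move=> admM; split=> -[yh Iy]; split=> //.
  exact/(stab_cartan charK ratV admM yh).
exact/(stab_cartan charK ratV admM yh).
Qed.

Lemma stabilizerP M x : admissible C M ->
  stabilizer M x <-> exists (y : g) (n : lat (cdatum C) -> int),
    integral_cartan C V y /\ x = y + \sum_(al <- roots) X al *~ n al.
Proof.
move=> admM; split=> [Sx|[y [n [/(integral_cartanP _ admM)[yh Sy] ->]]]]; last first.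
  apply: (stabD admM) => //; apply: (stab_sum admM) => al alR.
  exact: (stabMz admM _ (stab_cX admM alR)).
have [y yh [c Ex]] := root_decomposition C x; rewrite Ex in Sx.
have [whd whdE] := weight_functional C.
have whd_inj : {in roots &, injective whd}.
  move=> al be alR beR E; apply: (wt_root_inj charK notP3 alR beR) => z zh.
  by rewrite !whdE // E.
have whd_neq0 al : al \in roots -> whd al != 0.
  move=> alR; apply/eqP => E; apply: (wt_root_neq0 charK alR) => z zh.
  by rewrite whdE // E zero_lfunE.
have br_cX' al z := @br_cX K g C al z.
have [Sy Sc] := stab_components charK ratV admM whdE br_cX' whd_inj whd_neq0 yh Sx.
have /choice[n nE] : forall al, exists z : int, al \in roots -> c al = z%:~R.
  move=> al; have [alR|] := boolP (al \in roots); last by exists 0.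
  by have [z Ez] := root_case_integral charK ratV faithV admM alR (root_caseP charK alR)
    (Sc al alR); exists z.
exists y, n; split; first exact/(integral_cartanP _ admM).
rewrite Ex; congr (_ + _); rewrite big_seq [RHS]big_seq; apply: eq_bigr => al alR.
by rewrite nE // scaler_int.
Qed.

Lemma integral_cartan_lattice : exists b, basis_of h b /\
  forall y, integral_cartan C V y <-> Zspan (fun x => x \in b) y.
Proof.
have [L [p [_ LP pM pE [_ pD]]]] := weight_decomposition charK ratV.
have [_ [bH _] _ _ _] := chevalleyP C.
pose vec (c : 'cV[K]_(\dim h)) := \sum_k c k 0 *: cH C k.
have vech c : vec c \in h.
  by apply: memv_suml => k _; rewrite memvZ // cH_cartan.
have vecP y : y \in h -> exists c, y = vec c.
  case/cartan_coord => c ->; exists (\col_k c k); rewrite /vec.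
  by apply: eq_bigr => k _; rewrite mxE.
have wt_vec (mu : 'Hom(subvs_of h, K^o)) c :
    mu (vsproj h (vec c)) = \sum_k c k 0 * mu (vsproj h (cH C k)).
  by rewrite !linear_sum; apply: eq_bigr => k _; rewrite !linearZ.
have [W WE] : exists W : 'M[int]_(size L, \dim h),
    map_mx intr W = \matrix_(i, k) (L`_i) (vsproj h (cH C k)).
  have [|W EW] := @is_integer_mx K _ _ (\matrix_(i < size L, k < \dim h) (L`_i) (vsproj h (cH C k))).
    move=> i k; rewrite mxE; apply: (weight_integral ratV).
    by apply/LP; apply: mem_nth.
  by exists W.
have Wvec c i : (map_mx intr W *m c) i 0 = (L`_i) (vsproj h (vec c)) :> K.
  rewrite WE wt_vec mxE; apply: eq_bigr => k _; by rewrite mxE mulrC.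
have vec0 c : vec c = 0 -> c = 0.
  move=> E; apply/colP => k; rewrite mxE.
  apply: (free_sum_eq0 (r := enum 'I_(\dim h)) (F := cH C) (c := fun k => c k 0)).
  - exact: (basis_free bH).
  - by rewrite big_enum.
  - by rewrite mem_enum.
have [|B uB BP] := integral_preimage_lattice charK (W := W).
  (* An element of the Cartan subalgebra at which all weights vanish acts by zero on [V], so
     faithfulness makes the matrix of weights injective. *)
  move=> c Wc0; apply/vec0/faithV => v.
  rewrite (pD v) (act_sumr actP) big_seq big1 // => mu muL.
  have [wp _] := pM mu v (proj1 (LP mu) muL).
  rewrite (mact_cartan wp (vech c)).
  have /(nthP 0)[i ltiL <-] := muL.
  by rewrite -(Wvec c (Ordinal ltiL)) Wc0 mxE scale0r.
have integral_vec c : integral_cartan C V (vec c) <-> forall i, is_integer ((map_mx intr W *m c) i 0 : K).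
  split=> [[_ Ic] i|Ic].
    by rewrite Wvec; apply: Ic; apply/LP; apply: mem_nth.
  split=> // mu /LP /(nthP 0)[i ltiL <-].
  by rewrite -(Wvec c (Ordinal ltiL)); apply: Ic.
pose b := [seq vec (col k B) | k <- enum 'I_(\dim h)].
have vecB d : vec (B *m d) = \sum_k d k 0 *: vec (col k B).
  rewrite /vec; under [RHS]eq_bigr do rewrite scaler_sumr.
  rewrite exchange_big; apply: eq_bigr => i _; rewrite mxE scaler_suml.
  by apply: eq_bigr => k _; rewrite mxE scalerA mulrC.
have bP k : vec (col k B) \in b by apply/mapP; exists k; rewrite ?mem_enum.
exists b; split.
  rewrite basisEdim size_map size_enum_ord leqnn andbT; apply/subvP => y /vecP[c ->].
  rewrite -[c](mulKVmx uB) vecB; apply: memv_suml => k _.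
  by rewrite memvZ // memv_span.
have vec_span c : integral_cartan C V (vec c) <-> Zspan (fun x => x \in b) (vec c).
  rewrite integral_vec BP; split=> [[z ->]|].
    rewrite vecB; apply: Zspan_sum => k _.
    by rewrite mxE scaler_int; apply: ZspanMz; apply: Zspan_in.
  have vec_inj d d' : vec d = vec d' -> d = d'.
    move=> E; apply/eqP; rewrite -subr_eq0; apply/eqP/vec0.
    rewrite /vec -[RHS](subrr (vec d')) -{1}E -sumrB; apply: eq_bigr => k _.
    by rewrite !mxE scalerBl.
  suff H : forall y, Zspan (fun x => x \in b) y -> exists z : 'cV[int]_(\dim h), y = vec (B *m map_mx intr z).
    by move=> /H[z /vec_inj ->]; exists z.
  have vecD d d' : vec (d + d') = vec d + vec d'.
    by rewrite /vec -big_split; apply: eq_bigr => k _; rewrite !mxE scalerDl.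
  apply: Zspan_ind => [|_ _ [z ->] [z' ->]|_ m [z ->]|_ /mapP[k _ ->]].
  - by exists 0; rewrite map_mx0 mulmx0 /vec big1 // => k _; rewrite mxE scale0r.
  - by exists (z + z'); rewrite map_mxD mulmxDr vecD.
  - exists (m *: z); rewrite map_mxZ -scalemxAr /vec -scaler_int scaler_sumr.
    by apply: eq_bigr => k _; rewrite [in RHS]mxE scalerA.
  - by exists (delta_mx k 0); rewrite map_delta_mx -colE.
move=> y; split=> [Iy|Zy].
  by have [c Ey] := vecP y Iy.1; move: Iy; rewrite Ey => /vec_span.
have [c Ey] : exists c, y = vec c.
  apply: vecP; move: y Zy; apply: Zspan_ind => [|v w|v z vh|_ /mapP[k _ ->]].
  - exact: mem0v.
  - exact: memvD.
  - by rewrite -scaler_int memvZ.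
  - exact: vech.
by move: Zy; rewrite Ey => /vec_span.
Qed.

Lemma stabilizer_lattice M : admissible C M -> is_lattice (stabilizer M).
Proof.
move=> admM; have [b [bh bP]] := integral_cartan_lattice.
exists (b ++ [seq X al | al <- roots]); split.
  have [[bg _] [bH _] _ _ _] := chevalleyP C.
  have -> : fullv = (h + <<[seq X al | al <- roots]>>)%VS.
    by rewrite -(span_basis bg) span_cat (span_basis bH).
  apply: cat_basis => //; first exact/directv_addP/cartan_root_direct.
  by rewrite basisEfree cX_free subvv dim_span.
move=> x; split=> [/(stabilizerP _ admM)[y [n [/bP Zy ->]]]|].
  apply: ZspanD.
    move: y Zy; apply: Zspan_ind => [|v w|v z|v vb]; first exact: Zspan0.
    - exact: ZspanD.
    - exact: ZspanMz.
    by apply: Zspan_in; rewrite mem_cat vb.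
  apply: Zspan_sum => al alR; apply/ZspanMz/Zspan_in.
  by rewrite mem_cat map_f ?orbT.
apply: Zspan_ind => [|v w|v z|v]; [exact: (stab0 admM)|exact: (stabD admM)|exact: (stabMz admM z)|].
rewrite mem_cat => /orP[vb|/mapP[al alR ->]]; last exact: (stab_cX admM alR).
have /(integral_cartanP _ admM)[] // : integral_cartan C V v.
exact/bP/Zspan_in.
Qed.

Lemma stabilizer_direct y (n : lat (cdatum C) -> int) : integral_cartan C V y ->
  y + \sum_(al <- roots) X al *~ n al = 0 ->
  y = 0 /\ (forall al, al \in roots -> n al = 0).
Proof.
case=> yh _ E; have [|y0 n0] := @root_decomposition_eq0 _ _ C y (fun al => (n al)%:~R) yh.
  by rewrite -[RHS]E; congr (_ + _); apply: eq_bigr => al _; rewrite scaler_int.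
by split=> // al /n0 /eqP; rewrite (intr_eq0_char0 charK) => /eqP.
Qed.

End StabilizerLattice.

(** * The example of sl(2) *)

Section IntegerRows.
Variables (K : fieldType) (n : nat).

Definition integer_row (v : 'rV[K]_n) : Prop := forall i, is_integer (v 0 i).

Lemma integer_row0 : integer_row 0.
Proof. by move=> i; rewrite mxE; apply: is_integer0. Qed.

Lemma integer_rowD v w : integer_row v -> integer_row w -> integer_row (v + w).
Proof. by move=> Iv Iw i; rewrite mxE; apply: is_integerD. Qed.

Lemma integer_rowZ c v : is_integer c -> integer_row v -> integer_row (c *: v).
Proof. by move=> Ic Iv i; rewrite mxE; apply: is_integerM. Qed.

Lemma integer_row_delta i : integer_row (delta_mx 0 i).
Proof. by move=> j; rewrite mxE; apply: is_integer_nat. Qed.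

Lemma integer_row_lattice : is_lattice integer_row.
Proof.
pose b : seq 'rV[K]_n := [seq delta_mx 0 i | i <- enum 'I_n].
have bi i : delta_mx 0 i \in b by apply/mapP; exists i; rewrite ?mem_enum.
exists b; split=> [|v].
  rewrite basisEdim size_map size_enum_ord dimvf dim_matrix mul1r leqnn andbT.
  apply/subvP => v _; rewrite [v]row_sum_delta; apply: memv_suml => i _.
  by rewrite memvZ // memv_span.
split=> [Iv|].
  rewrite [v]row_sum_delta; apply: Zspan_sum => i _; have [z ->] := Iv i.
  by rewrite scaler_int; apply/ZspanMz/Zspan_in.
move: v; apply: Zspan_ind => [|v w|v z Iv|_ /mapP[i _ ->]].
- exact: integer_row0.
- exact: integer_rowD.
- by rewrite -scaler_int; apply: integer_rowZ => //; apply: is_integer_int.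
- exact: integer_row_delta.
Qed.

Lemma integer_row_ubinomial (charK : [pchar K] =i pred0) (g : lieSuper K)
    (act : g -> 'rV[K]_n -> 'rV[K]_n) (x : g) (m : 'I_n -> int) k v :
  is_representation act ->
  (forall i, act x (delta_mx 0 i) = (m i)%:~R *: delta_mx 0 i) ->
  integer_row v -> integer_row (uact act (ubinomial (uinj x) k) v).
Proof.
move=> actP xE Iv; rewrite [v]row_sum_delta.
rewrite (big_morph _ (uactDr actP _) (uact0r actP _)).
apply: big_ind => [||i _]; [exact: integer_row0 | exact: integer_rowD|].
rewrite (uactZr actP) (uact_ubinomial actP k (xE i)).
apply: integer_rowZ (Iv i) _; apply: integer_rowZ; last exact: integer_row_delta.
exact: is_integer_binf.
Qed.

End IntegerRows.

Section Sl2.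
Variable K : fieldType.

(* The coordinates of a row are those in the basis [e, h, f] of sl(2). *)
Definition vec3 (a b c : K) : 'rV[K]_3 := \row_(i < 3) nth 0 [:: a; b; c] i.
Definition ce (x : 'rV[K]_3) : K := x 0 (@Ordinal 3 0 isT).
Definition ch (x : 'rV[K]_3) : K := x 0 (@Ordinal 3 1 isT).
Definition cf (x : 'rV[K]_3) : K := x 0 (@Ordinal 3 2 isT).

Lemma vec3P x y : ce x = ce y -> ch x = ch y -> cf x = cf y -> x = y.
Proof.
move=> E0 E1 E2; apply/rowP => -[[|[|[|i]]] lti] //.
- by rewrite (_ : Ordinal lti = @Ordinal 3 0 isT) //; apply: val_inj.
- by rewrite (_ : Ordinal lti = @Ordinal 3 1 isT) //; apply: val_inj.
- by rewrite (_ : Ordinal lti = @Ordinal 3 2 isT) //; apply: val_inj.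
Qed.

Lemma ce_vec3 a b c : ce (vec3 a b c) = a. Proof. by rewrite /ce mxE. Qed.
Lemma ch_vec3 a b c : ch (vec3 a b c) = b. Proof. by rewrite /ch mxE. Qed.
Lemma cf_vec3 a b c : cf (vec3 a b c) = c. Proof. by rewrite /cf mxE. Qed.
Lemma coord3D x y :
  (ce (x + y) = ce x + ce y) * (ch (x + y) = ch x + ch y) * (cf (x + y) = cf x + cf y).
Proof. by rewrite /ce /ch /cf !mxE. Qed.
Lemma coord3N x :
  (ce (- x) = - ce x) * (ch (- x) = - ch x) * (cf (- x) = - cf x).
Proof. by rewrite /ce /ch /cf !mxE. Qed.
Lemma coord3Z c x :
  (ce (c *: x) = c * ce x) * (ch (c *: x) = c * ch x) * (cf (c *: x) = c * cf x).
Proof. by rewrite /ce /ch /cf !mxE. Qed.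
Lemma coord3_0 : (ce 0 = 0) * (ch 0 = 0) * (cf 0 = 0).
Proof. by rewrite /ce /ch /cf !mxE. Qed.

Definition coord3E := (ce_vec3, ch_vec3, cf_vec3, coord3D, coord3N, coord3Z, coord3_0).

Definition sl2_br x y := vec3 (2 * (ch x * ce y - ce x * ch y))
  (ce x * cf y - cf x * ce y) (2 * (cf x * ch y - ch x * cf y)).

Definition pure_part (V : vectType K) (b : bool) : {vspace V} := if b then 0%VS else fullv.

Lemma pure_part_sum (V : vectType K) : (pure_part V false + pure_part V true)%VS = fullv.
Proof. exact: addv0. Qed.

Lemma pure_part_cap (V : vectType K) : (pure_part V false :&: pure_part V true)%VS = 0%VS.
Proof. exact: capv0. Qed.

Lemma sl2_brl c x y z : sl2_br (c *: x + y) z = c *: sl2_br x z + sl2_br y z.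
Proof. by apply: vec3P; rewrite /sl2_br !coord3E; ring. Qed.

Lemma sl2_brr c x y z : sl2_br z (c *: x + y) = c *: sl2_br z x + sl2_br z y.
Proof. by apply: vec3P; rewrite /sl2_br !coord3E; ring. Qed.

Lemma sl2_br0l x : sl2_br 0 x = 0.
Proof. by apply: vec3P; rewrite /sl2_br !coord3E; ring. Qed.

Lemma sl2_br0r x : sl2_br x 0 = 0.
Proof. by apply: vec3P; rewrite /sl2_br !coord3E; ring. Qed.

Lemma sl2_part a b x y : x \in pure_part _ a -> y \in pure_part _ b ->
  sl2_br x y \in pure_part _ (a (+) b).
Proof.
case: a b => [] [] /=; rewrite /pure_part ?memvf // ?memv0.
- by move=> /eqP ->; rewrite sl2_br0l.
- by move=> _ /eqP ->; rewrite sl2_br0r.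
Qed.

Lemma sl2_skew a b x y : x \in pure_part _ a -> y \in pure_part _ b ->
  sl2_br x y = - ((-1) ^+ (a && b) *: sl2_br y x).
Proof.
case: a b => [] [] /=; rewrite /pure_part ?memv0.
- by move=> /eqP -> /eqP ->; rewrite sl2_br0r scaler0 oppr0.
- by move=> /eqP ->; rewrite sl2_br0r sl2_br0l scaler0 oppr0.
- by move=> _ /eqP ->; rewrite sl2_br0r sl2_br0l scaler0 oppr0.
- by move=> _ _; apply: vec3P; rewrite /sl2_br !coord3E; ring.
Qed.

Lemma sl2_jacobi a b x y z : x \in pure_part _ a -> y \in pure_part _ b ->
  sl2_br x (sl2_br y z) =
  sl2_br (sl2_br x y) z + (-1) ^+ (a && b) *: sl2_br y (sl2_br x z).
Proof.
have zeros := (sl2_br0l, sl2_br0r, scaler0, addr0).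
case: a b => [] [] /=; rewrite /pure_part ?memv0.
- by move=> /eqP -> /eqP ->; rewrite !zeros.
- by move=> /eqP ->; rewrite !zeros.
- by move=> _ /eqP ->; rewrite !zeros.
- by move=> _ _; apply: vec3P; rewrite /sl2_br !coord3E; ring.
Qed.

Definition sl2 : lieSuper K := @LieSuper K 'rV[K]_3 (pure_part _) sl2_br
  (pure_part_sum _) (pure_part_cap _) sl2_brl sl2_brr sl2_part sl2_skew sl2_jacobi.

Lemma sl2_odd (x : sl2) : x \in lpart sl2 true -> x = 0.
Proof. by rewrite /= memv0 => /eqP. Qed.

Lemma sl2_even (x : sl2) : x \in lpart sl2 false.
Proof. exact: memvf. Qed.

Definition sl2_adjoint : superModule sl2 := @SuperModule K sl2 'rV[K]_3 (pure_part _)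
  (sl2_br : sl2 -> _) (pure_part_sum _) (pure_part_cap _) sl2_part
  (adjoint_representation sl2).

Definition vec2 (a b : K) : 'rV[K]_2 := \row_(i < 2) nth 0 [:: a; b] i.
Definition c0 (x : 'rV[K]_2) : K := x 0 (@Ordinal 2 0 isT).
Definition c1 (x : 'rV[K]_2) : K := x 0 (@Ordinal 2 1 isT).

Lemma vec2P x y : c0 x = c0 y -> c1 x = c1 y -> x = y.
Proof.
move=> E0 E1; apply/rowP => -[[|[|i]] lti] //.
- by rewrite (_ : Ordinal lti = @Ordinal 2 0 isT) //; apply: val_inj.
- by rewrite (_ : Ordinal lti = @Ordinal 2 1 isT) //; apply: val_inj.
Qed.

Lemma c0_vec2 a b : c0 (vec2 a b) = a. Proof. by rewrite /c0 mxE. Qed.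
Lemma c1_vec2 a b : c1 (vec2 a b) = b. Proof. by rewrite /c1 mxE. Qed.
Lemma coord2D x y : (c0 (x + y) = c0 x + c0 y) * (c1 (x + y) = c1 x + c1 y).
Proof. by rewrite /c0 /c1 !mxE. Qed.
Lemma coord2N x : (c0 (- x) = - c0 x) * (c1 (- x) = - c1 x).
Proof. by rewrite /c0 /c1 !mxE. Qed.
Lemma coord2Z c x : (c0 (c *: x) = c * c0 x) * (c1 (c *: x) = c * c1 x).
Proof. by rewrite /c0 /c1 !mxE. Qed.
Lemma coord2_0 : (c0 0 = 0) * (c1 0 = 0).
Proof. by rewrite /c0 /c1 !mxE. Qed.

Definition coord2E := (c0_vec2, c1_vec2, coord2D, coord2N, coord2Z, coord2_0).

Definition sl2_nat_act (x : sl2) (v : 'rV[K]_2) : 'rV[K]_2 :=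
  vec2 (ch x * c0 v + ce x * c1 v) (cf x * c0 v - ch x * c1 v).

Lemma sl2_nat_part a b (x : sl2) v : x \in lpart sl2 a -> v \in pure_part _ b ->
  sl2_nat_act x v \in pure_part _ (a (+) b).
Proof.
case: a b => [] [] /=; rewrite /pure_part ?memvf // ?memv0.
- by move=> /eqP -> _; apply/eqP/vec2P; rewrite !coord2E !coord3E; ring.
- by move=> _ /eqP ->; apply/eqP/vec2P; rewrite !coord2E; ring.
Qed.

Lemma sl2_nat_representation : is_representation sl2_nat_act.
Proof.
split=> [c x y v|c x v w|a b x y v].
- by apply: vec2P; rewrite !coord2E !coord3E; ring.
- by apply: vec2P; rewrite !coord2E; ring.
suff E : sl2_nat_act (sl2_br x y) v =
    sl2_nat_act x (sl2_nat_act y v) - sl2_nat_act y (sl2_nat_act x v).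
  have nat0 w : sl2_nat_act 0 w = 0.
    by apply: vec2P; rewrite !coord2E !coord3E; ring.
  have natr0 z : sl2_nat_act z 0 = 0 by apply: vec2P; rewrite !coord2E; ring.
  case: a b => [] [] /=; rewrite /pure_part ?memv0 ?expr0 ?scale1r //.
  by move=> /eqP -> _; rewrite sl2_br0l !nat0 natr0 scaler0 subr0.
by apply: vec2P; rewrite /sl2_br !coord2E !coord3E; ring.
Qed.

Definition sl2_natural : superModule sl2 := @SuperModule K sl2 'rV[K]_2 (pure_part _)
  sl2_nat_act (pure_part_sum _) (pure_part_cap _) sl2_nat_part sl2_nat_representation.

End Sl2.

(** * A Lie superalgebra without odd part has none of the excluded types *)

Section PurelyEven.
Variables (K : fieldType) (g : lieSuper K).
Hypothesis noodd : forall x : g, x \in lpart g true -> x = 0.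

(** An odd matrix of [S] is sent into the odd part of g, which is zero, so it lies in the kernel
    [Z]. For A(1,1) and Q(n) this kernel consists of scalar matrices, and an odd nonscalar matrix
    contradicts it. *)
Lemma gl_subquotient_even p q (S Z : 'M[K]_(p + q) -> Prop) m :
  gl_subquotient S Z g -> S m -> gl_odd m = m -> Z m.
Proof.
move=> [f [_ fZ _ fP]] Sm odd_m; apply/(fZ m Sm)/noodd.
by have [_] := fP m Sm; rewrite odd_m.
Qed.

Lemma scalar_block_offdiag n (B : 'M[K]_n) c : block_mx 0 B B 0 = c%:M :> 'M[K]_(n + n) -> B = 0.
Proof. by rewrite scalar_mx_block => /eq_block_mx[]. Qed.

Lemma even_not_A11 : ~ type_A11 g.
Proof.
pose m : 'M[K]_(2 + 2) := block_mx 0 1%:M 1%:M 0.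
move=> /(@gl_subquotient_even 2 2 _ _ m)[||c /scalar_block_offdiag /matrixP/(_ 0 0)].
- by rewrite /m block_mxKul block_mxKdr !mxtrace0 subrr.
- by rewrite /gl_odd /m block_mxKur block_mxKdl.
by rewrite !mxE => /eqP; rewrite oner_eq0.
Qed.

Lemma even_not_Q n : ~ type_Q g n.
Proof.
(* An off-diagonal matrix unit, so that its trace is zero. *)
pose B : 'M[K]_n.+1 := delta_mx 0 ord_max; pose m := block_mx 0 B B 0.
case=> n2 /(@gl_subquotient_even n.+1 n.+1 _ _ m)[||c /scalar_block_offdiag /matrixP/(_ 0 ord_max)].
- exists 0, B; split=> //; rewrite /B /mxtrace big1 // => i _; rewrite mxE.
  case: eqP => // ->; case: eqP => // /(congr1 val) /= E; by rewrite -E in n2.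
- by rewrite /gl_odd /m block_mxKur block_mxKdl.
by rewrite !mxE !eqxx => /eqP; rewrite oner_eq0.
Qed.

(** The matrix of P(n) whose only nonzero block is B = 1 is odd and nonzero, but it would be the
    image of an even element. *)
Lemma even_not_P n : (lpart g false = fullv)%VS -> ~ type_P g n.
Proof.
move=> allev [phi [_ _ imP _ parP]].
have [x Ex] : exists x, phi x = block_mx 0 1%:M 0 0.
  by apply/imP; exists 0, 1%:M, 0; split; rewrite ?mxtrace0 ?trmx0 ?trmx1 ?oppr0.
have [+ _] := parP x; rewrite allev memvf Ex /gl_odd block_mxKur block_mxKdl => /(_ isT).
have -> : (0 : 'M[K]_(n.+1 + n.+1)) = block_mx 0 0 0 0 by rewrite block_mx0.
move=> /eq_block_mx[_ /matrixP/(_ 0 0) + _ _].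
by rewrite !mxE => /eqP; rewrite oner_eq0.
Qed.

(** The generator e_0 is odd, hence zero, so h_0 = [e_0, f_0] vanishes, against the independence of
    the h_i. *)
Lemma even_not_D21_nonint : ~ type_D21_nonint g.
Proof.
case=> -[a [_ [_ [e [f [h [ef free_h rel _ _]]]]]]] _.
have e0 : e 0 = 0 by apply: noodd; have [] := ef 0.
have [Eh _ _ _] := rel 0 0; rewrite eqxx e0 in Eh.
have h0 : h 0 = 0.
  by rewrite -Eh (act0l (adjoint_representation g)).
have /negP[] := free_not0 free_h (codom_f h 0).
by rewrite h0.
Qed.

End PurelyEven.

(** * Simplicity, Cartan subalgebra and invariant form of sl(2) *)

Section Sl2Classical.
Variables (K : fieldType) (charK : [pchar K] =i pred0).

Let two0 : (2 : K) != 0. Proof. by rewrite (natr_eq0_char0 charK). Qed.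

Local Notation g := (sl2 K).
Definition ee : g := vec3 1 0 0.
Definition hh : g := vec3 0 1 0.
Definition ff : g := vec3 0 0 1.

Lemma sl2_eta (x : g) : x = ce x *: ee + ch x *: hh + cf x *: ff.
Proof. by apply: vec3P; rewrite /ee /hh /ff !coord3E; ring. Qed.

(** A nonzero x in the ideal yields a nonzero multiple of e: bracket with e twice if the
    f-coordinate is nonzero, once if only the h-coordinate remains besides that of e, and not at all
    otherwise. Then e generates everything. *)
Lemma sl2_ideal (I : {vspace g}) : (forall x y : g, y \in I -> br x y \in I) ->
  I = 0%VS \/ I = fullv.
Proof.
move=> idI; have [|neqI] := eqVneq I 0%VS; [by left | right].
have unZ c (x : g) : c != 0 -> c *: x \in I -> x \in I.
  by move=> c0 /(memvZ c^-1); rewrite scalerA mulVf // scale1r.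
have eI_full : ee \in I -> I = fullv.
  move=> eI; have hI : hh \in I.
    rewrite (_ : hh = - br ff ee) ?memvN; first exact: idI.
    by apply: vec3P; rewrite /= /sl2_br /ee /ff /hh !coord3E; ring.
  have fI : ff \in I.
    apply: (unZ 2) => //; rewrite (_ : 2 *: ff = br ff hh); first exact: idI.
    by apply: vec3P; rewrite /= /sl2_br /hh /ff !coord3E; ring.
  apply/eqP; rewrite eqEsubv subvf; apply/subvP => x _.
  by rewrite [x]sl2_eta !memvD // memvZ.
have /eqP : vpick I != 0 by rewrite vpick0.
have := memv_pick I; move: (vpick I) => x xI x0.
have eex : br ee (br ee x) = (- 2 * cf x) *: ee.
  by apply: vec3P; rewrite /= /sl2_br /ee !coord3E; ring.
have [c0|c0] := eqVneq (cf x) 0; last first.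
  apply: eI_full; apply: (unZ (- 2 * cf x)); last by rewrite -eex; do 2!apply: (idI).
  by rewrite mulf_neq0 // oppr_eq0.
have ex : br ee x = (- 2 * ch x) *: ee.
  by apply: vec3P; rewrite /= /sl2_br /ee !coord3E ?c0; ring.
have [b0|b0] := eqVneq (ch x) 0; last first.
  apply: eI_full; apply: (unZ (- 2 * ch x)); last by rewrite -ex; apply: (idI).
  by rewrite mulf_neq0 // oppr_eq0.
apply: eI_full; apply: (unZ (ce x)).
  by apply/eqP => a0; apply: x0; apply: vec3P; rewrite ?coord3E.
by move: xI; rewrite {1}[x]sl2_eta b0 c0 !scale0r !addr0.
Qed.

Lemma sl2_classical : classical g.
Proof.
split.
- exists ee, ff => /(congr1 (@ch K)); rewrite /= /sl2_br /ee /ff !coord3E => /eqP.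
  by rewrite mulr1 mul0r subr0 oner_eq0.
- by move=> I [_ idI]; apply: sl2_ideal.
- move=> W; rewrite /= /pure_part subv0 => /eqP -> _; exists 0%VS.
  by split; rewrite ?addv0 ?cap0v // => x w _; rewrite !memv0 => /eqP -> /=; rewrite sl2_br0r.
Qed.

Local Notation hs := (<[hh]>%VS : {vspace g}).

Lemma hsP (x : g) : reflect (x = ch x *: hh) (x \in hs).
Proof.
apply: (iffP (vlineP _ _)) => [[k ->]|E]; last by exists (ch x).
by rewrite /hh !coord3E mulr1.
Qed.

Lemma hh_neq0 : hh != 0.
Proof.
apply/eqP => /(congr1 (@ch K)); rewrite /hh !coord3E => /eqP.
by rewrite oner_eq0.
Qed.

Lemma sl2_cartan : is_cartan hs.
Proof.
have comm x y : x \in hs -> y \in hs -> br x y = 0.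
  by move=> /hsP -> /hsP ->; apply: vec3P; rewrite /= /sl2_br /hh !coord3E; ring.
split; first exact: subvf.
- by move=> x y xh yh; rewrite comm ?mem0v.
- exists 1 => -[|x [|]] // y _ sh yh /=; apply: comm => //.
  by apply: sh; rewrite mem_head.
move=> x _ /(_ hh (memv_line _)) /hsP E; apply/hsP.
have := congr1 (@ce K) E; have := congr1 (@cf K) E.
rewrite /= /sl2_br /hh !coord3E => Ef Ee.
apply: vec3P; rewrite !coord3E.
- by apply: (mulfI two0); move: Ee; rewrite !(mulr0, mulr1, mul0r, sub0r) => /eqP;
     rewrite mulrN oppr_eq0 => /eqP.
- by rewrite mulr1.
by apply: (mulfI two0); move: Ef; rewrite !(mulr0, mulr1, subr0).
Qed.

(** The trace form of the natural module. *)
Definition sl2_form (x y : g) : K := ce x * cf y + cf x * ce y + 2 * (ch x * ch y).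

Lemma sl2_invariant_form : invariant_form sl2_form.
Proof.
split.
- by move=> c x y z; rewrite /sl2_form !coord3E; split; ring.
- by move=> x y _ /sl2_odd ->; rewrite /sl2_form !coord3E; ring.
- move=> [] [] x y; rewrite /= /pure_part ?memv0; last 3 first.
  + by move=> _ _; rewrite /sl2_form; ring.
  + by move=> _ _; rewrite /sl2_form; ring.
  + by move=> _ _; rewrite /sl2_form; ring.
  by move=> /eqP -> /eqP ->; rewrite /sl2_form !coord3E; ring.
- by move=> x y z; rewrite /sl2_form /= /sl2_br !coord3E; ring.
move=> x Bx; have := Bx ee; have := Bx hh; have := Bx ff.
rewrite /sl2_form /ee /hh /ff !coord3E !(mulr0, mulr1, addr0, add0r) => a0 b0 c0.
by apply: vec3P; rewrite coord3E //; apply: (mulfI two0); rewrite b0 mulr0.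
Qed.

(** Stated for any subspace, since it is applied both to the line of [hh] and to [cartan C], which
    is equal to that line only by a hypothesis. *)
Lemma ch_functional (U : {vspace g}) :
  exists f : 'Hom(subvs_of U, K^o), forall y, f y = ch (vsval y).
Proof.
pose f (y : subvs_of U) : K^o := ch (vsval y).
have f_lin : linear f by move=> d x z; rewrite /f linearP !coord3E.
pose F : {linear subvs_of U -> K^o} :=
  HB.pack f (GRing.isLinear.Build K (subvs_of U) K^o _ f f_lin).
by exists (linfun F) => y; rewrite lfunE.
Qed.

End Sl2Classical.

(** * A Chevalley basis of sl(2) *)

Section Sl2Chevalley.
Variables (K : fieldType) (charK : [pchar K] =i pred0).

Local Notation g := (sl2 K).
Local Notation ee := (ee K).
Local Notation hh := (hh K).
Local Notation ff := (ff K).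
Local Notation hs := (<[hh]>%VS : {vspace g}).
Local Notation hdual := 'Hom(subvs_of hs, K^o).

Let two0 : (2 : K) != 0. Proof. by rewrite (natr_eq0_char0 charK). Qed.

Lemma hdual_hs (la : hdual) y : y \in hs -> la (vsproj hs y) = ch y * la (vsproj hs hh).
Proof. by move=> /hsP {1}->; rewrite !linearZ. Qed.

Lemma hdual_eq_hs (la mu : hdual) : la (vsproj hs hh) = mu (vsproj hs hh) -> la = mu.
Proof.
move=> E; apply/lfunP => y; rewrite -(vsvalK y).
by rewrite (hdual_hs la (subvsP y)) (hdual_hs mu (subvsP y)) E.
Qed.

(** Only the facts that the computations in the two modules use are recorded, so that the root data
    of the basis constructed here need not be unfolded again. *)
Lemma sl2_chevalley : exists C : chevalleyBasis g,
  [/\ cartan C = hs, forall i, cH C i = hh, forall al : lat (cdatum C), ~ odroot al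
    & forall al : lat (cdatum C), evroot al -> cX C al = ee \/ cX C al = ff].
Proof.
have [f fE] := ch_functional hs.
pose al : hdual := 2 *: f.
have alE : al (vsproj hs hh) = 2.
  by rewrite scale_lfunE fE vsprojK ?memv_line // /hh coord3E; apply: mulr1.
have nalE : (- al) (vsproj hs hh) = - 2 by rewrite opp_lfunE alE.
have al0 : al != 0.
  by apply: contra_neq two0 => E; rewrite -alE E zero_lfunE.
have nal : - al != al.
  apply: contra_neq two0 => E; move: nalE; rewrite E alE => /eqP.
  by rewrite -addr_eq0 -natrD (natr_eq0_char0 charK).
have nal0 : - al != 0 by rewrite oppr_eq0.
have wt_ee : wt_space hs (hdual_wt al) ee.
  move=> y yh; rewrite /hdual_wt (hdual_hs _ yh) alE; move/hsP: yh => ->.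
  by apply: vec3P; rewrite /= /sl2_br /ee /hh !coord3E; ring.
have wt_ff : wt_space hs (hdual_wt (- al)) ff.
  move=> y yh; rewrite /hdual_wt (hdual_hs _ yh) nalE; move/hsP: yh => ->.
  by apply: vec3P; rewrite /= /sl2_br /ff /hh !coord3E; ring.
have ee0 : ee <> 0.
  by move/(congr1 (@ce K))/eqP; rewrite /ee !coord3E oner_eq0.
have ff0 : ff <> 0.
  by move/(congr1 (@cf K))/eqP; rewrite /ff !coord3E oner_eq0.
have wt_al x : wt_space hs (hdual_wt al) x -> x = ce x *: ee.
  move=> /(_ hh (memv_line _)); rewrite /hdual_wt alE => E.
  have := congr1 (@ch K) E; have := congr1 (@cf K) E.
  rewrite /= /sl2_br /hh !coord3E => Ef Eh.
  have f0 : cf x = 0.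
    have /eqP : (4 : K) * cf x = 0.
      transitivity (2 * cf x - 2 * (0 * ch x - 1 * cf x)); first by ring.
      by rewrite Ef subrr.
    by rewrite mulf_eq0 (natr_eq0_char0 charK) => /eqP.
  have h0 : ch x = 0 by apply: (mulfI two0); rewrite -Eh; ring.
  by apply: vec3P; rewrite /ee !coord3E ?f0 ?h0; ring.
have notP n : ~ type_P g n by apply: even_not_P => //; apply: sl2_odd.
pose m : rootModel g := BasicModel (@sl2_form K).
have mP : model_ok hs m by split=> //; apply: sl2_invariant_form.
pose roots : seq (lat (model_datum hs m)) := [:: al; - al].
have Ru : uniq roots by rewrite /= inE eq_sym nal.
have noodd (la : lat (model_datum hs m)) : ~ odroot la.
  by case=> x [x0 /sl2_odd].
have RP (la : lat (model_datum hs m)) : la \in roots <-> is_root la.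
  rewrite !inE; split=> [/orP[]/eqP ->|].
  - by left; split; [apply/eqP | exists ee; split=> //; apply: sl2_even].
  - by left; split; [apply/eqP | exists ff; split=> //; apply: sl2_even].
  case=> [[la0 [x [x0 _ /(_ hh (memv_line _))]]]|/noodd //].
  rewrite /hdual_wt; set l := la _ => E.
  have l0 : l != 0.
    apply/eqP => l0; apply: la0; apply: hdual_eq_hs.
    by rewrite -/l l0 zero_lfunE.
  have Ee := congr1 (@ce K) E; have Eh := congr1 (@ch K) E; have Ef := congr1 (@cf K) E.
  rewrite /= /sl2_br /hh !coord3E in Ee Eh Ef.
  have h0 : ch x = 0 by apply: (mulfI l0); rewrite -Eh; ring.
  have [e0|e0] := eqVneq (ce x) 0; last first.
    apply/orP; left; apply/eqP/hdual_eq_hs; rewrite alE -/l.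
    by apply: (mulIf e0); rewrite -Ee; ring.
  have [f0|f0] := eqVneq (cf x) 0.
    by case: x0; apply: vec3P; rewrite coord3E.
  apply/orP; right; apply/eqP/hdual_eq_hs; rewrite nalE -/l.
  by apply: (mulIf f0); rewrite -Ef; ring.
pose simple : seq (lat (model_datum hs m)) := [:: al].
have dist : distinguished hs roots simple simple.
  split.
  - by split=> // la; rewrite !inE => ->.
  - move=> la; rewrite !inE => laR; split=> [/eqP ->|].
      by exists [:: al]; split=> //; rewrite big_seq1.
    move=> neq; move: laR; rewrite (negbTE neq) /= => /eqP ->.
    by exists [:: al]; split=> //; rewrite opprK big_seq1.
  - split=> [la|la mu x y]; rewrite !inE => /eqP ->; first by rewrite nal.
    move=> /eqP -> /wt_al -> /wt_al -> [].
    by apply: vec3P; rewrite /= /sl2_br /ee !coord3E; ring.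
  - move=> la; rewrite inE => /eqP -> [mu [nu []]]; rewrite !inE => /eqP -> /eqP -> E.
    case/negP: al0; apply/eqP/(addrI al).
    by rewrite -E addr0.
  - by rewrite /= eqxx => la; rewrite inE => /eqP ->; split;
       [apply/eqP | exists ee; split=> //; apply: sl2_even].
have posP : positive_spec (fun la : lat (model_datum hs m) => la \in simple) by [].
(* The element dual to [la] under [sl2_form], since the form of [hh] with itself is 2. At the two
   roots it is [hh] or its opposite, so dual element and coroot coincide. *)
pose cr (la : lat (model_datum hs m)) : g := (la (vsproj hs hh) / 2) *: hh.
have cral : cr al = hh by rewrite /cr alE divff // scale1r.
have crnal : cr (- al) = - hh by rewrite /cr nalE mulNr divff // scaleN1r.
have crN la : cr (- la) = - cr la by rewrite /cr opp_lfunE mulNr scaleNr.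
have form_cr (la : hdual) : form_dual hs (@sl2_form K) (hdual_wt la) (cr la).
  split=> [|y yh]; first by rewrite memvZ ?memv_line.
  rewrite /hdual_wt (hdual_hs _ yh) /sl2_form /cr; move/hsP: yh => ->.
  by rewrite /hh !coord3E; field.
have aniso (la : hdual) : la \in roots -> ~ sqnorm0 hs (@sl2_form K) (hdual_wt la).
  move=> laR [t [/hsP th /(_ hh (memv_line _))]].
  rewrite th /sl2_form /hdual_wt /hh !coord3E.
  have : (la (vsproj hs hh) : K) = 2 \/ (la (vsproj hs hh) : K) = - 2.
    by move: laR; rewrite !inE => /orP[]/eqP ->; rewrite ?alE ?nalE; [left|right].
  have sq4 (l : K) : l = 2 \/ l = - 2 -> l * l = 4 by case=> ->; ring.
  move/sq4; move: (la _ : K) => l l2.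
  move: (ch t) => k E1 E2; have kk : 2 * (k * k) = 0 by rewrite -[RHS]E2; ring.
  have /eqP : (4 : K) = 0.
    by rewrite -l2 -E1; transitivity (2 * (2 * (k * k))); [ring | rewrite kk mulr0].
  by rewrite (natr_eq0_char0 charK).
have crP : coroot_spec cr.
  move=> la laR; have {}laR : la \in roots by apply/RP.
  split=> //.
  - by exists (cr la), 1; rewrite scale1r.
  - move=> _; rewrite /hdual_wt hdual_hs ?memvZ ?memv_line // /cr /hh !coord3E -/hh.
    by move: laR; rewrite !inE => /orP[]/eqP ->; rewrite ?alE ?nalE; field.
  - by move/aniso => /(_ laR).
pose H (i : 'I_(\dim hs)) : g := hh.
pose X (la : lat (model_datum hs m)) : g := if la == al then ee else ff.
have Xal : X al = ee by rewrite /X eqxx.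
have Xnal : X (- al) = ff by rewrite /X (negbTE nal).
have codomH : codom H = [:: hh].
  have : size (enum 'I_(\dim hs)) = 1%N by rewrite size_enum_ord dim_vline hh_neq0.
  by rewrite codomE; case: (enum _) => [|i []].
have Hin i : H i = hh by [].
have i0 : 'I_(\dim hs) by rewrite dim_vline hh_neq0; exact: ord0.
have chP : is_chevalley_basis roots simple cr H X.
  split.
  - split; last by move=> la _; left; apply: sl2_even.
    rewrite codomH /= Xal Xnal basisEdim dimvf dim_matrix leqnn andbT.
    apply/subvP => x _; rewrite [x]sl2_eta.
    by rewrite !memvD // memvZ // memv_span // !inE eqxx ?orbT.
  - rewrite codomH; split; first exact: seq1_basis (hh_neq0 K).
    move=> y; split; apply: Zspan_ind.
    + exact: Zspan0.
    + exact: ZspanD.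
    + exact: ZspanMz.
    + move=> _ [i ->]; apply: Zspan_in; exists al; rewrite cral.
      by rewrite !inE !eqxx orbT.
    + exact: Zspan0.
    + exact: ZspanD.
    + exact: ZspanMz.
    move=> _ [la [laR _ ->]].
    have crZ z : Zspan (fun z => exists i, z = H i) (hh *~ z).
      by apply/ZspanMz/Zspan_in; exists i0.
    move: laR; rewrite !inE => /orP[]/eqP ->; first by rewrite cral; apply: (crZ 1).
    by rewrite crnal; apply: (crZ (- 1)).
  - split=> [i j|i la laR].
      by apply: vec3P; rewrite /H /= /sl2_br /hh !coord3E; ring.
    move: laR; rewrite !inE => /orP[]/eqP ->; rewrite ?Xal ?Xnal.
      by apply: wt_ee; apply: memv_line.
    by apply: wt_ff; apply: memv_line.
  - move=> la laR _; split=> [[/noodd]|_] //.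
    move: laR; rewrite !inE => /orP[]/eqP ->; rewrite ?opprK ?Xal ?Xnal ?cral ?crnal.
      by apply: vec3P; rewrite /= /sl2_br /ee /ff /hh !coord3E; ring.
    by apply: vec3P; rewrite /= /sl2_br /ee /ff /hh !coord3E; ring.
  move=> la mu laR muR neq.
  (* With only two roots, opposite to each other, roots that are not opposite are equal, and their
     sum is not a root: only the vanishing clause remains. *)
  have Emu : mu = la.
    move: laR muR neq; rewrite !inE.
    by do 2![case/orP => /eqP ->]; rewrite ?opprK.
  have two_notin : la + la \notin roots.
    have notin nu : nu \in roots -> nu + nu != al /\ nu + nu != - al.
      rewrite !inE => nuR; split; apply/eqP => /(congr1 (fun u : hdual => u (vsproj hs hh)));
        rewrite add_lfunE ?alE ?nalE; case/orP: nuR => /eqP ->; rewrite ?alE ?nalE => /eqP;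
        rewrite -subr_eq0.
      + by rewrite addrK; apply/negP.
      + by rewrite -!opprD oppr_eq0 -!natrD (natr_eq0_char0 charK).
      + by rewrite opprK -!natrD (natr_eq0_char0 charK).
      + by rewrite opprK subrK oppr_eq0; apply/negP.
    by have [n1 n2] := notin la laR; rewrite !inE negb_or n1.
  rewrite Emu (negbTE two_notin); split=> // _.
  by apply: vec3P; rewrite /= /sl2_br !coord3E; ring.
exists (ChevalleyBasis (sl2_cartan charK) mP Ru RP dist posP crP chP).
by split=> //= la; rewrite /X; case: eqP; [left | right].
Qed.

End Sl2Chevalley.

(** * Admissible lattices in the natural and adjoint modules of sl(2) *)

Section Sl2Modules.
Variables (K : fieldType) (charK : [pchar K] =i pred0).

Local Notation g := (sl2 K).
Local Notation ee := (ee K).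
Local Notation hh := (hh K).
Local Notation ff := (ff K).

Let two0 : (2 : K) != 0. Proof. by rewrite (natr_eq0_char0 charK). Qed.

Variable C : chevalleyBasis g.
Hypotheses (CE : cartan C = <[hh]>%VS) (HE : forall i, cH C i = hh).
Hypothesis odE : forall al : lat (cdatum C), ~ odroot al.
Hypothesis XE : forall al : lat (cdatum C), evroot al -> cX C al = ee \/ cX C al = ff.

Lemma sl2_weight_vector (V : superModule g) (v : V) (c : K) : mact hh v = c *: v ->
  exists mu : 'Hom(subvs_of (cartan C), K^o), weight_vector mu v.
Proof.
move=> hv; have [f fE] := ch_functional (cartan C).
exists (c *: f) => y; have : vsval y \in <[hh]>%VS by rewrite -CE subvsP.
move=> /hsP Ey; rewrite Ey (actZl (mactP V)) hv scale_lfunE fE scalerA.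
by congr (_ *: _); apply: mulrC.
Qed.

Lemma sl2_rational (V : superModule g) :
  (forall v : V, exists s : seq V, (forall w, w \in s -> exists c : K, mact hh w = c *: w)
    /\ v = \sum_(w <- s) w) ->
  (forall (v : V) (c : K), v <> 0 -> mact hh v = c *: v -> is_integer c) ->
  rational C V.
Proof.
move=> dec int; split=> [v|mu [v v0 mu_v] i].
  have [s [sP Ev]] := dec v; exists s; split=> // w /sP[c].
  exact: sl2_weight_vector.
by rewrite HE; apply: int v0 _; rewrite -(mact_cartan mu_v) // CE memv_line.
Qed.

Lemma sl2_kostant_stable (V : superModule g) (M : V -> Prop) : is_lattice M ->
  (forall n v, M v -> M (uact (@mact _ _ V) (divided_power (uinj ee) n) v)) ->
  (forall n v, M v -> M (uact (@mact _ _ V) (divided_power (uinj ff) n) v)) ->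
  (forall n v, M v -> M (uact (@mact _ _ V) (ubinomial (uinj hh) n) v)) ->
  admissible C M.
Proof.
move=> latM Me Mf Mh; split=> // u; elim=> {u} [u [[al [n [/XE alE ->]]]|[al [/odE //]]|[i [n ->]]]
  | |u w _ IHu _ IHw|u w _ IHu _ IHw] v Mv.
- by case: alE => ->; [apply: Me | apply: Mf].
- by rewrite HE; apply: Mh.
- by rewrite (uact1 (mactP V)).
- by rewrite (uactB (mactP V)); apply: latticeB => //; [apply: IHu | apply: IHw].
- by rewrite (uactM (mactP V)); apply/IHu/IHw.
Qed.

Lemma divided_powers_vanish (V : superModule g) (x : g) k (v : V) :
  uact (@mact _ _ V) (divided_power (uinj x) k) v = 0 ->
  forall n, (k <= n)%N -> uact (@mact _ _ V) (divided_power (uinj x) n) v = 0.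
Proof.
move=> E n /subnK <-; elim: (n - k)%N => [|m IHm] //.
by rewrite addSn (uact_divided_powerS (mactP V)) IHm (act0r (mactP V)) scaler0.
Qed.

Lemma divided_power1 (V : superModule g) (x : g) (v : V) :
  uact (@mact _ _ V) (divided_power (uinj x) 1) v = mact x v.
Proof.
by rewrite (uact_divided_powerS (mactP V)) (uact_divided_power0 (mactP V)) invr1 scale1r.
Qed.

Lemma integer_row3 (v : 'rV[K]_3) :
  integer_row v <-> [/\ is_integer (ce v), is_integer (ch v) & is_integer (cf v)].
Proof.
split=> [Iv|[I0 I1 I2] [[|[|[|i]]] lti]] //; first by split; apply: Iv.
- by rewrite (_ : Ordinal lti = @Ordinal 3 0 isT) //; apply: val_inj.
- by rewrite (_ : Ordinal lti = @Ordinal 3 1 isT) //; apply: val_inj.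
- by rewrite (_ : Ordinal lti = @Ordinal 3 2 isT) //; apply: val_inj.
Qed.

Lemma integer_row2 (v : 'rV[K]_2) :
  integer_row v <-> is_integer (c0 v) /\ is_integer (c1 v).
Proof.
split=> [Iv|[I0 I1] [[|[|i]] lti]] //; first by split; apply: Iv.
- by rewrite (_ : Ordinal lti = @Ordinal 2 0 isT) //; apply: val_inj.
- by rewrite (_ : Ordinal lti = @Ordinal 2 1 isT) //; apply: val_inj.
Qed.

Lemma sl2_natural_rational : rational C (sl2_natural K).
Proof.
apply: sl2_rational => [v|v c v0 hv].
  exists [:: vec2 (c0 v) 0; vec2 0 (c1 v)]; split=> [w|]; last first.
    by rewrite big_cons big_seq1; apply: vec2P; rewrite !coord2E ?addr0 ?add0r.
  rewrite !inE => /orP[]/eqP ->; [exists 1|exists (-1)].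
    by apply: vec2P; rewrite /= /sl2_nat_act /hh !coord2E !coord3E; ring.
  by apply: vec2P; rewrite /= /sl2_nat_act /hh !coord2E !coord3E; ring.
have E0 := congr1 (@c0 K) hv; have E1 := congr1 (@c1 K) hv.
rewrite /= /sl2_nat_act /hh !coord2E !coord3E in E0 E1.
have [v0'|v0'] := eqVneq (c0 v) 0; last first.
  by rewrite (_ : c = 1); [apply: is_integer1 | apply: (mulIf v0'); rewrite -E0; ring].
have [v1'|v1'] := eqVneq (c1 v) 0.
  by case: v0; apply: vec2P; rewrite coord2E.
rewrite (_ : c = -1); first exact/is_integerN/is_integer1.
by apply: (mulIf v1'); rewrite -E1; ring.
Qed.

Lemma sl2_adjoint_rational : rational C (sl2_adjoint K).
Proof.
apply: sl2_rational => [v|v c v0 hv].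
  exists [:: ce v *: ee; ch v *: hh; cf v *: ff]; split=> [w|]; last first.
    by rewrite !big_cons big_nil addr0 addrA; apply: sl2_eta.
  rewrite !inE => /or3P[]/eqP ->; [exists 2|exists 0|exists (-2)];
    by apply: vec3P; rewrite /= /sl2_br /ee /hh /ff !coord3E; ring.
have E0 := congr1 (@ce K) hv; have E1 := congr1 (@ch K) hv; have E2 := congr1 (@cf K) hv.
rewrite /= /sl2_br /hh !coord3E in E0 E1 E2.
have [v0'|v0'] := eqVneq (ce v) 0; last first.
  rewrite (_ : c = 2); first exact: is_integer_nat.
  by apply: (mulIf v0'); rewrite -E0; ring.
have [v1'|v1'] := eqVneq (ch v) 0; last first.
  rewrite (_ : c = 0); first exact: is_integer0.
  by apply: (mulIf v1'); rewrite -E1; ring.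
have [v2'|v2'] := eqVneq (cf v) 0.
  by case: v0; apply: vec3P; rewrite coord3E.
rewrite (_ : c = -2); first exact/is_integerN/is_integer_nat.
by apply: (mulIf v2'); rewrite -E2; ring.
Qed.

Lemma sl2_natural_admissible : admissible C (@integer_row K 2 : sl2_natural K -> Prop).
Proof.
(* On the natural module [ee] and [ff] square to zero, so the divided powers of order at least 2
   vanish. *)
have small (x : g) n (v : sl2_natural K) : integer_row (mact x v) -> mact x (mact x v) = 0 ->
    integer_row (v : 'rV[K]_2) ->
    integer_row (uact (@mact _ _ (sl2_natural K)) (divided_power (uinj x) n) v : 'rV[K]_2).
  move=> Ixv xxv Iv; case: n => [|[|n]].
  - by rewrite (uact_divided_power0 (mactP _)).
  - by rewrite divided_power1.
  rewrite (divided_powers_vanish (k := 2)) //; first exact: integer_row0.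
  by rewrite (uact_divided_powerS (mactP _)) divided_power1 xxv scaler0.
apply: sl2_kostant_stable => [|n v Iv|n v Iv|n v Iv]; first exact: integer_row_lattice.
- apply: small => //.
    move/integer_row2: Iv => [I0 I1]; apply/integer_row2; rewrite /= /sl2_nat_act /ee.
    by rewrite !coord2E !coord3E !(mul0r, mul1r, add0r, subr0, oppr0); split=> //; apply: is_integer0.
  by apply: vec2P; rewrite /= /sl2_nat_act /ee !coord2E !coord3E; ring.
- apply: small => //.
    move/integer_row2: Iv => [I0 I1]; apply/integer_row2; rewrite /= /sl2_nat_act /ff.
    by rewrite !coord2E !coord3E !(mul0r, mul1r, add0r, subr0, oppr0); split=> //; apply: is_integer0.
  by apply: vec2P; rewrite /= /sl2_nat_act /ff !coord2E !coord3E; ring.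
apply: (integer_row_ubinomial charK (m := fun i : 'I_2 => if i == 0 :> nat then 1 else -1)) => //.
  exact: sl2_nat_representation.
move=> i; apply: vec2P; rewrite /= /sl2_nat_act /hh !coord2E !coord3E /c0 /c1 !mxE /=.
  by case: i => [[|[|i]] lti] //=; ring.
by case: i => [[|[|i]] lti] //=; ring.
Qed.

Lemma sl2_adjoint_admissible : admissible C (@integer_row K 3 : sl2_adjoint K -> Prop).
Proof.
(* On the adjoint module the cubes of [ee] and [ff] vanish. The divided squares are integral because
   the double brackets have coefficient -2, as in [e, [e, f]] = -2e. *)
have small (x : g) n (v : sl2_adjoint K) : integer_row (sl2_br x v) ->
    integer_row (2^-1 *: sl2_br x (sl2_br x v)) ->
    sl2_br x (sl2_br x (sl2_br x v)) = 0 -> integer_row (v : 'rV[K]_3) ->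
    integer_row (uact (@mact _ _ (sl2_adjoint K)) (divided_power (uinj x) n) v : 'rV[K]_3).
  move=> Ixv Ixxv xxxv Iv; have D2 : uact (@mact _ _ (sl2_adjoint K)) (divided_power (uinj x) 2) v
      = 2^-1 *: sl2_br x (sl2_br x v).
    by rewrite (uact_divided_powerS (mactP _)) divided_power1.
  case: n => [|[|[|n]]].
  - by rewrite (uact_divided_power0 (mactP _)).
  - by rewrite divided_power1.
  - by rewrite D2.
  rewrite (divided_powers_vanish (k := 3)) //; first exact: integer_row0.
  rewrite (uact_divided_powerS (mactP _)) D2 (actZr (mactP _)).
  by rewrite [mact _ _]xxxv !scaler0.
have I2 : is_integer (2 : K) by apply: is_integer_nat.
apply: sl2_kostant_stable => [|n v Iv|n v Iv|n v Iv]; first exact: integer_row_lattice.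
- move/integer_row3: (Iv) => [Ie Ih If]; apply: small => //.
  + rewrite (_ : sl2_br ee v = vec3 (- (2 * ch v)) (cf v) 0).
      apply/integer_row3; rewrite !coord3E; split=> //; last exact: is_integer0.
      exact/is_integerN/is_integerM.
    by apply: vec3P; rewrite /sl2_br /ee !coord3E; ring.
  + rewrite (_ : _ *: _ = vec3 (- cf v) 0 0).
      by apply/integer_row3; rewrite !coord3E; split; try exact: is_integer0; apply: is_integerN.
    by apply: vec3P; rewrite /sl2_br /ee !coord3E; field.
  by apply: vec3P; rewrite /sl2_br /ee !coord3E; ring.
- move/integer_row3: (Iv) => [Ie Ih If]; apply: small => //.
  + rewrite (_ : sl2_br ff v = vec3 0 (- ce v) (2 * ch v)).
      apply/integer_row3; rewrite !coord3E; split; first exact: is_integer0.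
        exact: is_integerN.
      exact: is_integerM.
    by apply: vec3P; rewrite /sl2_br /ff !coord3E; ring.
  + rewrite (_ : _ *: _ = vec3 0 0 (- ce v)).
      by apply/integer_row3; rewrite !coord3E; split; try exact: is_integer0; apply: is_integerN.
    by apply: vec3P; rewrite /sl2_br /ff !coord3E; field.
  by apply: vec3P; rewrite /sl2_br /ff !coord3E; ring.
apply: (integer_row_ubinomial charK
  (m := fun i : 'I_3 => if i == 0 :> nat then 2 else if i == 1 :> nat then 0 else -2)) => //.
  exact: (adjoint_representation g).
move=> i; apply: vec3P; rewrite /= /sl2_br /hh !coord3E /ce /ch /cf !mxE /=.
all: by case: i => [[|[|[|i]]] lti] //=; ring.
Qed.

Lemma sl2_natural_faithful : faithful (sl2_natural K).
Proof.
move=> x x0; have E0 := x0 (vec2 1 0); have E1 := x0 (vec2 0 1).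
have := congr1 (@c0 K) E0; have := congr1 (@c1 K) E0; have := congr1 (@c0 K) E1.
rewrite /= /sl2_nat_act !coord2E !(mulr0, mulr1, add0r, addr0, subr0) => a0 c0 b0.
by apply: vec3P; rewrite coord3E.
Qed.

Lemma sl2_adjoint_faithful : faithful (sl2_adjoint K).
Proof.
move=> x x0; have Ee := x0 ee; have Eh := x0 hh.
have := congr1 (@ce K) Ee; have := congr1 (@ce K) Eh; have := congr1 (@cf K) Eh.
rewrite /= /sl2_br /ee /hh !coord3E !(mulr0, mulr1, add0r, addr0, subr0, sub0r, mulrN) => c0 a0 b0.
apply: vec3P; rewrite coord3E; apply: (mulfI two0); rewrite mulr0 //.
by apply/eqP; rewrite -oppr_eq0 a0.
Qed.

Lemma sl2_stabilizers_differ :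
  ~ (forall x : g, stabilizer (V := sl2_natural K) (@integer_row K 2) x <->
                   stabilizer (V := sl2_adjoint K) (@integer_row K 3) x).
Proof.
move=> /(_ (2^-1 *: hh))[_ sadj].
have /sadj snat : stabilizer (V := sl2_adjoint K) (@integer_row K 3) (2^-1 *: hh).
  move=> v /integer_row3[Ie Ih If].
  rewrite /= (_ : sl2_br _ _ = vec3 (ce v) 0 (- cf v)).
    apply/integer_row3; rewrite !coord3E; split=> //; first exact: is_integer0.
    exact: is_integerN.
  by apply: vec3P; rewrite /= /sl2_br /hh !coord3E; field.
have /snat/integer_row2[] : integer_row (vec2 1 0 : 'rV[K]_2).
  by apply/integer_row2; rewrite !coord2E; split; [apply: is_integer1 | apply: is_integer0].
rewrite /= /sl2_nat_act /hh !coord2E !coord3E !(mulr1, mulr0, addr0) => -[z Ez] _.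
have : (1 : int) = 2 * z.
  apply: (intr_inj_char0 charK); rewrite intrM -Ez.
  by rewrite mulfV.
lia.
Qed.

End Sl2Modules.

(** Directness of the sum is expressed by the clause on vanishing sums, and dependence on the module
    by one algebra with one Chevalley basis and two faithful modules whose stabilizers differ. *)
Theorem theorem5p1p4 (K : closedFieldType) (charK : [pchar K] =i pred0) :
  (forall (g : lieSuper K) (C : chevalleyBasis g) (V : superModule g)
      (M : V -> Prop),
    classical g ->
    ~ type_A11 g -> ~ type_P g 3 -> (forall n, ~ type_Q g n) ->
    ~ type_D21_nonint g ->
    rational C V -> admissible C M -> faithful V ->
    [/\ forall x : g, stabilizer M x <->
          exists (y : g) (n : lat (cdatum C) -> int),
            integral_cartan C V y /\
            x = y + \sum_(al <- croots C) cX C al *~ n al,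
        forall (y : g) (n : lat (cdatum C) -> int),
          integral_cartan C V y ->
          y + \sum_(al <- croots C) cX C al *~ n al = 0 ->
          y = 0 /\ (forall al, al \in croots C -> n al = 0),
        is_lattice (stabilizer M)
      & forall M' : V -> Prop, admissible C M' ->
          forall x : g, stabilizer M' x <-> stabilizer M x])
  /\
  (exists (g : lieSuper K) (C : chevalleyBasis g) (V V' : superModule g)
      (M : V -> Prop) (M' : V' -> Prop),
    [/\ classical g,
        [/\ ~ type_A11 g, ~ type_P g 3, forall n, ~ type_Q g n
          & ~ type_D21_nonint g],
        [/\ rational C V, admissible C M & faithful V],
        [/\ rational C V', admissible C M' & faithful V']
      & ~ (forall x : g, stabilizer M x <-> stabilizer M' x)]).
Proof.
split=> [g C V M _ _ notP3 _ _ ratV admM faithV|].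
  have stabP M' := @stabilizerP K charK g C V notP3 ratV faithV M'.
  split=> [x|y n Iy|| M' admM' x].
  - exact: stabP.
  - exact: (stabilizer_direct charK Iy).
  - exact: stabilizer_lattice admM.
  by split=> [/(stabP M' x admM')/(stabP M x admM)|/(stabP M x admM)/(stabP M' x admM')].
have [C [CE HE odE XE]] := sl2_chevalley charK.
exists (sl2 K), C, (sl2_natural K), (sl2_adjoint K), (@integer_row K 2), (@integer_row K 3).
split.
- exact: sl2_classical.
- split.
  + by apply: even_not_A11; apply: sl2_odd.
  + by apply: even_not_P => //; apply: sl2_odd.
  + by move=> n; apply: even_not_Q; apply: sl2_odd.
  + by apply: even_not_D21_nonint; apply: sl2_odd.
- split; [exact: sl2_natural_rational | | exact: sl2_natural_faithful].
  exact: sl2_natural_admissible.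
- split; [exact: sl2_adjoint_rational | | exact: sl2_adjoint_faithful].
  exact: sl2_adjoint_admissible.
exact: sl2_stabilizers_differ.
Qed.
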